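(* Let $S\subset\mathbb{R}$ be a finite union of bounded intervals of positive length. Then there exists a set $\Lambda\subset\mathbb{R}$ such that the system $\{e^{i\lambda t}\}_{\lambda\in\Lambda}$ is a Riesz basis of $L^2(S)$. Moreover, if $S\subseteq[0,2\pi]$, then $\Lambda$ may be chosen so that $\Lambda\subseteq\mathbb{Z}$.
   Context: A system $\{f_n\}$ in a separable Hilbert space $H$ is a Riesz basis if it is the image of an orthonormal basis under a bounded invertible operator. Equivalently, it is complete in $H$ and there exist constants $0<c\le C$ such that $c\sum|a_n|^2\le\|\sum a_nf_n\|^2\le C\sum|a_n|^2$ for all $\{a_n\}\in\ell^2$. *)

(* Defs.v *)
From mathcomp Require Import all_boot all_algebra.
From mathcomp Require Import all_classical all_reals all_analysis.
From mathcomp Require Export complex.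
Import GRing.Theory Num.Theory numFieldNormedType.Exports.
Set Implicit Arguments.
Unset Strict Implicit.
Unset Printing Implicit Defensive.
Local Open Scope classical_set_scope.
Local Open Scope ring_scope.

Section RieszDefs.
Variable R : realType.

Definition sqabs (z : R[i]) : R := complex.Re z ^+ 2 + complex.Im z ^+ 2.

Definition L2sqnorm (S : set R) (f : R -> R[i]) : \bar R :=
  (\int[lebesgue_measure]_(x in S) (sqabs (f x))%:E)%E.

Definition inL2 (S : set R) (f : R -> R[i]) : Prop :=
  measurable_fun S (fun x => complex.Re (f x)) /\
  measurable_fun S (fun x => complex.Im (f x)) /\
  (L2sqnorm S f < +oo)%E.

Definition expi (lam : R) : R -> R[i] :=
  fun t => Complex (cos (lam * t)) (sin (lam * t)).

Definition lincomb (a : nat -> R[i]) (f : nat -> R -> R[i]) (N : nat) : R -> R[i] :=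
  fun t => \sum_(k < N) a k * f k t.

Definition ell2 (a : nat -> R[i]) : Prop :=
  cvgn (series (fun k => sqabs (a k))).

Definition ell2sqnorm (a : nat -> R[i]) : R :=
  limn (series (fun k => sqabs (a k))).

Definition complete_in (S : set R) (f : nat -> R -> R[i]) : Prop :=
  forall g, inL2 S g -> forall eps : R, 0 < eps ->
    exists (N : nat) (a : nat -> R[i]),
      (L2sqnorm S (fun t => (g t - lincomb a f N t)%R) < eps%:E)%E.

Definition riesz_basis (S : set R) (f : nat -> R -> R[i]) : Prop :=
  (forall k, inL2 S (f k)) /\
  complete_in S f /\
  exists c C : R, 0 < c /\ c <= C /\
    forall a, ell2 a ->
      exists g, inL2 S g /\
        (fun N => L2sqnorm S (fun t => (lincomb a f N t - g t)%R)) @ \oo --> 0%E /\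
        ((c * ell2sqnorm a)%:E <= L2sqnorm S g)%E /\
        (L2sqnorm S g <= (C * ell2sqnorm a)%:E)%E.

Definition finite_union_of_intervals (S : set R) : Prop :=
  exists (n : nat) (I : 'I_n -> interval R),
    (0 < n)%N /\
    (forall i, exists (b1 b2 : bool) (x y : R),
        x < y /\ I i = Interval (BSide b1 x) (BSide b2 y)) /\
    S = \bigcup_(i in [set: 'I_n]) [set` I i].

End RieszDefs.

(* Main.v *)
Require Import Defs.
From mathcomp Require Import all_boot all_order all_algebra.
From mathcomp Require Import all_classical all_reals all_analysis.
From mathcomp Require Import measurable_realfun complex ring lra zify.
Import Order.TTheory GRing.Theory Num.Theory numFieldNormedType.Exports.
Set Implicit Arguments.
Unset Strict Implicit.
Unset Printing Implicit Defensive.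
Local Open Scope classical_set_scope.
Local Open Scope ring_scope.

(** The argument is that of Kozma and Nitzan. Call a T-periodic set A good if, for some set L of
integers, the exponentials of frequencies 2 pi z / T with z in L satisfy a lower Riesz inequality
on A and are total in L^2(A).

A short arc of length l is good: the frequencies floor(k T / l) are a small perturbation of the
orthogonal system of frequencies k T / l.

Let T = N h and let A_m be the set of the t for which more than m of the points t + j h, j < N,
lie in A. If every A_m, as an h-periodic set, is good with frequencies L_m, then A is good with the
union of the sets N L_m + m: on a fibre with k points of A only the residues m < k matter, and they
are determined by the values on the fibre through a k x k Vandermonde system.

The sets A_m are the superlevel sets of the h-periodic function obtained by folding the indicator
of A, which has the same number of jumps as A. A superlevel set has as many jumps only if the
jumps, in cyclic order, alternate; its length is then determined modulo 1, so comparison with an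
arc bounds the square of the signed exponential sum of the jumps. The mean of this square over N is
the number of jumps (once coinciding jumps of opposite sign have been cancelled), while the mean of
the bound is at most 2. Hence for more than two jumps some N makes the number of jumps of every A_m
smaller, and induction leaves a single arc, which folding by a suitable N makes short. *)

(** * Complex numbers and the unit circle *)

(** A good set is asked only for a lower inequality and totality: for frequencies in the lattice of
    step 2 pi / T the upper inequality holds on every part of a period by Parseval, and for T = 2 pi
    the lattice is that of the integers, which is the second claim. The obstacle is that Riesz bases
    of two sets do not in general combine into one of their union. Superlevel sets of the fibre
    count avoid it because the system of residues is triangular: on the fibres with more than m
    points the mode of residue m is determined once those of larger residue are known. Both the
    inequality and the approximation are therefore obtained downwards from m = N - 1, with constants
    that depend on N but not on the fibre. Making the last arc as short as desired, and not just an
    arc, spares the stability theorems of Kadec or Avdonin: when the phase errors over the arc are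
    at most 1/12, rounding the frequencies is controlled by an elementary argument on the binary
    digits of the rounding errors. *)

Section ComplexBasics.
Variable R : realType.
Local Notation C := R[i].
Local Notation Re := complex.Re.
Local Notation Im := complex.Im.
Implicit Types z w : C.

Lemma cReD z w : Re (z + w) = Re z + Re w. Proof. by case: z w => [a b] []. Qed.
Lemma cImD z w : Im (z + w) = Im z + Im w. Proof. by case: z w => [a b] []. Qed.
Lemma cReN z : Re (- z) = - Re z. Proof. by case: z. Qed.
Lemma cImN z : Im (- z) = - Im z. Proof. by case: z. Qed.
Lemma cReM z w : Re (z * w) = Re z * Re w - Im z * Im w.
Proof. by case: z w => [a b] []. Qed.
Lemma cImM z w : Im (z * w) = Re z * Im w + Im z * Re w.
Proof. by case: z w => [a b] []. Qed.

Lemma Re_sum (I : Type) (s : seq I) (P : pred I) (F : I -> C) :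
  Re (\sum_(i <- s | P i) F i) = \sum_(i <- s | P i) Re (F i).
Proof.
by elim: s => [|x s IH]; rewrite ?big_nil// !big_cons; case: ifP => // _; rewrite cReD IH.
Qed.
Lemma Im_sum (I : Type) (s : seq I) (P : pred I) (F : I -> C) :
  Im (\sum_(i <- s | P i) F i) = \sum_(i <- s | P i) Im (F i).
Proof.
by elim: s => [|x s IH]; rewrite ?big_nil// !big_cons; case: ifP => // _; rewrite cImD IH.
Qed.

Lemma sqabs_ge0 z : 0 <= sqabs z.
Proof. by rewrite /sqabs addr_ge0// sqr_ge0. Qed.
Lemma sqabs0 : sqabs (0 : C) = 0. Proof. by rewrite /sqabs /= expr0n addr0. Qed.
Lemma sqabs1 : sqabs (1 : C) = 1. Proof. by rewrite /sqabs /= expr0n expr1n addr0. Qed.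
Lemma sqabsN z : sqabs (- z) = sqabs z.
Proof. by rewrite /sqabs cReN cImN !sqrrN. Qed.
Lemma sqabsB z w : sqabs (z - w) = sqabs (w - z).
Proof. by rewrite -sqabsN opprB. Qed.
Lemma sqabsM z w : sqabs (z * w) = sqabs z * sqabs w.
Proof. rewrite /sqabs cReM cImM; ring. Qed.
Lemma sqabs_real (x : R) : sqabs (x%:C%C) = x ^+ 2.
Proof. by rewrite /sqabs/= expr0n addr0. Qed.

(** The free weight lets one inequality serve three times: s = 1 gives the crude factor 2, s = n
    gives Cauchy-Schwarz by induction, and the ratio of two norms gives Minkowski's inequality. *)
Lemma sqabsD_weighted (s : R) z w : 0 < s ->
  sqabs (z + w) <= (1 + s) * sqabs z + (1 + s^-1) * sqabs w.
Proof.
move=> s0; rewrite /sqabs cReD cImD.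
have key (x y : R) : (x + y) ^+ 2 <= (1 + s) * x ^+ 2 + (1 + s^-1) * y ^+ 2.
  rewrite -subr_ge0.
  have -> : (1 + s) * x ^+ 2 + (1 + s^-1) * y ^+ 2 - (x + y) ^+ 2
          = s * (x - s^-1 * y) ^+ 2 by field; rewrite gt_eqF.
  by rewrite mulr_ge0 ?sqr_ge0// ltW.
have := key (Re z) (Re w); have := key (Im z) (Im w); lra.
Qed.

Lemma sqabsD z w : sqabs (z + w) <= 2 * sqabs z + 2 * sqabs w.
Proof. by have := sqabsD_weighted z w ltr01; rewrite invr1. Qed.

Lemma sqabs_sum (I : Type) (s : seq I) (F : I -> C) :
  sqabs (\sum_(i <- s) F i) <= (size s)%:R * \sum_(i <- s) sqabs (F i).
Proof.
elim: s => [|x s IH]; first by rewrite !big_nil sqabs0 mulr0.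
rewrite !big_cons /=.
case: s IH => [|y s] IH; first by rewrite !big_nil !addr0 mul1r.
set n := size (y :: s) in IH *; set S := \sum_(i <- _) _ in IH *.
set V := \sum_(i <- _) _ in IH *.
have n0 : 0 < n%:R :> R by rewrite ltr0n.
(* The weight n turns the factor (1 + 1/n) * n of the tail into n + 1. *)
apply: le_trans (sqabsD_weighted _ _ n0) _.
have -> : n.+1%:R = 1 + n%:R :> R by rewrite -natr1 addrC.
rewrite [leRHS]mulrDr lerD2l.
have -> : 1 + n%:R^-1 = (1 + n%:R) / n%:R :> R by field; rewrite gt_eqF.
rewrite -mulrA ler_wpM2l ?addr_ge0//.
by rewrite ler_pdivrMl.
Qed.

Lemma floor_itvP (x : R) : (Num.floor x)%:~R <= x < (Num.floor x)%:~R + 1.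
Proof.
have := floor_itv x; rewrite intrD; exact.
Qed.

Definition cis (x : R) : C := Complex (cos x) (sin x).

Lemma cisD x y : cis (x + y) = cis x * cis y.
Proof.
apply/eqP; rewrite eq_complex cReM cImM /= cosD sinD eqxx /=.
by rewrite [cos x * _ + _]addrC.
Qed.
Lemma cis0 : cis 0 = 1. Proof. by rewrite /cis cos0 sin0. Qed.
Lemma sqabs_cis x : sqabs (cis x) = 1.
Proof. by rewrite /sqabs /= cos2Dsin2. Qed.
Lemma cisNM x : cis (- x) * cis x = 1.
Proof. by rewrite -cisD addNr cis0. Qed.
Lemma cis_natM n x : cis (n%:R * x) = cis x ^+ n.
Proof.
elim: n => [|n IH]; first by rewrite mul0r cis0 expr0.
by rewrite -natr1 mulrDl mul1r cisD IH exprSr.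
Qed.
Lemma cis_2pi_nat n : cis (2 * pi * n%:R) = 1.
Proof.
rewrite mulrC cis_natM (_ : cis _ = 1) ?expr1n//.
by rewrite /cis mulr_natl cos2pi sin2pi.
Qed.
Lemma cis_2pi_int (z : int) : cis (2 * pi * z%:~R) = 1.
Proof.
case: z => n; first exact: cis_2pi_nat.
rewrite NegzE mulrNz mulrN.
by have := cisNM (2 * pi * n.+1%:R); rewrite cis_2pi_nat mulr1.
Qed.

Lemma cos_2pi_eq1 (x : R) : cos (2 * pi * x) = 1 -> x = (Num.floor x)%:~R.
Proof.
set z := Num.floor x => h; have /andP[r0 r1] := floor_itvP x.
pose r := x - z%:~R.
have cr : cos (2 * pi * r) = 1.
  suff : cis (2 * pi * r) = cis (2 * pi * x) by case=> ->.
  by rewrite -(mulr1 (cis _)) -(cis_2pi_int z) -cisD -mulrDr subrK.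
have [r_eq0|rn0] := eqVneq r 0; first by apply/eqP; rewrite -subr_eq0 -/r r_eq0.
have s0 : 0 < sin (pi * r).
  apply: sin_gt0_pi; rewrite mulr_gt0 ?pi_gt0 ?lt0r ?rn0 ?subr_ge0//=.
  by rewrite -[ltRHS]mulr1 ltr_pM2l ?pi_gt0// ltrBlDl.
have : sin (pi * r) ^+ 2 = 0.
  have := cos2Dsin2 (pi * r); have := cos_mulr2n (pi * r).
  have -> : pi * r *+ 2 = 2 * pi * r by rewrite mulr2n; ring.
  by rewrite cr; lra.
by move/eqP; rewrite sqrf_eq0 gt_eqF.
Qed.

Lemma cis_2pi_eq1 (x : R) : cis (2 * pi * x) = 1 -> x = (Num.floor x)%:~R.
Proof. by case=> h _; exact: cos_2pi_eq1. Qed.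

Lemma sqabsE z : (sqabs z)%:C%C = z * z^*%C.
Proof.
case: z => a b; apply/eqP; rewrite eq_complex cReM cImM /sqabs /=.
by apply/andP; split; apply/eqP; ring.
Qed.

Lemma cis_conj x : (cis x)^*%C = cis (- x).
Proof. by rewrite /cis /= cosN sinN. Qed.

End ComplexBasics.

(** * Integrals over a window *)

Section WindowIntegral.
Variable R : realType.
Local Notation mu := (@lebesgue_measure R).
Implicit Types (F G : R -> R) (w T : R).

(** Half-open windows tile the line exactly, so splitting and folding involve no null sets. *)
Definition wint w T F : \bar R := (\int[mu]_(x in `[w, (w + T)%R[) (F x)%:E)%E.

Definition nnmeas F := (forall x, 0 <= F x) /\ measurable_fun setT F.

Lemma nnmeasD F G : nnmeas F -> nnmeas G -> nnmeas (fun x => F x + G x).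
Proof.
move=> [F0 mF] [G0 mG]; split=> [x|]; first exact: addr_ge0.
exact: measurable_funD.
Qed.

Lemma nnmeasM F G : nnmeas F -> nnmeas G -> nnmeas (fun x => F x * G x).
Proof.
move=> [F0 mF] [G0 mG]; split=> [x|]; first exact: mulr_ge0.
exact: measurable_funM.
Qed.

Lemma nnmeas_cst c : 0 <= c -> nnmeas (fun=> c).
Proof. by move=> c0; split. Qed.

Lemma nnmeas_sum (I : Type) (s : seq I) (F : I -> R -> R) :
  (forall i, nnmeas (F i)) -> nnmeas (fun x => \sum_(i <- s) F i x).
Proof.
move=> h; split=> [x|]; first by apply: sumr_ge0 => i _; case: (h i).
by apply: measurable_sum => i; case: (h i).
Qed.

Lemma measurable_shift (c : R) : measurable_fun setT (fun x : R => x + c).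
Proof. by apply: measurable_funD; [exact: measurable_id|exact: measurable_cst]. Qed.

Lemma nnmeas_comp F (phi : R -> R) : measurable_fun setT phi ->
  nnmeas F -> nnmeas (fun x => F (phi x)).
Proof. by move=> mphi [F0 mF]; split=> [x //|]; exact: (measurableT_comp mF mphi). Qed.

Lemma nnmeas_shift F c : nnmeas F -> nnmeas (fun x => F (x + c)).
Proof. by move=> mF; exact: (nnmeas_comp (measurable_shift c) mF). Qed.

Lemma nnmeasE F D : nnmeas F -> measurable_fun D (fun x => (F x)%:E).
Proof. by move=> [_ mF]; apply/measurable_EFinP; exact: measurable_funTS. Qed.

Lemma wint_ge0 w T F : (forall x, 0 <= F x) -> (0 <= wint w T F)%E.
Proof. by move=> F0; apply: integral_ge0 => x _; rewrite lee_fin. Qed.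

Lemma wint_le w T F G : nnmeas F -> nnmeas G ->
  (forall x, w <= x < w + T -> F x <= G x) -> (wint w T F <= wint w T G)%E.
Proof.
move=> mF mG FG.
apply: (@ge0_le_integral _ _ _ mu) => //; try exact: nnmeasE.
  by move=> x _; rewrite lee_fin; case: mF.
Qed.

Lemma wint_eq w T F G : (forall x, w <= x < w + T -> F x = G x) ->
  wint w T F = wint w T G.
Proof.
move=> FG; apply: eq_integral => x; rewrite inE/= in_itv/= => xw.
by rewrite FG.
Qed.

Lemma wintD w T F G : nnmeas F -> nnmeas G ->
  wint w T (fun x => F x + G x) = (wint w T F + wint w T G)%E.
Proof.
move=> mF mG; rewrite /wint -ge0_integralD//.
- by move=> x _; rewrite lee_fin; case: mF.
- exact: nnmeasE.
- by move=> x _; rewrite lee_fin; case: mG.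
- exact: nnmeasE.
Qed.

Lemma wintZ w T c F : 0 <= c -> nnmeas F ->
  wint w T (fun x => c * F x) = (c%:E * wint w T F)%E.
Proof.
move=> c0 mF; rewrite /wint -ge0_integralZl_EFin//.
- by move=> x _; rewrite lee_fin; case: mF.
- exact: nnmeasE.
Qed.

Lemma wint_sum w T (I : Type) (s : seq I) (F : I -> R -> R) :
  (forall i, nnmeas (F i)) ->
  wint w T (fun x => \sum_(i <- s) F i x) = (\sum_(i <- s) wint w T (F i))%E.
Proof.
move=> mF; rewrite /wint -ge0_integral_sum//.
- by apply: eq_integral => x _; rewrite sumEFin.
- by move=> i; exact: nnmeasE.
- by move=> i x _; rewrite lee_fin; case: (mF i).
Qed.

Lemma wint_cst w T c : 0 <= T -> wint w T (fun=> c) = (c * T)%:E.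
Proof.
move=> T0; rewrite /wint integral_cst//= lebesgue_measure_itv/= lte_fin.
rewrite ltrDl; case: ltgtP T0 => // [T0 _|<- _]; last by rewrite mule0 mulr0.
by rewrite -EFinB -EFinM; congr (_ * _)%:E; rewrite addrAC subrr add0r.
Qed.

Lemma wint_translate w T c F : nnmeas F ->
  wint (w + c) T F = wint w T (fun x => F (x + c)).
Proof.
move=> mF; pose phi : R -> measurableTypeR R := fun x => x + c.
have mphi : measurable_fun setT phi by exact: measurable_shift.
rewrite /wint; transitivity
  (\int[pushforward mu phi]_(x in `[(w + c)%R, (w + c + T)%R[) (F x)%:E)%E.
  apply: eq_measure_integral => /= A mA _.
  (* Translation invariance: the image measure has the values of Lebesgue measure on the generating
     half-open intervals. *)
  apply: lebesgue_measure_unique => //= _ [[a b]] _ <-.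
  rewrite /pushforward (_ : phi @^-1` _ = `](a - c)%R, (b - c)%R]%classic).
    rewrite !lebesgue_measure_itv/= !lte_fin ltrD2r.
    by case: ifP => // _; rewrite -!EFinB; congr EFin; ring.
  by apply/seteqP; split=> x /=; rewrite !in_itv/= ltrBlDr lerBrDr.
rewrite ge0_integral_pushforward//=.
- have -> // : phi @^-1` `[(w + c)%R, (w + c + T)%R[ = `[w, (w + T)%R[%classic.
  by apply/seteqP; split=> x /=; rewrite !in_itv/= lerD2r addrAC ltrD2r.
- exact: nnmeasE.
- by move=> x _; rewrite lee_fin; case: mF.
Qed.

Lemma wint_split w S T F : 0 <= S -> 0 <= T -> nnmeas F ->
  wint w (S + T) F = (wint w S F + wint (w + S) T F)%E.
Proof.
move=> S0 T0 mF; rewrite /wint -ge0_integral_setU//.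
- congr (integral _ _ _); apply/seteqP; split => x /=; rewrite !in_itv/= addrA.
    move=> /andP[-> xT]; rewrite xT andbT.
    by case: (ltP x (w + S)) => h; [left|right].
  case=> /andP[h1 h2]; first by rewrite h1 (lt_le_trans h2)// lerDl.
  by rewrite h2 (le_trans _ h1)// lerDl.
- exact: nnmeasE.
- by move=> x _; rewrite lee_fin; case: mF.
- rewrite disj_set2E; apply/eqP/seteqP; split=> // x [] /=; rewrite !in_itv/=.
  by move=> /andP[_ h1] /andP[h2 _]; move: (lt_le_trans h1 h2); rewrite ltxx.
Qed.

Lemma wint_fold w h N F : 0 <= h -> nnmeas F ->
  wint w (N%:R * h) F = wint w h (fun x => \sum_(j < N) F (x + j%:R * h)).
Proof.
move=> h0 mF; rewrite wint_sum; last by move=> i; exact: nnmeas_shift.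
elim: N => [|N IH].
  rewrite big_ord0 mul0r /wint addr0 set_itvco0 integral_set0//.
rewrite big_ord_recr/= -IH -natr1 mulrDl mul1r wint_split ?mulr_ge0//.
by congr (_ + _)%E; rewrite wint_translate.
Qed.

Lemma periodicZ (X : Type) (F : R -> X) T : (forall x, F (x + T) = F x) ->
  forall (z : int) x, F (x + z%:~R * T) = F x.
Proof.
move=> P [n|n] x; first by elim: n => [|n IH]; rewrite ?mul0r ?addr0//
  -pmulrn -natr1 mulrDl mul1r addrA P [_%:R]pmulrn.
rewrite NegzE mulrNz mulNr.
have Pn m y : F (y + m%:R * T) = F y.
  elim: m => [|m IH]; first by rewrite mul0r addr0.
  by rewrite -natr1 mulrDl mul1r addrA P.
by rewrite -(Pn n.+1) pmulrn subrK.
Qed.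

Lemma wint_periodic w T F : 0 < T -> nnmeas F -> (forall x, F (x + T) = F x) ->
  wint w T F = wint 0 T F.
Proof.
move=> T0 mF P.
(* After w is reduced to r in [0, T[, the part of the window beyond T is moved down by one
   period. *)
set z := Num.floor (w / T); pose r := w - z%:~R * T.
have /andP[r0 rT] : 0 <= r < T.
  have /andP[h1 h2] := floor_itvP (w / T).
  rewrite /r subr_ge0 -ler_pdivlMr// h1/= ltrBlDr -[X in X + _]mul1r -mulrDl addrC.
  by rewrite -ltr_pdivrMr.
have -> : wint w T F = wint r T F.
  rewrite -{1}[w](subrK (z%:~R * T)) wint_translate//; apply: wint_eq => x _.
  by rewrite periodicZ.
have Tr : 0 <= T - r by rewrite subr_ge0 ltW.
rewrite -{1}[T](subrK r) wint_split//.
rewrite [r + _]addrC subrK addeC.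
have -> : wint 0 T F = (wint 0 r F + wint r (T - r) F)%E.
  by rewrite -[in LHS](subrKC r T) wint_split// add0r.
congr (_ + _)%E; rewrite -[in LHS](add0r T) wint_translate//.
by apply: wint_eq => x _; rewrite P.
Qed.

End WindowIntegral.

(** * Trigonometric polynomials and Parseval's identity *)

Section ComplexMeasurable.
Variable R : realType.
Local Notation C := R[i].
Local Notation Re := complex.Re.
Local Notation Im := complex.Im.
Implicit Types f g : R -> C.

Definition cmeas f := measurable_fun setT (fun x => Re (f x)) /\
  measurable_fun setT (fun x => Im (f x)).

Lemma cmeas_cst (c : C) : cmeas (fun=> c).
Proof. by split; exact: measurable_cst. Qed.

Lemma cmeasD f g : cmeas f -> cmeas g -> cmeas (fun x => f x + g x).
Proof.
move=> [f1 f2] [g1 g2]; split.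
  by under eq_fun do rewrite cReD; exact: measurable_funD.
by under eq_fun do rewrite cImD; exact: measurable_funD.
Qed.

Lemma cmeasM f g : cmeas f -> cmeas g -> cmeas (fun x => f x * g x).
Proof.
move=> [f1 f2] [g1 g2]; split.
  by under eq_fun do rewrite cReM; apply: measurable_funB; exact: measurable_funM.
by under eq_fun do rewrite cImM; apply: measurable_funD; exact: measurable_funM.
Qed.

Lemma cmeasB f g : cmeas f -> cmeas g -> cmeas (fun x => f x - g x).
Proof.
move=> mf mg; under eq_fun do rewrite -mulN1r.
by apply: cmeasD => //; apply: cmeasM => //; exact: cmeas_cst.
Qed.

Lemma cmeas_sum (I : Type) (s : seq I) (f : I -> R -> C) :
  (forall i, cmeas (f i)) -> cmeas (fun x => \sum_(i <- s) f i x).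
Proof.
move=> mf; split.
  by under eq_fun do rewrite Re_sum; apply: measurable_sum => i; case: (mf i).
by under eq_fun do rewrite Im_sum; apply: measurable_sum => i; case: (mf i).
Qed.

Lemma cmeas_comp f (phi : R -> R) : measurable_fun setT phi -> cmeas f ->
  cmeas (fun x => f (phi x)).
Proof.
by move=> mphi [f1 f2]; split; [exact: (measurableT_comp f1 mphi)|
  exact: (measurableT_comp f2 mphi)].
Qed.

Lemma cmeas_if (b : R -> bool) f g : measurable_fun setT b ->
  cmeas f -> cmeas g -> cmeas (fun x => if b x then f x else g x).
Proof.
move=> mb [f1 f2] [g1 g2]; split.
  rewrite (_ : (fun x => _) = (fun x => if b x then Re (f x) else Re (g x))).
    exact: measurable_fun_ifT.
  by apply/funext => x; case: (b x).
rewrite (_ : (fun x => _) = (fun x => if b x then Im (f x) else Im (g x))).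
  exact: measurable_fun_ifT.
by apply/funext => x; case: (b x).
Qed.

Lemma cmeas_sqabs f : cmeas f -> nnmeas (fun x => sqabs (f x)).
Proof.
move=> [f1 f2]; split=> [x|]; first exact: sqabs_ge0.
by apply: measurable_funD; exact: measurable_funX.
Qed.

Lemma nnmeas_bool (b : R -> bool) : measurable_fun setT b ->
  nnmeas (fun x => (b x)%:R : R).
Proof.
move=> mb; split=> [x|]; first by case: (b x).
rewrite (_ : (fun x => _) = (fun x => if b x then 1 else 0)).
  by apply: measurable_fun_ifT.
by apply/funext => x; case: (b x).
Qed.

Lemma cmeas_cis (phi : R -> R) : measurable_fun setT phi ->
  cmeas (fun x => cis (phi x)).
Proof.
move=> mphi; split => /=.
  apply: (measurableT_comp (f := cos)) => //.
  by apply: continuous_measurable_fun; exact: continuous_cos.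
apply: (measurableT_comp (f := sin)) => //.
by apply: continuous_measurable_fun; exact: continuous_sin.
Qed.

End ComplexMeasurable.

Section TrigPoly.
Variable R : realType.
Local Notation C := R[i].

Definition ch (T : R) (z : int) (t : R) : C := cis (2 * pi * (z%:~R * t / T)).

Definition tpoly (T : R) (s : seq int) (a : int -> C) (t : R) : C :=
  \sum_(z <- s) a z * ch T z t.

Lemma sqabs_ch T z t : sqabs (ch T z t) = 1.
Proof. exact: sqabs_cis. Qed.

Lemma ch0 T t : ch T 0 t = 1.
Proof. by rewrite /ch !mul0r mulr0 cis0. Qed.

Lemma chD T y z t : ch T (y + z) t = ch T y t * ch T z t.
Proof. by rewrite /ch -cisD intrD -mulrDr !mulrDl. Qed.

Lemma chNM T z t : ch T (- z) t * ch T z t = 1.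
Proof. by rewrite -chD addNr ch0. Qed.

Lemma ch_add T z t u : ch T z (t + u) = ch T z t * ch T z u.
Proof. by rewrite /ch -cisD; congr cis; ring. Qed.

Lemma ch_period T z t : T != 0 -> ch T z (t + T) = ch T z t.
Proof. by move=> T0; rewrite ch_add {2}/ch mulfK// cis_2pi_int mulr1. Qed.

Lemma ch_periodZ T z (y : int) t : T != 0 -> ch T z (t + y%:~R * T) = ch T z t.
Proof.
by move=> T0; rewrite ch_add {2}/ch mulrA mulfK// -intrM cis_2pi_int mulr1.
Qed.

Lemma ch_dilate T (N : nat) (q : int) t : (0 < N)%N ->
  ch (T / N%:R) q t = ch T (N%:Z * q) t.
Proof.
move=> N0; rewrite /ch; congr (cis (_ * _)).
by rewrite invf_div intrM -pmulrn; ring.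
Qed.

Lemma cmeas_ch T z : cmeas (ch T z).
Proof.
apply: cmeas_cis; apply: measurable_funM; first exact: measurable_cst.
apply: measurable_funM; last exact: measurable_cst.
by apply: measurable_funM; [exact: measurable_cst|exact: measurable_id].
Qed.

Lemma cmeas_tpoly T s a : cmeas (tpoly T s a).
Proof.
by apply: cmeas_sum => z; apply: cmeasM; [exact: cmeas_cst|exact: cmeas_ch].
Qed.

Lemma tpoly_period T s a t : T != 0 -> tpoly T s a (t + T) = tpoly T s a t.
Proof. by move=> T0; apply: eq_bigr => z _; rewrite ch_period. Qed.

Lemma sum_roots_of_unity (M : nat) (k : int) : `|k|%N != 0 -> (`|k| < M)%N ->
  \sum_(j < M) ch (M%:R : R) k j%:R = 0.
Proof.
move=> k0 kM; have M0 : (0 < M)%N by apply: leq_ltn_trans kM.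
have Mr : M%:R != 0 :> R by rewrite pnatr_eq0 -lt0n.
pose x := ch (M%:R : R) k 1.
have xj j : ch (M%:R : R) k j%:R = x ^+ j.
  by rewrite /x /ch -cis_natM; congr cis; ring.
have xM : x ^+ M = 1 by rewrite -xj -[X in ch _ _ X]add0r ch_period// /ch mulr0 mul0r mulr0 cis0.
have : (x - 1) * (\sum_(j < M) ch (M%:R : R) k j%:R) = 0.
  by under eq_bigr do rewrite xj; rewrite -subrX1 xM subrr.
move/eqP; rewrite mulf_eq0 => /orP[|/eqP//]; rewrite subr_eq0 => /eqP x1.
exfalso; have := cis_2pi_eq1 x1; rewrite mulr1; set z := Num.floor _.
move=> /(congr1 (fun u => u * M%:R)); rewrite divfK// pmulrn -intrM.
move=> /eqP; rewrite eqr_int => /eqP kz; move: k0 kM; rewrite kz abszM absz_nat.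
by case: (absz z) => // n _; rewrite ltnNge mulSn leq_addr.
Qed.

(* Discrete Parseval: for M larger than all frequency differences the off-diagonal terms
   are full sums over nontrivial M-th roots of unity. *)
Lemma discrete_parseval (s : seq int) (a : int -> C) (M : nat) T t :
  0 < T -> uniq s -> (forall y z, y \in s -> z \in s -> (`|y - z| < M)%N) ->
  \sum_(j < M) sqabs (tpoly (M%:R * T) s a (t + j%:R * T)) =
  M%:R * \sum_(z <- s) sqabs (a z).
Proof.
move=> T0 us sM.
have [->|M0] := posnP M; first by rewrite big_ord0 mul0r.
have Mr : M%:R != 0 :> R by rewrite pnatr_eq0 -lt0n.
apply: (@complexI R).
rewrite rmorphM rmorph_nat !rmorph_sum /=.
pose b z := a z * ch (M%:R * T) z t.
have bE j : tpoly (M%:R * T) s a (t + j%:R * T) =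
    \sum_(z <- s) b z * ch (M%:R : R) z j%:R.
  apply: eq_bigr => z _; rewrite ch_add mulrA; congr (_ * _).
  by rewrite /ch; congr cis; congr (_ * _); rewrite mulrA -mulf_div divff ?gt_eqF// mulr1.
under eq_bigr => j _.
  rewrite sqabsE bE rmorph_sum big_distrlr /=.
  under eq_bigr => y _.
    under eq_bigr => z _.
      rewrite rmorphM /= [X in _ * (_ * X)]cis_conj.
      rewrite (_ : _ * _ * _ = b y * (b z)^*%C * ch (M%:R : R) (y - z) j%:R); last first.
        rewrite chD mulrACA; congr (_ * (_ * _)); rewrite /ch; congr cis.
        by rewrite intrN; ring.
      over.
    over.
  over.
rewrite exchange_big mulr_sumr big_seq [RHS]big_seq; apply: eq_bigr => y ys.
rewrite exchange_big (bigD1_seq y)//= [X in _ + X]big_seq_cond [X in _ + X]big1 ?addr0.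
  under eq_bigr do rewrite subrr ch0 mulr1.
  rewrite sumr_const card_ord -[LHS]mulr_natl; congr (_ * _).
  by rewrite -sqabsE /b sqabsM sqabs_ch mulr1.
move=> z /andP[zs zy]; rewrite -mulr_sumr sum_roots_of_unity ?mulr0 ?sM//.
by rewrite absz_eq0 subr_eq0 eq_sym.
Qed.

(** Folding the window into M equal parts makes the integrand constant by the discrete identity, so
    no exponential has to be integrated. *)
Lemma parseval w T (s : seq int) (a : int -> C) : 0 < T -> uniq s ->
  wint w T (fun x => sqabs (tpoly T s a x)) = (T * \sum_(z <- s) sqabs (a z))%:E.
Proof.
move=> T0 us.
have [M M0 sM] : exists2 M : nat, (0 < M)%N &
    forall y z, y \in s -> z \in s -> (`|y - z| < M)%N.
  exists (\sum_(y <- s) \sum_(z <- s) `|y - z|).+1%N => // y z ys zs.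
  rewrite ltnS (big_rem y)//= (big_rem z zs)/= -addnA; exact: leq_addr.
have Mr : 0 < M%:R :> R by rewrite ltr0n.
pose h := T / M%:R; have h0 : 0 < h by rewrite divr_gt0.
have Th : T = M%:R * h by rewrite /h mulrC divfK// gt_eqF.
rewrite {1}Th wint_fold ?ltW//; last exact/cmeas_sqabs/cmeas_tpoly.
rewrite (@wint_eq _ _ _ _ (fun=> M%:R * \sum_(z <- s) sqabs (a z))).
  by rewrite wint_cst ?ltW// mulrAC -Th.
by move=> x _; rewrite -(@discrete_parseval s a M h x)// -Th.
Qed.

End TrigPoly.

(** * Riesz sequences and total systems on a window *)

Section RieszProperties.
Variable R : realType.
Local Notation C := R[i].
Implicit Types (A : R -> bool) (f g : R -> C) (L : set int) (w T : R).

Definition N2 w T A f : \bar R := wint w T (fun x => (A x)%:R * sqabs (f x)).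

(** Coefficients live on all integers and vanish off [L], so a list of summands may contain
    frequencies outside [L]; this eases merging and splitting of sums. *)
Definition supported L (a : int -> C) := forall z, ~ L z -> a z = 0.

Definition lowerL2 w T A L := exists2 c : R, 0 < c &
  forall s a, uniq s -> supported L a ->
    ((c * \sum_(z <- s) sqabs (a z))%:E <= N2 w T A (tpoly T s a))%E.

Definition totalL2 w T A L := forall g, cmeas g -> (N2 w T A g < +oo)%E ->
  forall eps : R, 0 < eps -> exists s a, [/\ uniq s, supported L a &
    (N2 w T A (fun x => g x - tpoly T s a x)%R <= eps%:E)%E].

(** Infinity of [L] allows the frequencies to be enumerated by the natural numbers at the end. It is
    conditional because the empty set is good with no frequencies at all. *)
Definition good T A := exists L, [/\ (exists2 x, 0 <= x < T & A x) -> infinite_set L,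
  lowerL2 0 T A L & totalL2 0 T A L].

Lemma nnmeas_N2 A f : measurable_fun setT A -> cmeas f ->
  nnmeas (fun x => (A x)%:R * sqabs (f x)).
Proof.
by move=> mA mf; apply: nnmeasM; [exact: nnmeas_bool|exact: cmeas_sqabs].
Qed.

Lemma N2_ge0 w T A f : (0 <= N2 w T A f)%E.
Proof. by apply: wint_ge0 => x; rewrite mulr_ge0// sqabs_ge0. Qed.

Lemma N2_eq w T A f g : (forall x, w <= x < w + T -> A x -> f x = g x) ->
  N2 w T A f = N2 w T A g.
Proof.
move=> fg; apply: wint_eq => x xw; case: (boolP (A x)) => Ax; last by rewrite !mul0r.
by rewrite fg.
Qed.

Lemma N2D_weighted w T A f g (s : R) : measurable_fun setT A -> cmeas f -> cmeas g ->
  0 < s -> (N2 w T A (fun x => f x + g x)%R <=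
     (1 + s)%:E * N2 w T A f + (1 + s^-1)%:E * N2 w T A g)%E.
Proof.
move=> mA mf mg s0; have s1 : 0 <= s^-1 by rewrite invr_ge0 ltW.
have s2 : 0 <= s by exact: ltW.
rewrite -!wintZ ?addr_ge0//; try exact: nnmeas_N2.
have nn c h : 0 <= c -> cmeas h -> nnmeas (fun x => c * ((A x)%:R * sqabs (h x))).
  by move=> c0 mh; apply: nnmeasM; [exact: nnmeas_cst|exact: nnmeas_N2].

rewrite -wintD; try by apply: nn => //; rewrite addr_ge0.
apply: wint_le => [||x _].
- by apply: nnmeas_N2 => //; exact: cmeasD.
- by apply: nnmeasD; apply: nn => //; rewrite addr_ge0.
- by case: (A x); rewrite ?mul0r ?mulr0 ?addr0// !mul1r; exact: sqabsD_weighted.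
Qed.

(** Minkowski's inequality for squared norms; the optimal weight is y / x, whence the strict
    positivity of both bounds. *)
Lemma N2D w T A f g (x y : R) : measurable_fun setT A -> cmeas f -> cmeas g ->
  0 < x -> 0 < y -> (N2 w T A f <= (x ^+ 2)%:E)%E -> (N2 w T A g <= (y ^+ 2)%:E)%E ->
  (N2 w T A (fun t => f t + g t)%R <= ((x + y) ^+ 2)%:E)%E.
Proof.
move=> mA mf mg x0 y0 fx gy.
have s0 : 0 < y / x by rewrite divr_gt0.
apply: le_trans (N2D_weighted _ _ mA mf mg s0) _.
have -> : (x + y) ^+ 2 = (1 + y / x) * x ^+ 2 + (1 + (y / x)^-1) * y ^+ 2.
  by field; rewrite !gt_eqF.
by rewrite [leRHS]EFinD; apply: leeD; rewrite EFinM lee_wpmul2l// lee_fin addr_ge0// ?invr_ge0 ltW.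
Qed.

Lemma N2B_comm w T A f g :
  N2 w T A (fun x => f x - g x)%R = N2 w T A (fun x => g x - f x)%R.
Proof. by apply: wint_eq => x _; rewrite sqabsB. Qed.

(** The upper Riesz inequality, valid for any set of frequencies: enlarge [A] to the whole period
    and apply Parseval. *)
Lemma N2_tpoly_fin w T A s a : 0 < T -> measurable_fun setT A -> uniq s ->
  (N2 w T A (tpoly T s a) <= (T * \sum_(z <- s) sqabs (a z))%:E)%E.
Proof.
move=> T0 mA us; rewrite -(parseval w)//; apply: wint_le => [||x _].
- by apply: nnmeas_N2 => //; exact: cmeas_tpoly.
- exact/cmeas_sqabs/cmeas_tpoly.
- by case: (A x); rewrite ?mul1r// mul0r sqabs_ge0.
Qed.

Lemma measurable_floor : measurable_fun setT (fun x : R => (Num.floor x)%:~R : R).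
Proof.
apply: nondecreasing_measurable => // x y xy.
by rewrite ler_int; exact: le_floor.
Qed.

Lemma measurable_reduce b T :
  measurable_fun setT (fun x : R => x - (Num.floor ((x - b) / T))%:~R * T).
Proof.
apply: measurable_funB; first exact: measurable_id.
apply: measurable_funM; last exact: measurable_cst.
apply: (measurableT_comp measurable_floor).
apply: measurable_funM; last exact: measurable_cst.
exact: measurable_shift.
Qed.

Lemma lower_window w v T A L : 0 < T -> measurable_fun setT A ->
  (forall x, A (x + T) = A x) -> lowerL2 v T A L -> lowerL2 w T A L.
Proof.
move=> T0 mA PA [c c0 H]; exists c => // s a us La.
have e u : N2 u T A (tpoly T s a) = N2 0 T A (tpoly T s a).
  rewrite /N2 (wint_periodic u)//; first by apply: nnmeas_N2 => //; exact: cmeas_tpoly.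
  by move=> x; rewrite PA tpoly_period// gt_eqF.
by rewrite e -(e v); exact: H.
Qed.

Lemma total_window w v T A L : 0 < T -> measurable_fun setT A ->
  (forall x, A (x + T) = A x) -> totalL2 v T A L -> totalL2 w T A L.
Proof.
move=> T0 mA PA H g mg gfin eps eps0.
(* Only the values of [g] on the window at w count, so [g] is replaced by its periodic extension
   [g'] from that window. *)
pose rho x := x - (Num.floor ((x - w) / T))%:~R * T.
pose g' x := g (rho x).
have mg' : cmeas g' by apply: cmeas_comp => //; exact: measurable_reduce.
have rhoT x : rho (x + T) = rho x.
  rewrite /rho (_ : (x + T - w) / T = (x - w) / T + 1%:~R); last first.
    by rewrite addrAC mulrDl divff// gt_eqF.
  by rewrite floorDrz// floor1 intrD mulrDl mul1r; ring.
have g'T x : g' (x + T) = g' x by rewrite /g' rhoT.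
have g'g x : w <= x < w + T -> g' x = g x.
  move=> /andP[x1 x2]; rewrite /g' /rho.
  suff -> : Num.floor ((x - w) / T) = 0 by rewrite mul0r subr0.
  by apply/eqP; rewrite floor_eq/= add0r divr_ge0 ?subr_ge0 ?(ltW T0)//= ltr_pdivrMr// mul1r ltrBlDl.
have shift f : cmeas f -> (forall x, f (x + T) = f x) -> N2 v T A f = N2 w T A f.
  move=> mf fT; rewrite /N2 (wint_periodic v)// 1?(wint_periodic w)//.
  - exact: nnmeas_N2.
  - by move=> x; rewrite PA fT.
  - exact: nnmeas_N2.
  - by move=> x; rewrite PA fT.
have [|s [a [us La Hs]]] := H g' mg' _ eps eps0.
  rewrite shift// (N2_eq (g := g))// => x xw _; exact: g'g.
exists s, a; split=> //; rewrite shift// in Hs.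
- by rewrite (N2_eq (g := fun x => g' x - tpoly T s a x))// => x xw _; rewrite g'g.
- by apply: cmeasB => //; exact: cmeas_tpoly.
- by move=> x; rewrite g'T tpoly_period// gt_eqF.
Qed.

(** Translation multiplies the coefficients by unimodular constants, which affects neither their
    squares nor their support; hence goodness is translation invariant with the same [L]. *)
Lemma tpoly_shift T s (a : int -> C) x u :
  tpoly T s a (x + u) = tpoly T s (fun z => a z * ch T z u) x.
Proof. by apply: eq_bigr => z _; rewrite ch_add mulrAC mulrA. Qed.

Lemma lower_translate w T A L : measurable_fun setT A ->
  lowerL2 0 T (fun x => A (x + w)) L -> lowerL2 w T A L.
Proof.
move=> mA [c c0 H]; exists c => // s a us La.
rewrite /N2 -{1}[w]add0r wint_translate; last by apply: nnmeas_N2 => //; exact: cmeas_tpoly.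
under [X in wint _ _ X]eq_fun do rewrite tpoly_shift.
apply: le_trans (H s _ us _); last by move=> z Lz; rewrite La// mul0r.
under [X in (_ <= (c * X)%:E)%E]eq_bigr do rewrite sqabsM sqabs_ch mulr1.
exact: lexx.
Qed.

Lemma total_translate w T A L : measurable_fun setT A ->
  totalL2 0 T (fun x => A (x + w)) L -> totalL2 w T A L.
Proof.
move=> mA H g mg gfin eps eps0.
have mg' : cmeas (fun x => g (x + w)) by apply: cmeas_comp => //; exact: measurable_shift.
have trans f : cmeas f -> N2 w T A f = N2 0 T (fun x => A (x + w)) (fun x => f (x + w)).
  by move=> mf; rewrite /N2 -{1}[w]add0r wint_translate//; exact: nnmeas_N2.
have [|s [a [us La Hs]]] := H _ mg' _ _ eps0; first by rewrite -trans.
exists s, (fun z => a z * ch T z (- w)); split=> //.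
  by move=> z Lz; rewrite La// mul0r.
rewrite trans; last by apply: cmeasB => //; exact: cmeas_tpoly.
rewrite (N2_eq (g := fun x => g (x + w) - tpoly T s a x))// => x _ _.
by congr (_ - _); rewrite -tpoly_shift addrK.
Qed.

End RieszProperties.

(** * The algebra of trigonometric polynomials and its closure in L^2 of a period *)

Section TrigAlgebra.
Variables (R : realType) (T : R).
Local Notation C := R[i].
Implicit Types f g : R -> C.

Definition istrig f := exists s a, uniq s /\ f = tpoly T s a.

Lemma istrig_ch (c : C) z : istrig (fun x => c * ch T z x).
Proof.
by exists [:: z], (fun=> c); split=> //; apply/funext => x; rewrite /tpoly big_seq1.
Qed.

Lemma istrig_cst (c : C) : istrig (fun=> c).
Proof.
have := istrig_ch c 0; congr istrig; apply/funext => x; by rewrite ch0 mulr1.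
Qed.

Lemma tpoly_extend (s s' : seq int) (a : int -> C) x : uniq s -> uniq s' ->
  {subset s <= s'} ->
  tpoly T s a x = tpoly T s' (fun z => if z \in s then a z else 0) x.
Proof.
move=> us us' ss'; rewrite /tpoly [RHS](bigID (mem s))/= [X in _ + X]big1 ?addr0; last first.
  by move=> z /negbTE ->; rewrite mul0r.
under [RHS]eq_bigr => z zs do rewrite zs.
rewrite -[RHS]big_filter; apply: perm_big; apply: uniq_perm => //; first exact: filter_uniq.
by move=> z; rewrite mem_filter; case: (boolP (z \in s)) => //= /ss' ->.
Qed.

Lemma istrigD f g : istrig f -> istrig g -> istrig (fun x => f x + g x).
Proof.
move=> [s [a [us ->]]] [s' [a' [us' ->]]].
exists (undup (s ++ s')), (fun z => (if z \in s then a z else 0) + (if z \in s' then a' z else 0)).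
split; first exact: undup_uniq.
apply/funext => x; rewrite (@tpoly_extend s (undup (s ++ s')))// ?undup_uniq//.
  rewrite (@tpoly_extend s' (undup (s ++ s')))// ?undup_uniq//.
    by rewrite /tpoly -big_split/=; apply: eq_bigr => z _; rewrite mulrDl.
  by move=> z zs; rewrite mem_undup mem_cat zs orbT.
by move=> z zs; rewrite mem_undup mem_cat zs.
Qed.

Lemma istrig_mulch f c z : istrig f -> istrig (fun x => c * ch T z x * f x).
Proof.
move=> [s [a [us ->]]].
exists [seq z + y | y <- s], (fun y => c * a (y - z)); split.
  by rewrite map_inj_uniq//; exact: addrI.
apply/funext => x; rewrite /tpoly big_map mulr_sumr; apply: eq_bigr => y _.
by rewrite [z + y]addrC addrK addrC chD; ring.
Qed.

Lemma istrigM f g : istrig f -> istrig g -> istrig (fun x => f x * g x).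
Proof.
move=> [s [a [_ ->]]] tg; elim: s => [|z s IH].
  have -> : (fun x => tpoly T [::] a x * g x) = fun=> 0.
    by apply/funext => x; rewrite /tpoly big_nil mul0r.
  exact: istrig_cst.
have -> : (fun x => tpoly T (z :: s) a x * g x) =
    (fun x => a z * ch T z x * g x + tpoly T s a x * g x).
  by apply/funext => x; rewrite /tpoly big_cons mulrDl.
by apply: istrigD => //; exact: istrig_mulch.
Qed.

Lemma istrigX f n : istrig f -> istrig (fun x => f x ^+ n).
Proof.
move=> tf; elim: n => [|n IH]; first exact: istrig_cst.
have -> : (fun x => f x ^+ n.+1) = (fun x => f x * f x ^+ n).
  by apply/funext => x; rewrite exprS.
exact: istrigM.
Qed.

Lemma istrig_cos c : istrig (fun x => (cos (2 * pi * ((x - c) / T)))%:C%C).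
Proof.
have -> : (fun x => (cos (2 * pi * ((x - c) / T)))%:C%C) =
   fun x => (2^-1 * cis (2 * pi * (- c / T))) * ch T 1 x +
            (2^-1 * cis (2 * pi * (c / T))) * ch T (-1) x.
  apply/funext => x; rewrite -![2^-1 * _ * ch _ _ _]mulrA -!cisD -mulrDr.
  have -> : 2 * pi * (- c / T) + 2 * pi * (1%:~R * x / T) = 2 * pi * ((x - c) / T).
    by rewrite mul1r; ring.
  have -> : 2 * pi * (c / T) + 2 * pi * ((-1)%:~R * x / T) = - (2 * pi * ((x - c) / T)).
    by rewrite rmorphN mulN1r; ring.
  set y := 2 * pi * _.
  have -> : cis y + cis (- y) = 2 * (cos y)%:C%C.
    apply/eqP; rewrite eq_complex cReD cImD cReM cImM /= cosN sinN.
    by apply/andP; split; apply/eqP; ring.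
  by rewrite mulKf// pnatr_eq0.
by apply: istrigD; exact: istrig_ch.
Qed.

Lemma cmeas_trig f : istrig f -> cmeas f.
Proof. by move=> [s [a [_ ->]]]; exact: cmeas_tpoly. Qed.

(** Membership in the L^2 closure; measurability is bundled so that the closure properties below
    need no side conditions. *)
Definition app f := cmeas f /\ forall eps : R, 0 < eps ->
  exists2 g, istrig g & (N2 0 T xpredT (fun x => f x - g x)%R <= eps%:E)%E.

Lemma app_trig f : istrig f -> app f.
Proof.
move=> tf; split=> [|eps eps0]; first exact: cmeas_trig.
exists f => //; rewrite /N2 (wint_eq (G := fun=> 0)); last first.
  by move=> x _; rewrite subrr sqabs0 mulr0.
by rewrite /wint integral0 lee_fin ltW.
Qed.

Lemma N2D2 A f g : measurable_fun setT A -> cmeas f -> cmeas g ->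
  (N2 0 T A (fun x => f x + g x)%R <= 2%:E * N2 0 T A f + 2%:E * N2 0 T A g)%E.
Proof.
move=> mA mf mg; have := N2D_weighted 0 T mA mf mg (@ltr01 R).
by rewrite invr1.
Qed.

Lemma app_lim f : cmeas f ->
  (forall eps : R, 0 < eps -> exists2 g, app g &
    (N2 0 T xpredT (fun x => f x - g x)%R <= eps%:E)%E) -> app f.
Proof.
move=> mf H; split=> // eps eps0.
have e4 : 0 < eps / 4 by rewrite divr_gt0.
have [g [mg ag] fg] := H _ e4; have [h th gh] := ag _ e4.
exists h => //; have mh := cmeas_trig th.
have -> : (fun x => f x - h x) = (fun x => (f x - g x) + (g x - h x)).
  by apply/funext => x; rewrite addrA subrK.
apply: le_trans (N2D2 (measurable_cst true) (cmeasB mf mg) (cmeasB mg mh)) _.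
have -> : eps%:E = (2%:E * (eps / 4)%:E + 2%:E * (eps / 4)%:E)%E.
  by rewrite -!EFinM -EFinD; congr EFin; field.
by apply: leeD; apply: lee_wpmul2l.
Qed.

Lemma appD f g : app f -> app g -> app (fun x => f x + g x).
Proof.
move=> [mf af] [mg ag]; split=> [|eps eps0]; first exact: cmeasD.
have e4 : 0 < eps / 4 by rewrite divr_gt0.
have [f' tf ff] := af _ e4; have [g' tg gg] := ag _ e4.
exists (fun x => f' x + g' x); first exact: istrigD.
have -> : (fun x => f x + g x - (f' x + g' x)) = (fun x => (f x - f' x) + (g x - g' x)).
  by apply/funext => x; ring.
apply: le_trans (N2D2 (measurable_cst true) (cmeasB mf (cmeas_trig tf))
   (cmeasB mg (cmeas_trig tg))) _.
have -> : eps%:E = (2%:E * (eps / 4)%:E + 2%:E * (eps / 4)%:E)%E.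
  by rewrite -!EFinM -EFinD; congr EFin; field.
by apply: leeD; apply: lee_wpmul2l.
Qed.

Lemma N2Z w A (c : C) f : measurable_fun setT A -> cmeas f ->
  N2 w T A (fun x => c * f x) = ((sqabs c)%:E * N2 w T A f)%E.
Proof.
move=> mA mf; rewrite -wintZ ?sqabs_ge0//; last exact: nnmeas_N2.
by apply: wint_eq => x _; rewrite sqabsM mulrCA.
Qed.

Lemma appZ c f : app f -> app (fun x => c * f x).
Proof.
move=> [mf af]; split=> [|eps eps0]; first by apply: cmeasM => //; exact: cmeas_cst.
have s0 := sqabs_ge0 c; have s1 : 0 < sqabs c + 1 by rewrite ltr_pwDr.
have e1 : 0 < eps / (sqabs c + 1) by rewrite divr_gt0.
have [g tg fg] := af _ e1; exists (fun x => c * g x).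
  by apply: istrigM => //; exact: istrig_cst.
have -> : (fun x => c * f x - c * g x) = (fun x => c * (f x - g x)).
  by apply/funext => x; rewrite mulrBr.
rewrite N2Z//; last by apply: cmeasB => //; exact: cmeas_trig.
apply: le_trans (lee_wpmul2l _ fg) _; first by rewrite lee_fin.
rewrite -EFinM lee_fin mulrCA ger_pMr// ler_pdivrMr// mul1r lerDl.
exact: ler01.
Qed.

Lemma appB f g : app f -> app g -> app (fun x => f x - g x).
Proof.
move=> af ag; have -> : (fun x => f x - g x) = (fun x => f x + (-1) * g x).
  by apply/funext => x; rewrite mulN1r.
by apply: appD => //; exact: appZ.
Qed.

Lemma app_sum (I : Type) (s : seq I) (F : I -> R -> C) :
  (forall i, app (F i)) -> app (fun x => \sum_(i <- s) F i x).
Proof.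
move=> aF; elim: s => [|i s IH].
  under eq_fun do rewrite big_nil; apply: app_trig; exact: istrig_cst.
by under eq_fun do rewrite big_cons; exact: appD.
Qed.

End TrigAlgebra.

(** * Dominated convergence on a window *)

Section Dominated.
Variable R : realType.
Implicit Types w T : R.

(** The exceptional set is countable, hence null; in the applications it holds the end point 0 of
    the window and the jump of a step function. *)
Lemma wint_dominated w T (F : nat -> R -> R) (G : R -> R) (Z : set R) :
  (forall n, nnmeas (F n)) -> nnmeas G -> (wint w T G < +oo)%E ->
  (forall n x, w <= x < w + T -> F n x <= G x) -> countable Z ->
  (forall x, w <= x < w + T -> ~ Z x -> F ^~ x @ \oo --> (0 : R)) ->
  forall eps : R, 0 < eps -> exists n, (wint w T (F n) <= eps%:E)%E.
Proof.
move=> mF mG Gfin FG cZ F0 eps eps0.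
pose mu := @lebesgue_measure R.
have cvg : {ae mu, forall x, `[w, (w + T)[%classic x ->
    (fun n => (F n x)%:E) @ \oo --> 0%E}.
  exists Z; split.
  + exact: countable_measurable.
  + exact: countable_lebesgue_measure0.
  + move=> x /= /existsNP nx; apply: contrapT => nZ; case: nx => xw; apply.
    by apply: cvg_EFin; [exact: nearW|apply: F0 => //; move: xw; rewrite in_itv].
have dom : {ae mu, forall x n, `[w, (w + T)[%classic x -> (`|(F n x)%:E| <= (G x)%:E)%E}.
  apply: aeW => x n; rewrite /= in_itv/= => xw.
  by rewrite lee_fin ger0_norm ?FG//; case: (mF n).
have intG : mu.-integrable `[w, (w + T)[%classic (fun x => (G x)%:E).
  apply/integrableP; split; first exact: nnmeasE.
  have := Gfin; congr (_ < _)%E; apply: eq_integral => x _.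
  by rewrite gee0_abs// lee_fin; case: mG.
have [//||//|_ _] := dominated_convergence _ _ _ cvg intG dom.
  by move=> n; exact: nnmeasE.
rewrite integral0 => /fine_cvgP[fin] /cvgrPdist_le /(_ _ eps0) lim.
have [n _ H] := filterI fin lim; have [fn ln] := H n (leqnn n).
have fn' : wint w T (F n) \is a fin_num := fn.
exists n; rewrite -(fineK fn') lee_fin; apply: le_trans ln.
by rewrite sub0r normrN ler_norm.
Qed.

End Dominated.

(** * Completeness of the exponentials over a period *)

Section StepApproximation.
Variable R : realType.

Lemma bernoulli_lower (x : R) K : 0 <= x <= 1 -> 1 - K%:R * x <= (1 - x) ^+ K.
Proof.
move=> /andP[x0 x1]; elim: K => [|K IH]; first by rewrite mul0r subr0 expr0.
rewrite exprS; apply: (@le_trans _ _ ((1 - x) * (1 - K%:R * x))); last first.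
  by rewrite ler_wpM2l// subr_ge0.
have : 0 <= K%:R * x * x by rewrite !mulr_ge0.
by rewrite -natr1; lra.
Qed.

Lemma bernoulli_upper (x : R) K : 0 <= x <= 1 -> (1 - x) ^+ K * (1 + K%:R * x) <= 1.
Proof.
move=> /andP[x0 x1]; elim: K => [|K IH]; first by rewrite mul0r addr0 expr0 mulr1.
apply: le_trans IH; rewrite exprSr -mulrA ler_wpM2l//.
  by rewrite exprn_ge0// subr_ge0.
have : 0 <= K%:R * x * x by rewrite !mulr_ge0.
have : 0 <= x * x by rewrite mulr_ge0.
by rewrite -natr1; lra.
Qed.

(* The Brosowski-Deutsch polynomials 1 - (1 - q^n)^(m^n) turn the threshold q = 1/m into a jump. *)
Definition steep (m n : nat) (q : R) : R := 1 - (1 - q ^+ n) ^+ (m ^ n).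

Lemma steep01 m n q : 0 <= q <= 1 -> 0 <= steep m n q <= 1.
Proof.
move=> /andP[q0 q1]; have qn0 : 0 <= q ^+ n by rewrite exprn_ge0.
have qn1 : q ^+ n <= 1 by rewrite exprn_ile1.
rewrite /steep subr_ge0 exprn_ile1 ?subr_ge0//=; last by rewrite gerBl.
by rewrite gerBl exprn_ge0// subr_ge0.
Qed.

Lemma steep_low m n q : 0 <= q <= 1 -> steep m n q <= (m%:R * q) ^+ n.
Proof.
move=> /andP[q0 q1].
have qn : 0 <= q ^+ n <= 1 by rewrite exprn_ge0// exprn_ile1.
by have := bernoulli_lower (m ^ n) qn; rewrite /steep exprMn natrX; lra.
Qed.

Lemma steep_high m n q : (0 < m)%N -> 0 < q <= 1 -> 1 - steep m n q <= (m%:R * q)^-1 ^+ n.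
Proof.
move=> m0 /andP[q0 q1].
have qn0 : 0 < q ^+ n by rewrite exprn_gt0.
have qn1 : q ^+ n <= 1 by rewrite exprn_ile1// ltW.
have qn : 0 <= q ^+ n <= 1 by rewrite ltW.
have p0 : 0 < (m%:R * q) ^+ n by rewrite exprn_gt0// mulr_gt0// ltr0n.
rewrite /steep opprB addrC subrK exprVn -[leRHS]mul1r ler_pdivlMr//.
apply: le_trans (bernoulli_upper (m ^ n) qn).
by rewrite ler_wpM2l ?exprn_ge0 ?subr_ge0// natrX -exprMn lerDr ler01.
Qed.

(** Convergence is geometric: below the threshold the error is at most (m q)^n by Bernoulli's
    inequality, above it at most (m q)^-n because (1 - x)^K <= 1 / (1 + K x). *)
Lemma steep_cvg m q (b : bool) : (0 < m)%N -> 0 <= q <= 1 ->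
  (if b then 1 < m%:R * q else m%:R * q < 1) ->
  (fun n => (b%:R - steep m n q) ^+ 2) @ \oo --> (0 : R).
Proof.
move=> m0 q01 hb.
have [r r01 H] : exists2 r : R, 0 <= r < 1 &
    forall n, `|b%:R - steep m n q| <= r ^+ n.
  have /andP[q0 q1] := q01.
  case: b hb => hq.
    have q_gt0 : 0 < q by rewrite lt0r q0 andbT; apply/eqP => qq; move: hq; rewrite qq mulr0 ltr10.
    exists (m%:R * q)^-1 => [|n].
      by rewrite invr_ge0 mulr_ge0//= invf_lt1// (lt_trans ltr01).
    have /andP[h0 h1] := steep01 m n q01.
    by rewrite ger0_norm ?subr_ge0// steep_high// q_gt0.
  exists (m%:R * q) => [|n]; first by rewrite mulr_ge0.
  have /andP[h0 h1] := steep01 m n q01.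
  by rewrite sub0r normrN ger0_norm// steep_low.
have /andP[r0 r1] := r01.
apply: (@squeeze_cvgr _ _ _ _ (cst 0) (GRing.exp r)).
- near=> n; rewrite sqr_ge0/= -real_normK ?num_real// expr2.
  have h := H n; apply: (@le_trans _ _ (`|b%:R - steep m n q| * 1)); last by rewrite mulr1.
  by rewrite ler_wpM2l// (le_trans h)// exprn_ile1// ltW.
- exact: cvg_cst.
- by apply: cvg_expr; rewrite ger0_norm.
Unshelve. all: by end_near. Qed.

End StepApproximation.

(** * From rays to Borel sets to square-integrable functions *)

Section TrigCompleteness.
Variables (R : realType) (T : R).
Hypothesis T0 : 0 < T.
Local Notation C := R[i].

(* On the window, cos(2 pi (t - c)/T) with c the midpoint of ]x, T[ exceeds its value at x
   exactly on ]x, T[. *)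
Lemma cos_arc (x t : R) : 0 < x < T -> 0 < t < T -> t != x ->
  if x < t then cos (2 * pi * ((x - (x + T) / 2) / T)) < cos (2 * pi * ((t - (x + T) / 2) / T))
  else cos (2 * pi * ((t - (x + T) / 2) / T)) < cos (2 * pi * ((x - (x + T) / 2) / T)).
Proof.
move=> /andP[x0 xT] /andP[t0 tT] tx.
set c := (x + T) / 2.
(* The cosine depends only on the distance to c on the circle of length T, which is at most T / 2,
   and it decreases in that distance. *)
have ang u : 0 < u -> u < T -> cos (2 * pi * ((u - c) / T)) =
    cos (2 * pi * (Num.min `|u - c| (T - `|u - c|) / T)).
  move=> u0 uT.
  have -> : cos (2 * pi * ((u - c) / T)) = cos (2 * pi * (`|u - c| / T)).
    rewrite -[LHS]cos_norm !normrM !(ger0_norm (pi_ge0 R)) normfV (gtr0_norm T0) ger0_norm//.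
  case: leP => // _.
  have -> : 2 * pi * ((T - `|u - c|) / T) = - (2 * pi * (`|u - c| / T)) + pi *+ 2.
    by rewrite mulr2n; field; rewrite gt_eqF.
  by rewrite cosD2pi cosN.
have E u v : 0 <= u <= T / 2 -> 0 <= v <= T / 2 ->
    (cos (2 * pi * (u / T)) < cos (2 * pi * (v / T))) = (v < u).
  have inI y : 0 <= y <= T / 2 -> 2 * pi * (y / T) \in `[0, (pi : R)].
    move=> /andP[y0 yT]; rewrite in_itv/=; apply/andP; split.
      by rewrite !mulr_ge0 ?pi_ge0 ?invr_ge0 ?(ltW T0).
    rewrite -mulrA mulrCA ger_pMr ?pi_gt0// mulrA ler_pdivrMr// mul1r.
    by move: yT; rewrite ler_pdivlMr// mulrC.
  move=> uI vI; rewrite ltr_cos ?inI// ltr_pM2l ?mulr_gt0 ?pi_gt0//.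
  by rewrite ltr_pM2r// invr_gt0.
have cE : c = (x + T) / 2 by [].
rewrite !ang//.
have minI u : 0 < u -> u < T -> 0 <= Num.min `|u - c| (T - `|u - c|) <= T / 2.
  move=> u0 uT; have : `|u - c| < T by rewrite ltr_norml cE; lra.
  by have := normr_ge0 (u - c); move=> n0 nT; case: (leP `|u - c| (T - `|u - c|)) => h;
    apply/andP; split; lra.
have mx : Num.min `|x - c| (T - `|x - c|) = (T - x) / 2.
  have -> : `|x - c| = (T - x) / 2 by rewrite ler0_norm cE; lra.
  by case: leP; lra.
case: ifPn => xt; rewrite E ?minI// mx.
  by rewrite gt_min; apply/orP; left; rewrite ltr_norml cE; apply/andP; split; lra.
have {tx xt} xt : t < x by rewrite lt_neqAle tx leNgt.
by rewrite lt_min ler0_norm cE; [apply/andP; split|]; lra.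
Qed.

Lemma cmeas_real (f : R -> R) : measurable_fun setT f -> cmeas (fun x => (f x)%:C%C).
Proof. by move=> mf; split => //=; exact: measurable_cst. Qed.

Lemma app_dominated_lim (f : R -> C) (g : nat -> R -> C) (G : R -> R) (Z : set R) :
  cmeas f -> (forall n, app T (g n)) -> nnmeas G -> (wint 0 T G < +oo)%E ->
  (forall n x, 0 <= x < T -> sqabs (f x - g n x) <= G x) -> countable Z ->
  (forall x, 0 <= x < T -> ~ Z x -> (fun n => sqabs (f x - g n x)) @ \oo --> (0 : R)) ->
  app T f.
Proof.
move=> mf ag mG Gfin dom cZ lim; apply: app_lim => // eps eps0.
have mF n : nnmeas (fun x => true%:R * sqabs (f x - g n x)).
  by apply: nnmeas_N2 => //; apply: cmeasB => //; case: (ag n).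
have [n x xT|x xT Zx|n Hn] := @wint_dominated R 0 T
   (fun n x => true%:R * sqabs (f x - g n x)) G Z mF mG Gfin _ cZ _ _ eps0.
- by rewrite add0r in xT; rewrite mul1r dom.
- by rewrite add0r in xT; under eq_fun do rewrite mul1r; exact: lim.
- by exists (g n).
Qed.

Lemma app_bounded_lim (f : R -> C) (g : nat -> R -> C) (Z : set R) :
  cmeas f -> (forall n, app T (g n)) ->
  (forall n x, 0 <= x < T -> sqabs (f x - g n x) <= 1) -> countable Z ->
  (forall x, 0 <= x < T -> ~ Z x -> (fun n => sqabs (f x - g n x)) @ \oo --> (0 : R)) ->
  app T f.
Proof.
move=> mf ag dom cZ lim; apply: (app_dominated_lim (G := fun=> 1) mf ag _ _ dom cZ lim).
  exact: nnmeas_cst.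
by rewrite wint_cst ?ltW// ltry.
Qed.

Lemma measurable_ray (x : R) : measurable_fun setT (fun t : R => ((x < t)%R%:R : R)).
Proof.
have := @nnmeas_bool R (fun t => x < t); case=> //.
by apply: measurable_fun_ltr; [exact: measurable_cst|exact: measurable_id].
Qed.

Lemma app_ray (x : R) : app T (fun t => ((x < t)%R%:R : R)%:C%C).
Proof.
have mf := cmeas_real (measurable_ray x).
have bnd (b : bool) (p : R) : 0 <= p <= 1 -> sqabs ((b%:R : R)%:C%C - p%:C%C) <= 1.
  move=> /andP[p0 p1]; rewrite -rmorphB sqabs_real.
  rewrite -real_normK ?num_real// exprn_ile1// ler_norml.
  by case: b => /=; rewrite ?sub0r; apply/andP; split; lra.
have cst_case (b : bool) : (forall t, 0 < t < T -> (x < t) = b) ->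
    app T (fun t => ((x < t)%R%:R : R)%:C%C).
  move=> xb; apply: (@app_bounded_lim _ (fun=> fun=> (b%:R : R)%:C%C) [set 0]) => //.
  - by move=> n; apply: app_trig; exact: istrig_cst.
  - by move=> n t _; apply: bnd; case: b {xb} => /=; rewrite ?lexx ler01.
  - move=> t /andP[t0 tT] /= /eqP tn0.
    rewrite xb ?tT ?lt0r ?tn0 ?t0// subrr sqabs0; exact: cvg_cst.
have [x0|x0] := leP x 0.
  by apply: (cst_case true) => t /andP[t0 _]; rewrite (le_lt_trans x0).
have [xT|xT] := leP T x.
  by apply: (cst_case false) => t /andP[_ tT]; apply/negbTE; rewrite -leNgt (le_trans (ltW tT)).
pose c := (x + T) / 2; pose y0 := cos (2 * pi * ((x - c) / T)).
(* The value at x is not the minimum -1 of the cosine, since x - c = - (T - x) / 2 lies strictly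
   between - T / 2 and 0. *)
have y0gt : 0 < y0 + 1.
  rewrite -ltrBlDr sub0r lt_neqAle cos_geN1 andbT eq_sym; apply/eqP => h.
  have : cos (2 * pi * ((x - c) / T - 2^-1)) = 1.
    have -> : 2 * pi * ((x - c) / T - 2^-1) = - (- (2 * pi * ((x - c) / T)) + pi) by field; rewrite gt_eqF.
    by rewrite cosN cosDpi cosN -/y0 h opprK.
  move/cos_2pi_eq1; set z := Num.floor _ => hz.
  have e : z%:~R * T = - (T - x) / 2 - T / 2.
    by rewrite -hz /c; field; rewrite gt_eqF.
  have z1 : z%:~R < 0 :> R.
    by rewrite -(pmulr_llt0 _ T0) e; lra.
  have z2 : -1 < z%:~R :> R.
    by rewrite -(ltr_pM2r T0) e; lra.
  move: z1 z2; rewrite -[0]/(0%:~R) ltr_int -(rmorphN1 (intmul 1)) ltr_int.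
  by case: z {hz e} => // -[].
have [m m2] : exists m : nat, 2 <= m%:R * (y0 + 1).
  exists (Num.truncn (2 / (y0 + 1))).+1; rewrite -ler_pdivrMr// ltW// truncnS_gt//.
have m0 : (0 < m)%N.
  by rewrite lt0n; apply/eqP => mm; move: m2; rewrite mm mul0r => h; lra.
(* Affine in the cosine: it lies in [0, 1] because the cosine plus 1 is at most 2, and [m * q]
   exceeds 1 exactly where the cosine exceeds [y0]. *)
pose q t := (m%:R * (y0 + 1))^-1 * (cos (2 * pi * ((t - c) / T)) + 1).
have my : 0 < m%:R * (y0 + 1) by rewrite (lt_le_trans _ m2).
have q01 t : 0 <= q t <= 1.
  have cm := cos_geN1 (2 * pi * ((t - c) / T)); have c1 := cos_le1 (2 * pi * ((t - c) / T)).
  have c0 : 0 <= cos (2 * pi * ((t - c) / T)) + 1 by lra.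
  rewrite /q mulr_ge0 ?invr_ge0 ?(ltW my)//=.
  by rewrite ler_pdivrMl// mulr1; apply: le_trans m2; lra.
have mq t : m%:R * q t = (cos (2 * pi * ((t - c) / T)) + 1) / (y0 + 1).
  by rewrite /q; field; rewrite !gt_eqF// ltr0n.
have tq n : istrig T (fun t => (steep m n (q t))%:C%C).
  have -> : (fun t => (steep m n (q t))%:C%C) =
    (fun t => 1 + (-1) * (1 + (-1) * ((((m%:R * (y0 + 1))^-1)%:C%C *
       ((cos (2 * pi * ((t - c) / T)))%:C%C + 1)) ^+ n)) ^+ (m ^ n)) :> (R -> C).
    apply/funext => t; rewrite /steep /q rmorphB rmorphXn rmorphB rmorphXn rmorphM rmorphD !rmorph1.
    by rewrite !mulN1r.
  apply: istrigD; first exact: istrig_cst.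
  apply: istrigM; first exact: istrig_cst.
  apply: istrigX; apply: istrigD; first exact: istrig_cst.
  apply: istrigM; first exact: istrig_cst.
  apply: istrigX; apply: istrigM; first exact: istrig_cst.
  by apply: istrigD; [exact: istrig_cos|exact: istrig_cst].
apply: (@app_bounded_lim _ (fun n t => (steep m n (q t))%:C%C) [set 0; x]) => //.
- by move=> n; exact: app_trig.
- by move=> n t _; apply: bnd; exact: steep01.
- by apply: finite_set_countable.
- move=> t /andP[t0 tT] /= /not_orP[/eqP tn0 /eqP tnx].
  under eq_fun do rewrite -rmorphB sqabs_real.
  have t0' : 0 < t by rewrite lt0r tn0.
  have xI : 0 < x < T by rewrite x0.
  have tI : 0 < t < T by rewrite t0'.
  have arc := cos_arc xI tI tnx; apply: steep_cvg => //; rewrite mq.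
  case: ifP arc => xt arc.
    by rewrite ltr_pdivlMr// mul1r ltrD2r.
  by rewrite ltr_pdivrMr// mul1r ltrD2r.
Qed.

Definition app_set (B : set R) := measurable B /\ app T (fun t => (\1_B t : R)%:C%C).

Lemma cmeas_indic (B : set R) : measurable B -> cmeas (fun t => (\1_B t : R)%:C%C).
Proof. by move=> mB; apply: cmeas_real; exact: measurable_indic. Qed.

Lemma app_set_lambda : lambda_system setT app_set.
Proof.
split => //.
- split; first exact: measurableT.
  by apply: app_trig; have := istrig_cst T 1; congr istrig; apply/funext => t; rewrite indicT.
- move=> A B AB [mA aA] [mB aB]; split; first exact: measurableD.
  have -> : (fun t => (\1_(A `\` B) t : R)%:C%C) =
            (fun t => (\1_A t : R)%:C%C - (\1_B t : R)%:C%C).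
    apply/funext => t; rewrite -rmorphB; congr (_%:C)%C; rewrite !indicE in_setD.
    case: (boolP (t \in A)) => tA; case: (boolP (t \in B)) => tB; rewrite /= ?subr0 ?subrr//.
    by move: tA; rewrite notin_setE => nA; move: tB; rewrite inE => /AB.
  exact: appB.
- move=> F ndF FE.
  have mU : measurable (\bigcup_n F n) by apply: bigcupT_measurable => n; case: (FE n).
  split=> //; apply: (@app_bounded_lim _ (fun n t => (\1_(F n) t : R)%:C%C) set0) => //.
  + exact: cmeas_indic.
  + by move=> n; case: (FE n).
  + move=> n t _; rewrite -rmorphB sqabs_real !indicE.
    by case: (t \in _); case: (t \in _); rewrite ?subrr ?subr0 ?sub0r ?sqrrN ?expr1n ?expr0n ?lexx ?ler01.
  + move=> t _ _; case: (boolP (t \in \bigcup_n F n)) => tU; last first.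
      have z n : \1_(F n) t = 0 :> R.
        rewrite indicE memNset// => Ft; move: tU; rewrite notin_setE; apply; by exists n.
      under eq_fun do rewrite z indicE (negbTE tU) subrr sqabs0; exact: cvg_cst.
    move: (tU); rewrite inE => -[m _ Fm].
    apply: (@cvg_near_cst _ _ _ _ _ _ _); exists m => // n /= mn.
    have Ftn : F n t by move/subsetPset: (ndF m n mn); apply.
    by rewrite !indicE tU mem_set// subrr sqabs0.
Qed.

(** Dynkin's argument: the rays ]x, +oo[ are stable under intersection and generate the Borel
    sets. *)
Lemma app_measurable (B : set R) : measurable B -> app T (fun t => (\1_B t : R)%:C%C).
Proof.
move=> mB; suff [] : app_set B by [].
have H := @lambda_system_subset _ (@RGenOInfty.G R) _ setT app_set app_set_lambda.
apply: H => //.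
- move=> _ _ [x ->] [y ->]; exists (Num.max x y).
  by apply/seteqP; split=> t /=; rewrite !in_itv/= !andbT gt_max => /andP.
- move=> _ [x ->]; split; first exact: measurable_itv.
  have := app_ray x; congr (app T); apply/funext => t; congr (_%:C)%C.
  by rewrite indicE /= -[_ \in _]/(t \in `]x, +oo[%classic) mem_setE in_itv/= andbT.
- by have := mB : (@ocitv R).-sigma.-measurable B; rewrite (@RGenOInfty.measurableE R).
Qed.

(** The dyadic simple functions increase to [f] from below, so the squared error is dominated by
    f^2. *)
Lemma app_nonneg (f : R -> R) : nnmeas f -> (wint 0 T (fun x => (f x ^+ 2)%R) < +oo)%E ->
  app T (fun t => (f t)%:C%C).
Proof.
move=> [f0 mf] ffin.
have mfE : measurable_fun setT (EFin \o f) by exact/measurable_EFinP.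
pose g := approx setT (EFin \o f).
have gf n x : g n x <= f x.
  rewrite -lee_fin; apply: (@le_approx _ _ _ setT (EFin \o f) n x) => // y _.
  by rewrite lee_fin.
have g0 n x : 0 <= g n x.
  rewrite /g /approx addr_ge0 ?mulr_ge0// sumr_ge0//.
apply: (app_dominated_lim (g := fun n t => (g n t)%:C%C) (G := fun x => f x ^+ 2) (Z := set0)) => //.
- move=> n; rewrite /g /approx.
  have mA k : measurable (dyadic_approx setT (EFin \o f) n k).
    rewrite /dyadic_approx; case: ifPn => [kn|_]//; rewrite -preimage_comp.
    by apply: mfE => //; apply/measurable_image_EFin; exact: measurable_itv.
  have mI : measurable (integer_approx setT (EFin \o f) n).
    apply: emeasurable_fun_c_infty => //.
  have -> : (fun t => (\sum_(k < n * 2 ^ n) k%:R * 2 ^- n *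
       \1_(dyadic_approx setT (EFin \o f) n k) t +
       n%:R * \1_(integer_approx setT (EFin \o f) n) t)%:C%C) =
    (fun t => \sum_(k < n * 2 ^ n) (k%:R * 2 ^- n : R)%:C%C *
       (\1_(dyadic_approx setT (EFin \o f) n k) t)%:C%C +
       (n%:R : R)%:C%C * (\1_(integer_approx setT (EFin \o f) n) t)%:C%C).
    apply/funext => t; rewrite rmorphD rmorph_sum rmorphM; congr (_ + _).
    by apply: eq_bigr => k _; rewrite rmorphM.
  apply: appD; last by apply: appZ; exact: app_measurable.
  by apply: app_sum => k; apply: appZ; exact: app_measurable.
- by split=> [x|]; [exact: sqr_ge0|exact: measurable_funX].
- move=> n x _; rewrite -rmorphB sqabs_real.
  have := gf n x; have := g0 n x => h1 h2.
  by rewrite ler_sqr ?nnegrE ?subr_ge0// gerBl.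
- move=> x _ _; under eq_fun do rewrite -rmorphB sqabs_real.
  have cg : g ^~ x @ \oo --> f x.
    by apply: (@cvg_approx _ _ _ setT (EFin \o f) x) => // [y _|]; rewrite ?lee_fin ?ltry.
  have : (fun n => (f x - g n x) ^+ 2) @ \oo --> (f x - f x) ^+ 2.
    have d : (fun n => f x - g n x) @ \oo --> f x - f x by apply: cvgB => //; exact: cvg_cst.
    by under eq_fun do rewrite expr2; rewrite expr2; exact: cvgM.
  by rewrite subrr expr0n.
Qed.

Theorem trig_total : totalL2 0 T xpredT setT.
Proof.
move=> g mg gfin eps eps0.
have [g1 g2] := mg.
have fin (phi : R -> R) : measurable_fun setT phi -> (forall x, phi x ^+ 2 <= sqabs (g x)) ->
    (wint 0 T (fun x => (phi x ^+ 2)%R) < +oo)%E.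
  move=> mphi h; apply: le_lt_trans gfin; apply: wint_le => [||x _].
  - by split=> [x|]; [exact: sqr_ge0|exact: measurable_funX].
  - exact: nnmeas_N2.
  - by rewrite mul1r.
have real_part (u : R -> R) : measurable_fun setT u -> (forall x, u x ^+ 2 <= sqabs (g x)) ->
    app T (fun t => (u t)%:C%C).
  move=> mu uh.
  have mp : measurable_fun setT (fun t => Num.max (u t) 0).
    by apply: measurable_maxr => //; exact: measurable_cst.
  have mn : measurable_fun setT (fun t => Num.max (- u t) 0).
    by apply: measurable_maxr; [exact: measurable_funN|exact: measurable_cst].
  have -> : (fun t => (u t)%:C%C) = (fun t => (Num.max (u t) 0)%:C%C - (Num.max (- u t) 0)%:C%C).
    apply/funext => t; rewrite -rmorphB; congr (_%:C)%C.
    by case: (leP (u t) 0) => h; case: (leP (- u t) 0) => h'; lra.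
  apply: appB; apply: app_nonneg.
  - by split=> [x|//]; rewrite le_max lexx orbT.
  - apply: fin => // x; apply: le_trans (uh x); case: (leP (u x) 0) => _ //.
    by rewrite expr0n sqr_ge0.
  - by split=> [x|//]; rewrite le_max lexx orbT.
  - apply: fin => // x; apply: le_trans (uh x); case: (leP (- u x) 0) => _; last by rewrite sqrrN.
    by rewrite expr0n sqr_ge0.
have ag : app T g.
  have -> : g = (fun t => (complex.Re (g t))%:C%C + (Complex 0 1) * (complex.Im (g t))%:C%C).
    apply/funext => t; case: (g t) => a b; apply/eqP.
    by rewrite eq_complex cReD cImD cReM cImM /=; apply/andP; split; apply/eqP; ring.
  apply: appD; last apply: appZ; apply: real_part => // x.
    by rewrite /sqabs lerDl sqr_ge0.
  by rewrite /sqabs lerDr sqr_ge0.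
have [_ /(_ _ eps0)[_ [s [a [us ->]]] H]] := ag.
by exists s, a; split=> // z /(_ I).
Qed.

End TrigCompleteness.

(** * Short arcs *)

Section SmallAngles.
Variable R : realType.

Lemma sin_le_id (x : R) : `|sin x| <= `|x|.
Proof.
wlog x0 : x / 0 < x.
  move=> H; have [x0|x0|->] := ltgtP x 0; last by rewrite sin0.
    by have := H (- x); rewrite sinN !normrN oppr_gt0; exact.
  exact: H.
have [|c _] := @MVT R sin cos 0 x x0.
  by apply: continuous_subspaceT => y; exact: continuous_sin.
rewrite sin0 !subr0 => ->; rewrite normrM -[leRHS]mul1r ler_wpM2r//.
exact: cos_max.
Qed.

Lemma sqabs_cis_sub1 (x : R) : sqabs (cis x - 1) <= x ^+ 2.
Proof.
have -> : sqabs (cis x - 1) = (2 * sin (x / 2)) ^+ 2.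
  rewrite /sqabs cReD cImD cReN cImN /= oppr0 addr0.
  have hx : x = (x / 2) *+ 2 by rewrite mulr2n -splitr.
  have e1 : cos x = cos (x / 2) ^+ 2 *+ 2 - 1 by rewrite {1}hx cos_mulr2n.
  have e2 : sin x = (cos (x / 2) * sin (x / 2)) *+ 2 by rewrite {1}hx sin_mulr2n.
  have := cos2Dsin2 (x / 2); rewrite e1 e2.
  set c := cos _; set s := sin _ => cs.
  have -> : c ^+ 2 = 1 - s ^+ 2 by rewrite -cs addrK.
  rewrite !mulr2n; have : c ^+ 2 = 1 - s ^+ 2 by rewrite -cs addrK.
  move=> c2; transitivity ((- (2 * s ^+ 2)) ^+ 2 + 4 * (c ^+ 2) * s ^+ 2); first ring.
  by rewrite c2; ring.
rewrite -[leLHS]real_normK ?num_real// -[leRHS]real_normK ?num_real//.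
rewrite ler_sqr ?nnegrE// normrM ger0_norm//.
have := sin_le_id (x / 2); rewrite normrM [`|2^-1|]ger0_norm ?invr_ge0//; lra.
Qed.

End SmallAngles.

(** * Finite combinations of given exponentials and a contraction criterion for totality *)

Section Combinations.
Variables (R : realType) (T : R).
Local Notation C := R[i].

Definition combo (L : set int) (f : R -> C) :=
  exists s a, [/\ uniq s, supported L a & f = tpoly T s a].

Lemma cmeas_combo L f : combo L f -> cmeas f.
Proof. by move=> [s [a [_ _ ->]]]; exact: cmeas_tpoly. Qed.

Lemma comboD L f g : combo L f -> combo L g -> combo L (fun x => f x + g x).
Proof.
move=> [s [a [us La ->]]] [s' [a' [us' La' ->]]].
exists (undup (s ++ s')), (fun z => (if z \in s then a z else 0) + (if z \in s' then a' z else 0)).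
split; first exact: undup_uniq.
  by move=> z Lz; rewrite La// La'// !if_same addr0.
apply/funext => x; rewrite (@tpoly_extend _ _ s (undup (s ++ s')))// ?undup_uniq//.
  rewrite (@tpoly_extend _ _ s' (undup (s ++ s')))// ?undup_uniq//.
    by rewrite /tpoly -big_split/=; apply: eq_bigr => z _; rewrite mulrDl.
  by move=> z zs; rewrite mem_undup mem_cat zs orbT.
by move=> z zs; rewrite mem_undup mem_cat zs.
Qed.

Lemma combo0 L : combo L (fun=> 0).
Proof.
exists [::], (fun=> 0); split => //.
by apply/funext => x; rewrite /tpoly big_nil.
Qed.

Lemma comboZ L (c : C) f : combo L f -> combo L (fun x => c * f x).
Proof.
move=> [s [a [us La ->]]]; exists s, (fun z => c * a z); split=> //.
  by move=> z Lz; rewrite La// mulr0.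
by apply/funext => x; rewrite /tpoly mulr_sumr; apply: eq_bigr => z _; rewrite mulrA.
Qed.

Lemma combo_ch (L : set int) z : L z -> combo L (ch T z).
Proof.
move=> Lz; exists [:: z], (fun y => if y == z then 1 else 0); split => //.
  by move=> y; case: eqVneq => // ->.
by apply/funext => x; rewrite /tpoly big_seq1 eqxx mul1r.
Qed.

Lemma combo_sum L (I : Type) (s : seq I) (F : I -> R -> C) :
  (forall i, combo L (F i)) -> combo L (fun x => \sum_(i <- s) F i x).
Proof.
move=> cF; elim: s => [|i s IH].
  by under eq_fun do rewrite big_nil; exact: combo0.
by under eq_fun do rewrite big_cons; exact: comboD.
Qed.

(* A contraction estimate suffices for totality: iterate it on the remainder. *)
Lemma total_of_contraction w A L : measurable_fun setT A ->
  (forall g (V : R), cmeas g -> 0 < V -> (N2 w T A g <= V%:E)%E ->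
    exists2 f, combo L f & (N2 w T A (fun x => g x - f x)%R <= (V / 2)%:E)%E) ->
  totalL2 w T A L.
Proof.
move=> mA H g mg gfin eps eps0.
have [V V0 gV] : exists2 V : R, 0 < V & (N2 w T A g <= V%:E)%E.
  exists (fine (N2 w T A g) + 1).
    by rewrite ltr_wpDl// fine_ge0// N2_ge0.
  by rewrite EFinD fineK ?ge0_fin_numE ?N2_ge0// leeDl// lee_fin.
have iter n : exists2 f, combo L f & (N2 w T A (fun x => g x - f x)%R <= (V / 2 ^+ n)%:E)%E.
  elim: n => [|n [f cf Hf]].
    exists (fun=> 0); first exact: combo0.
    by rewrite expr0 divr1; under [X in N2 _ _ _ X]eq_fun do rewrite subr0.
  have [||f' cf' Hf'] := H (fun x => g x - f x) (V / 2 ^+ n) _ _ Hf.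
  - by apply: cmeasB => //; exact: cmeas_combo cf.
  - by rewrite divr_gt0// exprn_gt0.
  exists (fun x => f x + f' x); first exact: comboD.
  rewrite exprSr invfM mulrA.
  by under [X in N2 _ _ _ X]eq_fun do rewrite opprD addrA.
have [n Hn] : exists n, V / 2 ^+ n <= eps.
  exists (Num.truncn (V / eps)).+1; rewrite ler_pdivrMr ?exprn_gt0// mulrC.
  rewrite -ler_pdivrMr// -natrX; apply: ltW; apply: lt_le_trans (truncnS_gt _) _.
  by rewrite ler_nat ltnW// ltn_expl.
have [f [s [a [us La ->]]] Hf] := iter n.
by exists s, a; split=> //; apply: le_trans Hf _; rewrite lee_fin.
Qed.

End Combinations.

(** * Rounding the orthogonal frequencies of an arc to the lattice of the period *)

Section Perturbation.
Variables (R : realType) (l T : R).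
Hypotheses (l0 : 0 < l) (lT : l <= T).
Local Notation C := R[i].
Let T0 : 0 < T. Proof. exact: lt_le_trans l0 lT. Qed.
(** [theta] is the step of the frequency lattice; [rho] bounds the phase that a frequency error of
    less than one step accumulates over the arc. *)
Let theta : R := 2 * pi / T.
Let rho : R := theta * l.
Let rho0 : 0 < rho.
Proof. by rewrite /rho /theta mulr_gt0// divr_gt0// mulr_gt0// pi_gt0. Qed.
(** The constant 1/12 is what gives the contraction in [arc_total] the ratio 1/2. *)
Hypothesis rho_small : rho <= 12^-1.

(** The change of [tpoly l s a] when its k-th frequency is lowered by [theta * x k]. *)
Definition twist (x : int -> R) (s : seq int) (a : int -> C) (t : R) : C :=
  \sum_(k <- s) a k * (cis (- (theta * x k * t)) - 1) * ch l k t.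

Lemma cmeas_twist x s a : cmeas (twist x s a).
Proof.
apply: cmeas_sum => k; apply: cmeasM; last exact: cmeas_ch.
apply: cmeasM; first exact: cmeas_cst.
apply: cmeasB; last exact: cmeas_cst.
apply: cmeas_cis; apply: measurable_funN; apply: measurable_funM; first exact: measurable_cst.
exact: measurable_id.
Qed.

Definition dyadic (j : nat) (x : R) : R := (Num.floor (2 ^+ j * x))%:~R / 2 ^+ j.

Lemma dyadic_itv j x : 0 <= x - dyadic j x <= 2 ^- j.
Proof.
have p0 : 0 < 2 ^+ j :> R by rewrite exprn_gt0.
have /andP[h1 h2] := floor_itvP (2 ^+ j * x).
rewrite subr_ge0 lerBlDr /dyadic ler_pdivrMr// [x * _]mulrC h1/=.
rewrite -[leRHS]mulr1 -[X in X * 1](mulfK (lt0r_neq0 p0)) mulr1.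
rewrite mulrDl mulVf ?gt_eqF// divfK ?gt_eqF// ler_pdivlMr// [x * _]mulrC addrC.
exact: ltW.
Qed.

Lemma dyadic_step j x : exists b : bool, dyadic j.+1 x = dyadic j x + b%:R / 2 ^+ j.+1.
Proof.
have p0 : 0 < 2 ^+ j :> R by rewrite exprn_gt0.
set m := Num.floor (2 ^+ j * x).
have /andP[h1 h2] : m%:~R <= 2 ^+ j * x < m%:~R + 1 := floor_itvP (2 ^+ j * x).
have [h|h] := ltP (2 ^+ j.+1 * x) (2 * m%:~R + 1).
  exists false; rewrite mul0r addr0 /dyadic.
  have -> : Num.floor (2 ^+ j.+1 * x) = 2 * m.
    apply/eqP; rewrite floor_eq !intrD !intrM; apply/andP; split; rewrite exprS -mulrA in h *; lra.
  by rewrite intrM exprS -/m; field; rewrite gt_eqF.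
exists true; rewrite /dyadic.
have -> : Num.floor (2 ^+ j.+1 * x) = 2 * m + 1.
  apply/eqP; rewrite floor_eq !intrD !intrM; apply/andP; split; rewrite exprS -mulrA in h *; lra.
by rewrite intrD intrM exprS -/m (_ : true%:R = 1 :> R)//; field; rewrite gt_eqF.
Qed.

(** One binary digit is added to all offsets at a time. The terms with digit 1 all acquire the same
    phase factor, independent of k and within rho / 2^(j+1) of 1 on the arc; these terms, as
    perturbed so far, have norm at most (1 + 2 rho) Y <= 3/2 Y, and the increments form a geometric
    series. The leading 2 rho, instead of 3/2 rho, keeps the bound positive at j = 0, as [N2D]
    demands. *)
Lemma twist_dyadic (x : int -> R) s j (a : int -> C) (Y : R) :
  (forall k, 0 <= x k < 1) -> uniq s -> 0 < Y ->
  l * \sum_(k <- s) sqabs (a k) <= Y ^+ 2 ->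
  (N2 0 l xpredT (twist (fun k => dyadic j (x k)) s a) <=
     (((2 * rho - 3 / 2 * rho / 2 ^+ j) * Y) ^+ 2)%:E)%E.
Proof.
move=> x01 us; elim: j a Y => [|j IH] a Y Y0 aY.
  rewrite /N2 (wint_eq (G := fun=> 0)).
    by rewrite /wint integral0 lee_fin sqr_ge0.
  move=> t _; rewrite /twist big1 ?sqabs0 ?mulr0// => k _.
  rewrite /dyadic expr0 mul1r divr1.
  have -> : Num.floor (x k) = 0 by apply/eqP; rewrite floor_eq add0r x01.
  by rewrite mulr0 mul0r oppr0 cis0 subrr mulr0 mul0r.
have p0 : 0 < 2 ^+ j :> R by rewrite exprn_gt0.
have pV : 0 < (2 ^+ j)^-1 :> R /\ (2 ^+ j)^-1 <= 1 :> R.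
  by split; [rewrite invr_gt0|rewrite invf_le1// exprn_ege1// ler1n].
have [b Hb] : exists b : int -> bool, forall k,
    dyadic j.+1 (x k) = dyadic j (x k) + (b k)%:R / 2 ^+ j.+1.
  have [b Hb] := choice (fun k => dyadic_step j (x k)); by exists b.
pose ab k := if b k then a k else 0.
have abY : l * \sum_(k <- s) sqabs (ab k) <= Y ^+ 2.
  apply: le_trans aY; rewrite ler_pM2l//; apply: ler_sum => k _.
  by rewrite /ab; case: (b k); rewrite ?lexx// sqabs0 sqabs_ge0.
pose y t := theta / 2 ^+ j.+1 * t.
pose P t := tpoly l s ab t + twist (fun k => dyadic j (x k)) s ab t.
have mP : cmeas P by apply: cmeasD; [exact: cmeas_tpoly|exact: cmeas_twist].
have PY : (N2 0 l xpredT P <= ((3 / 2 * Y) ^+ 2)%:E)%E.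
  have r2 : 0 < 2 * rho - 3 / 2 * rho / 2 ^+ j.
    by case: pV; have := rho0; set u := 2 ^- j; nra.
  apply: (@le_trans _ _ (((Y + (2 * rho - 3 / 2 * rho / 2 ^+ j) * Y) ^+ 2)%:E)).
    apply: N2D => //; first exact: cmeas_tpoly.
    - exact: cmeas_twist.
    - by rewrite mulr_gt0.
    - rewrite /N2; under [X in wint _ _ X]eq_fun do rewrite mul1r.
      by rewrite parseval// lee_fin.
    - exact: IH.
  have -> : Y + (2 * rho - 3 / 2 * rho / 2 ^+ j) * Y = (1 + (2 * rho - 3 / 2 * rho / 2 ^+ j)) * Y by ring.
  have k0 : 0 <= 1 + (2 * rho - 3 / 2 * rho / 2 ^+ j) by rewrite addr_ge0// ltW.
  rewrite lee_fin ler_sqr ?nnegrE ?(mulr_ge0 _ (ltW Y0))// ler_pM2r//.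
  case: pV; have := rho0; have := rho_small; set u := (2 ^+ j)^-1; nra.
have E t : twist (fun k => dyadic j.+1 (x k)) s a t =
    twist (fun k => dyadic j (x k)) s a t + (cis (- y t) - 1) * P t.
  rewrite /P /twist /tpoly -!big_split/= mulr_sumr -big_split/=; apply: eq_bigr => k _.
  rewrite Hb /ab; case: (b k); last first.
    by rewrite mul0r addr0 !mul0r addr0 mulr0 addr0.
  have -> : - (theta * (dyadic j (x k) + true%:R / 2 ^+ j.+1) * t) =
     - (theta * dyadic j (x k) * t) + (- y t).
    by rewrite /y (_ : true%:R = 1 :> R)//; ring.
  by rewrite cisD; ring.
have -> : twist (fun k => dyadic j.+1 (x k)) s a =
  fun t => twist (fun k => dyadic j (x k)) s a t + (cis (- y t) - 1) * P t.
  by apply/funext.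
have my : cmeas (fun t => (cis (- y t) - 1) * P t).
  apply: cmeasM => //; apply: cmeasB; last exact: cmeas_cst.
  apply: cmeas_cis; apply: measurable_funN; apply: measurable_funM; first exact: measurable_cst.
  exact: measurable_id.
have th0 : 0 < theta by rewrite /theta divr_gt0// mulr_gt0// pi_gt0.
have Vj : 0 < (2 ^+ j.+1)^-1 :> R by rewrite invr_gt0 exprn_gt0.
have small : (N2 0 l xpredT (fun t => (cis (- y t) - 1) * P t)%R <=
    ((rho / 2 ^+ j.+1 * (3 / 2 * Y)) ^+ 2)%:E)%E.
  rewrite exprMn EFinM; apply: (@le_trans _ _ (((rho / 2 ^+ j.+1) ^+ 2)%:E * N2 0 l xpredT P)%E); last first.
    by rewrite lee_wpmul2l// lee_fin sqr_ge0.
  rewrite -wintZ ?sqr_ge0//; last exact: nnmeas_N2.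
  apply: wint_le => [||t].
  - exact: nnmeas_N2.
  - by apply: nnmeasM; [apply: nnmeas_cst; exact: sqr_ge0|exact: nnmeas_N2].
  - rewrite add0r => /andP[t0 tl]; rewrite !mul1r sqabsM ler_wpM2r ?sqabs_ge0//.
    apply: le_trans (sqabs_cis_sub1 _) _; rewrite sqrrN ler_sqr ?nnegrE.
    + have -> : y t = theta / 2 ^+ j.+1 * t by [].
      have -> : rho / 2 ^+ j.+1 = theta / 2 ^+ j.+1 * l by rewrite /rho mulrAC.
      by apply: ler_wpM2l; [apply: mulr_ge0; exact: ltW|exact: ltW].
    + by apply: mulr_ge0 => //; apply: mulr_ge0; exact: ltW.
    + by apply: mulr_ge0; exact: ltW.
have e : 2 * rho - 3 / 2 * rho / 2 ^+ j.+1 =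
    (2 * rho - 3 / 2 * rho / 2 ^+ j) + rho / 2 ^+ j.+1 * (3 / 2).
  by rewrite exprS; field; rewrite gt_eqF.
have d0 : 0 < 2 * rho - 3 / 2 * rho / 2 ^+ j.
  by case: pV; have := rho0; set u := 2 ^- j; nra.
rewrite e mulrDl -[rho / 2 ^+ j.+1 * (3 / 2) * Y]mulrA; apply: N2D => //; first exact: cmeas_twist.
- by rewrite mulr_gt0.
- by apply: mulr_gt0; [exact: mulr_gt0 rho0 Vj|rewrite mulr_gt0// divr_gt0].
- exact: IH.
Qed.

Lemma twist_bound (x : int -> R) s (a : int -> C) (V : R) :
  (forall k, 0 <= x k < 1) -> uniq s -> 0 < V ->
  l * \sum_(k <- s) sqabs (a k) <= V ->
  (N2 0 l xpredT (twist x s a) <= (9 * rho ^+ 2 * V)%:E)%E.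
Proof.
move=> x01 us V0 aV; pose Y := Num.sqrt V.
have Y0 : 0 < Y by rewrite sqrtr_gt0.
have YV : Y ^+ 2 = V by rewrite sqr_sqrtr// ltW.
rewrite -{}YV in aV *.
(* With as many digits as terms, the factor 2^-j pays for the number of terms lost in a crude
   Cauchy-Schwarz bound of the remainder [d]. *)
pose j := size s; pose q k := dyadic j (x k).
have p0 : 0 < 2 ^+ j :> R by rewrite exprn_gt0.
pose d t := \sum_(k <- s) a k * (cis (- (theta * x k * t)) - cis (- (theta * q k * t))) * ch l k t.
have mlin c : measurable_fun setT (fun t : R => - (c * t)).
  by apply: measurable_funN; apply: measurable_funM; [exact: measurable_cst|exact: measurable_id].
have md : cmeas d.
  apply: cmeas_sum => k; apply: cmeasM; last exact: cmeas_ch.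
  apply: cmeasM; first exact: cmeas_cst.
  by apply: cmeasB; apply: cmeas_cis; exact: mlin.
have -> : twist x s a = fun t => twist q s a t + d t.
  by apply/funext => t; rewrite /twist /d -big_split/=; apply: eq_bigr => k _; ring.
have th0 : 0 < theta by rewrite /theta divr_gt0// mulr_gt0// pi_gt0.
have dY : (N2 0 l xpredT d <= ((rho * Y) ^+ 2)%:E)%E.
  apply: (@le_trans _ _ (wint 0 l (fun=> (size s)%:R * \sum_(k <- s) sqabs (a k) * (rho / 2 ^+ j) ^+ 2))).
    apply: wint_le => [||t].
    - exact: nnmeas_N2.
    - by apply: nnmeas_cst; rewrite mulr_ge0// sumr_ge0// => k _; rewrite mulr_ge0 ?sqabs_ge0 ?sqr_ge0.
    - rewrite add0r => /andP[t0 tl]; rewrite mul1r.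
      apply: le_trans (sqabs_sum _ _) _; rewrite ler_wpM2l//; apply: ler_sum => k _.
      rewrite sqabsM sqabs_ch mulr1 sqabsM ler_wpM2l ?sqabs_ge0//.
      have -> : cis (- (theta * x k * t)) - cis (- (theta * q k * t)) =
          cis (- (theta * q k * t)) * (cis (- (theta * (x k - q k) * t)) - 1).
        by rewrite mulrBr mulr1 -cisD; congr (cis _ - _); ring.
      rewrite sqabsM sqabs_cis mul1r; apply: le_trans (sqabs_cis_sub1 _) _.
      have /andP[h1 h2] := dyadic_itv j (x k).
      rewrite sqrrN ler_sqr ?nnegrE; last by rewrite divr_ge0 ?exprn_ge0// ltW.
        rewrite /rho -mulrA -[leRHS]mulrA ler_wpM2l//; first exact: ltW.
        by rewrite [leRHS]mulrC; apply: ler_pM => //; exact: ltW.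
      by rewrite mulr_ge0// mulr_ge0// ltW.
  rewrite wint_cst; last exact: ltW.
  rewrite lee_fin -mulr_suml [leRHS]exprMn.
  have -> : (size s)%:R * ((\sum_(k <- s) sqabs (a k)) * (rho / 2 ^+ j) ^+ 2) * l =
      ((size s)%:R / (2 ^+ j) ^+ 2) * (rho ^+ 2 * (l * \sum_(k <- s) sqabs (a k))).
    by field; rewrite gt_eqF.
  apply: (@le_trans _ _ (1 * (rho ^+ 2 * (l * \sum_(k <- s) sqabs (a k))))).
    rewrite ler_wpM2r//.
      apply: mulr_ge0; first exact: sqr_ge0.
      by apply: mulr_ge0; [exact: ltW|apply: sumr_ge0 => k _; exact: sqabs_ge0].
    rewrite ler_pdivrMr ?exprn_gt0// mul1r expr2 -natrX -natrM ler_nat.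
    apply: (@leq_trans (2 ^ j)); first exact/ltnW/ltn_expl.
    by rewrite leq_pmulr// expn_gt0.
  by rewrite mul1r ler_wpM2l ?sqr_ge0.
have bq : (N2 0 l xpredT (twist q s a) <= ((2 * rho * Y) ^+ 2)%:E)%E.
  apply: le_trans (twist_dyadic j x01 us Y0 aV) _; rewrite lee_fin.
  have r1 : 0 <= 3 / 2 * rho by apply: mulr_ge0; [rewrite divr_ge0|exact: ltW].
  have r2 : 0 <= 3 / 2 * rho / 2 ^+ j by apply: divr_ge0 => //; exact: ltW.
  have r3 : 3 / 2 * rho / 2 ^+ j <= 3 / 2 * rho.
    by rewrite ler_pdivrMr// ler_peMr// exprn_ege1// ler1n.
  have Yge := ltW Y0; have rge := ltW rho0.
  rewrite ler_sqr ?nnegrE.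
  - by rewrite ler_pM2r// gerBl.
  - by apply: mulr_ge0 => //; lra.
  - by apply: mulr_ge0 => //; lra.
have -> : 9 * rho ^+ 2 * Y ^+ 2 = (2 * rho * Y + rho * Y) ^+ 2 by ring.
apply: N2D => //; first exact: cmeas_twist.
- by apply: mulr_gt0 => //; apply: mulr_gt0 => //; exact: rho0.
- exact: mulr_gt0 rho0 Y0.
Qed.

Definition slow (k : int) : int := Num.floor (k%:~R * T / l).
Definition unslow (z : int) : int := Num.ceil (z%:~R * l / T).

(** Since l <= T, consecutive numbers k T / l are at least 1 apart, so rounding loses nothing and a
    ceiling recovers k. *)
Lemma slowK : cancel slow unslow.
Proof.
move=> k; rewrite /unslow /slow; set z := Num.floor _.
have /andP[h1 h2] : z%:~R <= k%:~R * T / l < z%:~R + 1 := floor_itvP _.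
apply/eqP; rewrite ceil_eq intrB; apply/andP; split.
  rewrite ltr_pdivlMr// mulrBl ltrBlDr.
  move: h2; rewrite ltr_pdivrMr// mulrDl mul1r => h2; apply: lt_le_trans h2 _.
  by rewrite lerD2l mul1r.
by rewrite ler_pdivrMr//; move: h1; rewrite ler_pdivlMr.
Qed.

Definition offset (k : int) : R := k%:~R * T / l - (slow k)%:~R.

Lemma offset01 k : 0 <= offset k < 1.
Proof.
have /andP[h1 h2] := floor_itvP (k%:~R * T / l).
by rewrite /offset subr_ge0 h1/= ltrBlDl.
Qed.

Lemma ch_slow k t : ch T (slow k) t = cis (- (theta * offset k * t)) * ch l k t.
Proof.
rewrite /ch -cisD; congr cis; rewrite /theta /offset.
by field; rewrite !gt_eqF.
Qed.

Definition slow_freqs : set int := range slow.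

Lemma twistE s (a : int -> C) t : \sum_(k <- s) a k * ch T (slow k) t =
  tpoly l s a t + twist offset s a t.
Proof.
rewrite /twist /tpoly -big_split/=; apply: eq_bigr => k _.
by rewrite ch_slow; ring.
Qed.

Lemma arc_window (A : R -> bool) f : measurable_fun setT A -> cmeas f ->
  (forall t, 0 <= t < T -> A t = (t < l)) -> N2 0 T A f = N2 0 l xpredT f.
Proof.
move=> mA mf At; rewrite /N2.
have -> : T = l + (T - l) by rewrite addrC subrK.
rewrite wint_split ?subr_ge0 ?(ltW l0)//; last exact: nnmeas_N2.
rewrite [X in (_ + X)%E](wint_eq (G := fun=> 0)); last first.
  move=> t /andP[t1 t2]; rewrite At; first by rewrite add0r in t1; rewrite ltNge t1 mul0r.
  by move: t1 t2; rewrite add0r addrC subrK => t1 ->; rewrite (le_trans (ltW l0) t1).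
rewrite [X in (_ + X)%E]/wint integral0 adde0; apply: wint_eq => t.
rewrite add0r => /andP[t0 tl]; rewrite At ?tl//.
by rewrite t0/= (lt_le_trans tl).
Qed.

(** Approximate in the orthogonal system of the arc, then replace each frequency by its rounding:
    the two errors contribute V / 8 and 54 rho^2 V <= 3 V / 8. *)
Lemma arc_total (A : R -> bool) : measurable_fun setT A ->
  (forall t, 0 <= t < T -> A t = (t < l)) -> totalL2 0 T A slow_freqs.
Proof.
move=> mA At; apply: total_of_contraction => // g V mg V0.
rewrite (arc_window _ _ At)// => gV.
have gfin : (N2 0 l xpredT g < +oo)%E by rewrite (le_lt_trans gV)// ltry.
have V16 : 0 < V / 16 by rewrite divr_gt0.
have [s [a [us _ ga]]] := trig_total l0 mg gfin V16.
pose P t := \sum_(k <- s) a k * ch T (slow k) t.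
have cP : combo T slow_freqs P.
  by apply: combo_sum => k; apply: comboZ; apply: combo_ch; exists k.
exists P => //; have mP := cmeas_combo cP.
rewrite (arc_window _ _ At)//; last exact: cmeasB.
have mt := cmeas_tpoly l s a; have mgt := cmeasB mg mt.
have aV : l * \sum_(k <- s) sqabs (a k) <= 3 * V.
  rewrite -lee_fin -(parseval 0)//.
  have -> : wint 0 l (fun x => sqabs (tpoly l s a x)) =
     N2 0 l xpredT (fun x => g x + (tpoly l s a x - g x)).
    by apply: wint_eq => x _; rewrite mul1r addrC subrK.
  apply: le_trans (N2D2 _ _ mg (cmeasB mt mg)) _ => //.
  rewrite N2B_comm.
  apply: (@le_trans _ _ (2%:E * V%:E + 2%:E * (V / 16)%:E)%E).
    by apply: leeD; apply: lee_wpmul2l.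
  by rewrite -!EFinM -EFinD lee_fin; lra.
have V3 : 0 < 3 * V by rewrite mulr_gt0.
have tw := twist_bound offset01 us V3 aV.
have -> : (fun x => g x - P x) = fun x => (g x - tpoly l s a x) + (-1) * twist offset s a x.
  by apply/funext => x; rewrite /P twistE; ring.
have mtw := cmeas_twist offset s a.
apply: le_trans (N2D2 _ _ mgt _) _ => //; first by apply: cmeasM => //; exact: cmeas_cst.
rewrite N2Z// sqabsN sqabs1 mul1e.
apply: (@le_trans _ _ (2%:E * (V / 16)%:E + 2%:E * (9 * rho ^+ 2 * (3 * V))%:E)%E).
  by apply: leeD; apply: lee_wpmul2l.
rewrite -!EFinM -EFinD lee_fin.
have r2 : rho ^+ 2 <= 144^-1.
  have -> : 144^-1 = 12^-1 ^+ 2 :> R by rewrite exprVn -natrX.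
  by rewrite ler_sqr ?nnegrE ?invr_ge0// ltW.
have : rho ^+ 2 * V <= 144^-1 * V by rewrite ler_wpM2r// ltW.
lra.
Qed.

Lemma arc_lower (A : R -> bool) : measurable_fun setT A ->
  (forall t, 0 <= t < T -> A t = (t < l)) -> lowerL2 0 T A slow_freqs.
Proof.
(* Any constant up to 7 l / 16 would do: with S the sum of squares and Q the polynomial, l S <= 2
   |Q|^2 + 18 rho^2 l S and 18 rho^2 <= 1/8. *)
move=> mA At; exists (l / 4) => [|s a us La]; first by rewrite divr_gt0.
(* Frequencies of [s] outside the range of [slow] carry zero coefficients and are dropped; the
   others are relabelled by k. *)
pose s' := [seq unslow z | z <- s & slow (unslow z) == z].
pose a' k := a (slow k).
have us' : uniq s'.
  rewrite map_inj_in_uniq ?filter_uniq// => y z.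
  by rewrite !mem_filter => /andP[/eqP hy _] /andP[/eqP hz _] e; rewrite -hy -hz e.
have off z : slow (unslow z) != z -> a z = 0.
  by move=> zz; apply: La => -[k _ kz]; move: zz; rewrite -kz slowK eqxx.
have E1 (F : int -> C -> R) : (forall z, F z 0 = 0) ->
    \sum_(z <- s) F z (a z) = \sum_(k <- s') F (slow k) (a' k).
  move=> F0; rewrite /s' big_map big_filter [LHS](bigID (fun z => slow (unslow z) == z))/=.
  rewrite [X in _ + X]big1 ?addr0; last by move=> z /off ->.
  by apply: eq_bigr => z /eqP zz; rewrite /a' zz.
have E2 t : tpoly T s a t = \sum_(k <- s') a' k * ch T (slow k) t.
  rewrite /s' big_map big_filter /tpoly [LHS](bigID (fun z => slow (unslow z) == z))/=.
  rewrite [X in _ + X]big1 ?addr0; last by move=> z /off ->; rewrite mul0r.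
  by apply: eq_bigr => z /eqP zz; rewrite /a' zz.
rewrite (E1 (fun _ c => sqabs c)); last by move=> _; rewrite sqabs0.
set S := \sum_(k <- s') _.
have S0 : 0 <= S by apply: sumr_ge0 => k _; exact: sqabs_ge0.
rewrite (arc_window _ _ At)//; last exact: cmeas_tpoly.
have -> : tpoly T s a = fun t => tpoly l s' a' t + twist offset s' a' t.
  by apply/funext => t; rewrite E2 twistE.
set Q : R -> C := (fun t : R => _ + _).
have [S_eq0|Sn0] := eqVneq S 0; first by rewrite S_eq0 mulr0 N2_ge0.
have V0 : 0 < l * S by rewrite mulr_gt0// lt0r Sn0.
have tw := twist_bound offset01 us' V0 (lexx _).
have mt := cmeas_tpoly l s' a'; have mtw := cmeas_twist offset s' a'.
have mQ : cmeas Q by exact: cmeasD.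
have : (N2 0 l xpredT (tpoly l s' a') <= 2%:E * N2 0 l xpredT Q + 2%:E * N2 0 l xpredT (twist offset s' a'))%E.
  have -> : tpoly l s' a' = fun t => Q t + (-1) * twist offset s' a' t.
    by apply/funext => t; rewrite /Q; ring.
  apply: le_trans (N2D2 _ _ mQ _) _ => //; first by apply: cmeasM => //; exact: cmeas_cst.
  by rewrite N2Z// sqabsN sqabs1 mul1e.
have -> : N2 0 l xpredT (tpoly l s' a') = (l * S)%:E.
  by rewrite -(parseval 0)//; apply: wint_eq => t _; rewrite mul1r.
have [|Qoo _] := ltP (N2 0 l xpredT Q) +oo%E; last by apply: le_trans Qoo; rewrite leey.
rewrite -ge0_fin_numE ?N2_ge0// => Qfin; rewrite -(fineK Qfin) => H.
have {H} : ((l * S)%:E <= 2%:E * (fine (N2 0 l xpredT Q))%:E + 2%:E * (9 * rho ^+ 2 * (l * S))%:E)%E.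
  apply: le_trans H _; rewrite leeD2l// lee_wpmul2l//.
rewrite -!EFinM -EFinD !lee_fin.
have r2 : rho ^+ 2 <= 144^-1.
  have -> : 144^-1 = 12^-1 ^+ 2 :> R by rewrite exprVn -natrX.
  by rewrite ler_sqr ?nnegrE ?invr_ge0// ltW.
have : rho ^+ 2 * (l * S) <= 144^-1 * (l * S) by rewrite ler_wpM2r// ltW.
lra.
Qed.

End Perturbation.

Lemma infinite_inj_image (f : int -> int) (A : set int) : injective f ->
  infinite_set A -> infinite_set (f @` A).
Proof.
move=> inj_f iA fin; apply: iA.
by rewrite (eq_finite_set (inj_card_eq (A := A) (f := f) _)) in fin => // x y _ _ /inj_f.
Qed.

Lemma infinite_setT_int : infinite_set [set: int].
Proof.
apply: (@sub_infinite_set _ (range Posz)) => //.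
move=> fin; apply: infinite_nat.
by rewrite (eq_finite_set (inj_card_eq (A := setT) (f := Posz) _)) in fin => // x y _ _ [].
Qed.

(** * First examples of good sets *)

Section BasicGood.
Variable R : realType.

Lemma good_arc (l T : R) (A : R -> bool) : 0 < l -> l <= T -> 2 * pi / T * l <= 12^-1 ->
  measurable_fun setT A -> (forall t, 0 <= t < T -> A t = (t < l)) -> good T A.
Proof.
move=> l0 lT small mA At; exists (slow_freqs l T); split.
- move=> _; apply: infinite_inj_image; last exact: infinite_setT_int.
  exact: can_inj (slowK l0 lT).
- exact: arc_lower.
- exact: arc_total.
Qed.

Lemma good_empty (T : R) (A : R -> bool) :
  (forall t, 0 <= t < T -> A t = false) -> good T A.
Proof.
move=> At; exists set0; split.
- by case=> x xT; rewrite At.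
- exists 1 => // s a us a0; rewrite big1 ?mulr0 ?N2_ge0// => z _.
  by rewrite a0 ?sqabs0.
- move=> g mg _ eps eps0; exists [::], (fun=> 0); split => //.
  rewrite /N2 (wint_eq (G := fun=> 0)); first by rewrite /wint integral0 lee_fin ltW.
  by move=> x xT; rewrite At ?mul0r//; move: xT; rewrite add0r.
Qed.

Lemma good_full (T : R) (A : R -> bool) : 0 < T ->
  (forall t, 0 <= t < T -> A t) -> good T A.
Proof.
move=> T0 At; have E f : N2 0 T A f = N2 0 T xpredT f.
  by apply: wint_eq => x; rewrite add0r => xT; rewrite At.
exists setT; split.
- by move=> _; exact: infinite_setT_int.
- exists T => // s a us _; rewrite E -(parseval 0)// le_eqVlt; apply/orP; left; apply/eqP.
  by apply: wint_eq => x _; rewrite mul1r.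
- move=> g mg; rewrite E => gfin eps eps0.
  have [s [a [us La H]]] := trig_total T0 mg gfin eps0.
  by exists s, a; split=> //; rewrite E.
Qed.

End BasicGood.

(** * Splitting a period into N parts *)

Section Vandermonde.
Variables (F : fieldType) (N : nat) (zeta : 'I_N -> F).
Hypothesis zeta_inj : injective zeta.

(** [beta] is the inverse of the Vandermonde matrix of the nodes in [J]. As a left inverse it reads
    off coefficients from values, for the lower inequality; as a right inverse it interpolates given
    values, for totality. *)
Lemma vandermonde_dual (J : {set 'I_N}) : exists beta : nat -> 'I_N -> F,
  (forall m n, (m < #|J|)%N -> (n < #|J|)%N ->
     \sum_(j in J) beta m j * zeta j ^+ n = (m == n)%:R) /\
  (forall i j, i \in J -> j \in J ->
     \sum_(m < #|J|) zeta i ^+ m * beta m j = (i == j)%:R).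
Proof.
pose k := #|J|; pose e (i : 'I_k) : 'I_N := enum_val i.
pose V := Vandermonde k (\row_(i < k) zeta (e i)).
have Vu : V \in unitmx.
  rewrite unitmxE det_Vandermonde unitfE; apply/prodf_neq0 => i _.
  apply/prodf_neq0 => j ij; rewrite !mxE subr_eq0; apply/eqP => /zeta_inj /enum_val_inj ji.
  by move: ij; rewrite ji ltnn.
pose W := invmx V.
(* Extension by 0 to all indices, so that the type of [beta] does not depend on the size of [J]. *)
pose beta (m : nat) (j : 'I_N) : F :=
  \sum_(i < k) \sum_(n < k) (e i == j)%:R * (n == m :> nat)%:R * W i n.
have VE m i : V m i = zeta (e i) ^+ m by rewrite !mxE.
have betaE (m : 'I_k) i : beta m (e i) = W i m.
  rewrite /beta (bigD1 i)//= (bigD1 m)//= !eqxx !mul1r.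
  rewrite big1 ?addr0 => [|n nm]; last by rewrite (negbTE (_ : n != m :> nat))// mulr0 mul0r.
  rewrite big1 ?addr0// => i' ii'; apply: big1 => n _.
  rewrite (negbTE (_ : e i' != e i)) ?mul0r//.
  by apply: contra ii' => /eqP /enum_val_inj ->.
exists beta; split=> [m n mk nk|i j iJ jJ].
  have -> : \sum_(j in J) beta m j * zeta j ^+ n =
      \sum_(i < k) V (Ordinal nk) i * W i (Ordinal mk).
    rewrite big_enum_val /=.
    by apply: eq_bigr => i _; rewrite VE -[m]/(nat_of_ord (Ordinal mk)) betaE mulrC.
  have := mulmxV Vu; move/matrixP => /(_ (Ordinal nk) (Ordinal mk)); rewrite !mxE => ->.
  by rewrite -val_eqE /= eq_sym.
have ei : e (enum_rank_in iJ i) = i by rewrite /e enum_rankK_in.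
have ej : e (enum_rank_in iJ j) = j by rewrite /e enum_rankK_in.
set i' := enum_rank_in iJ i in ei; set j' := enum_rank_in iJ j in ej.
transitivity (\sum_(m < k) W j' m * V m i').
  by apply: eq_bigr => m _; rewrite VE ei -ej betaE mulrC.
have := mulVmx Vu; move/matrixP => /(_ j' i'); rewrite !mxE => ->.
by rewrite -ei -ej (inj_eq enum_val_inj) eq_sym.
Qed.

End Vandermonde.

(** * A discrete Gronwall inequality, run backwards *)

Section GeometricRecursion.
Variable R : realFieldType.

(** Including one more term at the lower end multiplies X plus the tail by at most 1 + D. *)
Lemma downward_gronwall (D X : R) N (x : nat -> R) : 0 <= D ->
  (forall m, (m < N)%N -> x m <= D * (X + \sum_(m.+1 <= n < N) x n)) ->
  X + \sum_(n < N) x n <= (1 + D) ^+ N * X.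
Proof.
move=> D0 H.
suff S i : (i <= N)%N -> X + \sum_(N - i <= n < N) x n <= (1 + D) ^+ i * X.
  by have := S N (leqnn N); rewrite subnn big_mkord.
elim: i => [|i IH] iN; first by rewrite subn0 big_geq// addr0 expr0 mul1r.
have lt : (N - i.+1 < N)%N by rewrite ltn_subrL/= (leq_trans _ iN).
have e : (N - i.+1).+1 = (N - i)%N by rewrite subnSK.
rewrite big_ltn// e addrCA.
have := H _ lt; rewrite e => h.
have := IH (ltnW iN); set Y := X + _ => h2.
rewrite exprS -mulrA mulrDl mul1r.
apply: (@le_trans _ _ (D * Y + Y)); first by rewrite lerD2r.
rewrite addrC lerD// ler_wpM2l//.
Qed.

End GeometricRecursion.

(** * Integers as pairs of a residue and a quotient modulo N *)

Section Residues.
Variable N : nat.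
Hypothesis N0 : (0 < N)%N.

Definition rd (z : int) : nat := `|(z %% N%:Z)%Z|%N.
Definition qd (z : int) : int := (z %/ N%:Z)%Z.
Definition enc (m : nat) (q : int) : int := N%:Z * q + m%:Z.

Lemma N0z : N%:Z != 0. Proof. by rewrite eqz_nat -lt0n. Qed.

Lemma rd_lt z : (rd z < N)%N.
Proof.
by rewrite -ltz_nat /rd gez0_abs ?modz_ge0 ?N0z// ltz_mod// N0z.
Qed.

Lemma encK z : enc (rd z) (qd z) = z.
Proof.
by rewrite /enc /rd gez0_abs ?modz_ge0 ?N0z// /qd mulrC -divz_eq.
Qed.

Lemma qd_enc m q : (m < N)%N -> qd (enc m q) = q.
Proof.
move=> mN; rewrite /qd /enc mulrC divzMDl ?N0z// divz_small ?addr0//.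
Qed.

Lemma rd_enc m q : (m < N)%N -> rd (enc m q) = m.
Proof.
move=> mN; rewrite /rd /enc mulrC modzMDl modz_small ?absz_nat//.
Qed.

End Residues.

(** * Goodness of a set from goodness of its fibre-count superlevel sets *)

Section Combining.
Variables (R : realType) (N : nat) (h : R) (A : R -> bool).
Hypotheses (N0 : (0 < N)%N) (h0 : 0 < h) (mA : measurable_fun setT A).
Local Notation C := R[i].
Let T : R := N%:R * h.
Let Nr : N%:R != 0 :> R. Proof. by rewrite pnatr_eq0 -lt0n. Qed.
Let T0 : 0 < T. Proof. by rewrite mulr_gt0// ltr0n. Qed.

Definition fiber (t : R) : {set 'I_N} := finset (fun j : 'I_N => A (t + (j : nat)%:R * h)).
Definition level (m : nat) (t : R) : bool := (m < #|fiber t|)%N.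

Definition zeta (j : 'I_N) : C := cis (2 * pi * ((j : nat)%:R / N%:R)).

Lemma zeta_inj : injective zeta.
Proof.
have key (i j : 'I_N) : (i < j)%N -> zeta i <> zeta j.
  move=> ij e.
  have : cis (2 * pi * (((j : nat) - i)%N%:R / N%:R)) = 1 :> C.
    rewrite -(cisNM (2 * pi * ((i : nat)%:R / N%:R))) [cis _ * _]mulrC -/(zeta i) e /zeta -cisD.
    by congr cis; rewrite natrB 1?ltnW//; ring.
  move/cis_2pi_eq1; set z := Num.floor _ => hz.
  have x0 : 0 < ((j : nat) - i)%N%:R / N%:R :> R by rewrite divr_gt0 ?ltr0n ?subn_gt0.
  have x1 : ((j : nat) - i)%N%:R / N%:R < 1 :> R.
    by rewrite ltr_pdivrMr ?ltr0n// mul1r ltr_nat (leq_ltn_trans (leq_subr _ _)).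
  move: x0 x1; rewrite hz ltr0z -[1]/(1%:~R) ltr_int.
  by case: z {hz} => // -[].
move=> i j ij; apply/val_inj/eqP; case: ltngtP => // lt.
  by have := key i j lt ij.
by have := key j i lt (esym ij).
Qed.

Lemma ch_node (j : 'I_N) (m : nat) t :
  ch T m%:Z (t + (j : nat)%:R * h) = zeta j ^+ m * ch T m%:Z t.
Proof.
rewrite ch_add mulrC; congr (_ * _); rewrite /ch /zeta -cis_natM; congr cis.
by rewrite /T -pmulrn; field; rewrite Nr gt_eqF.
Qed.

Definition dual (J : {set 'I_N}) := sval (cid (vandermonde_dual zeta_inj J)).

Lemma dual_left (J : {set 'I_N}) m n : (m < #|J|)%N -> (n < #|J|)%N ->
  \sum_(j in J) dual J m j * zeta j ^+ n = (m == n)%:R.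
Proof. by case: (svalP (cid (vandermonde_dual zeta_inj J))) => H _; exact: H. Qed.

Lemma dual_right (J : {set 'I_N}) i j : i \in J -> j \in J ->
  \sum_(m < #|J|) zeta i ^+ m * dual J m j = (i == j)%:R.
Proof. by case: (svalP (cid (vandermonde_dual zeta_inj J))) => _ H; exact: H. Qed.

(** There are finitely many possible fibres, so a single constant bounds all dual systems, uniformly
    in t. *)
Let K : R := \sum_(J : {set 'I_N}) \sum_(m < N) \sum_(j : 'I_N) sqabs (dual J m j).

Lemma K_ge0 : 0 <= K.
Proof. by do 3!(apply: sumr_ge0 => ? _); exact: sqabs_ge0. Qed.

Lemma dual_bound (J : {set 'I_N}) m j : (m < N)%N -> sqabs (dual J m j) <= K.
Proof.
move=> mN.
have term (I : finType) (F : I -> R) i : (forall i, 0 <= F i) -> F i <= \sum_i F i.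
  by move=> F0; rewrite (bigD1 i)//= lerDl sumr_ge0.
rewrite /K; apply: le_trans (term _ _ J _); last first.
  by move=> ?; do 2!(apply: sumr_ge0 => ? _); exact: sqabs_ge0.
apply: le_trans (term _ _ (Ordinal mN) _); last first.
  by move=> ?; apply: sumr_ge0 => ? _; exact: sqabs_ge0.
by apply: (term _ (fun j => sqabs (dual J m j))) => ?; exact: sqabs_ge0.
Qed.

Lemma card_fiber_le (J : {set 'I_N}) : (#|J| <= N)%N.
Proof. by rewrite -[X in (_ <= X)%N](card_ord N) max_card. Qed.

(* For t in the fold, the values on the fibre minus the modes of index at least #|J t| determine
   the modes of smaller index through the dual Vandermonde system. *)
Definition target (g : R -> C) (f : nat -> R -> C) (m : nat) (t : R) : C :=
  ch T (- m%:Z) t * \sum_(j in fiber t) dual (fiber t) m j *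
    (g (t + (j : nat)%:R * h) -
     \sum_(n < N | (#|fiber t| <= n)%N) zeta j ^+ n * (ch T n%:Z t * f n t)).

Definition synth (f : nat -> R -> C) (t : R) : C := \sum_(n < N) ch T n%:Z t * f n t.

Lemma synth_node f (j : 'I_N) t : (forall n, f n (t + (j : nat)%:R * h) = f n t) ->
  synth f (t + (j : nat)%:R * h) = \sum_(n < N) zeta j ^+ n * (ch T n%:Z t * f n t).
Proof.
by move=> fp; apply: eq_bigr => n _; rewrite ch_node fp mulrA.
Qed.

Lemma sum_split_ord (k : nat) (F : nat -> C) : (k <= N)%N ->
  \sum_(n < N) F n = \sum_(n < k) F n + \sum_(n < N | (k <= n)%N) F n.
Proof.
move=> kN; rewrite (bigID (fun n : 'I_N => (n < k)%N))/=; congr (_ + _).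
  by rewrite (big_ord_widen N F kN).
by apply: eq_bigl => n; rewrite -leqNgt.
Qed.

(** Once the modes of index at least #|J| are subtracted, the values on the fibre are those of a
    polynomial in the nodes of degree below #|J|; the left inverse reads off its m-th
    coefficient. *)
Lemma target_synth f m t : (forall n (j : 'I_N), f n (t + (j : nat)%:R * h) = f n t) ->
  level m t -> target (synth f) f m t = f m t.
Proof.
move=> fp; rewrite /level /target; set J := fiber t => mk.
under eq_bigr => j _.
  rewrite synth_node// (sum_split_ord (fun n => zeta j ^+ n * (ch T n%:Z t * f n t)) (card_fiber_le J)).
  rewrite addrK mulr_sumr.
  over.
rewrite exchange_big/=.
under eq_bigr => n _.
  under eq_bigr do rewrite [dual _ _ _ * _]mulrA.
  rewrite -mulr_suml dual_left//.
  over.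
rewrite (bigD1 (Ordinal mk))//= eqxx mul1r big1 ?addr0.
  by rewrite mulrA chNM mul1r.
move=> n nm; rewrite (negbTE (_ : m != n)) ?mul0r//.
by apply: contra nm => /eqP e; apply/eqP/val_inj; rewrite /= e.
Qed.

(** Conversely, by the right inverse, low modes equal to their targets would reproduce [g] exactly
    on the fibre, whatever the high modes are. *)
Lemma target_solves g f t (i : 'I_N) : i \in fiber t ->
  \sum_(m < #|fiber t|) zeta i ^+ m * (ch T m%:Z t * target g f m t) =
  g (t + (i : nat)%:R * h) -
    \sum_(n < N | (#|fiber t| <= n)%N) zeta i ^+ n * (ch T n%:Z t * f n t).
Proof.
rewrite /target; set J := fiber t => iJ.
under eq_bigr => m _.
  rewrite [ch T m%:Z t * _]mulrA [ch T m%:Z t * _]mulrC chNM mul1r mulr_sumr.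
  over.
rewrite exchange_big/=.
under eq_bigr => j jJ.
  under eq_bigr do rewrite mulrA.
  rewrite -mulr_suml dual_right//.
  over.
rewrite (bigD1 i)//= eqxx mul1r [X in _ + X]big1 ?addr0// => j /andP[_ ji].
by rewrite eq_sym (negbTE ji) mul0r.
Qed.

Let Cst : R := N%:R * K * (2 * N%:R * N%:R).

Lemma sqabs_sum_cond (n : nat) (P : pred 'I_n) (F : 'I_n -> C) :
  sqabs (\sum_(i | P i) F i) <= n%:R * \sum_(i | P i) sqabs (F i).
Proof.
rewrite -big_filter; apply: le_trans (sqabs_sum _ _) _.
rewrite big_filter ler_wpM2r ?sumr_ge0//; first by move=> i _; exact: sqabs_ge0.
rewrite ler_nat size_filter; apply: leq_trans (count_size _ _) _.
by rewrite /index_enum -enumT size_enum_ord.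
Qed.

Lemma target_bound g f m t : (m < N)%N -> level m t ->
  sqabs (target g f m t) <= Cst *
    (\sum_(j < N) (A (t + (j : nat)%:R * h))%:R * sqabs (g (t + (j : nat)%:R * h)) +
     \sum_(m.+1 <= n < N) sqabs (f n t)).
Proof.
move=> mN; rewrite /level /target; set J := fiber t => mk.
set G := \sum_(j < N) _; set Q := \sum_(m.+1 <= n < N) _.
have N1 : 1 <= N%:R :> R by rewrite ler1n.
have G0 : 0 <= G by apply: sumr_ge0 => j _; rewrite mulr_ge0// sqabs_ge0.
have Q0 : 0 <= Q by apply: sumr_ge0 => j _; exact: sqabs_ge0.
rewrite sqabsM sqabs_ch mul1r; apply: le_trans (sqabs_sum_cond _ _) _.
rewrite /Cst -!mulrA ler_wpM2l//.
apply: (@le_trans _ _ (\sum_(j in J) K * (2 * sqabs (g (t + (j : nat)%:R * h)) + 2 * N%:R * Q))).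
  apply: ler_sum => j jJ; rewrite sqabsM.
  apply: ler_pM; rewrite ?sqabs_ge0 ?dual_bound//.
  apply: le_trans (sqabsD _ _) _; rewrite lerD2l sqabsN -mulrA ler_wpM2l//.
  apply: le_trans (sqabs_sum_cond _ _) _; rewrite ler_wpM2l//.
  apply: (@le_trans _ _ (\sum_(n < N | (#|J| <= n)%N) sqabs (f n t))).
    by apply: ler_sum => n _; rewrite !sqabsM sqabs_ch mul1r /zeta -cis_natM sqabs_cis mul1r.
  (* On [level m] the subtracted modes have index at least #|J| > m, so the tail beyond m contains
     them all. *)
  rewrite /Q -(big_mkord (fun n => #|J| <= n)%N (fun n => sqabs (f n t))).
  rewrite (@big_cat_nat _ _ _ m.+1 0 N)//= big_nat_cond big1 ?add0r.
    rewrite [leRHS](bigID (fun n => #|J| <= n)%N)/= lerDl.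
    by apply: sumr_ge0 => n _; exact: sqabs_ge0.
  by move=> n /andP[/andP[_ nm] kn]; have := leq_ltn_trans kn nm; rewrite ltnS leqNgt mk.
rewrite -mulr_sumr ler_wpM2l ?K_ge0// big_split/= -mulr_sumr sumr_const -[_ *+ #|J|]mulr_natl.
have GJ : \sum_(j in J) sqabs (g (t + (j : nat)%:R * h)) = G.
  rewrite /G [RHS](bigID (mem J))/= [X in _ + X]big1 ?addr0.
    by apply: eq_bigr => j; rewrite inE => ->; rewrite mul1r.
  by move=> j; rewrite inE => /negbTE ->; rewrite mul0r.
rewrite GJ !mulrDr; apply: lerD.
  have NN : G <= N%:R * N%:R * G.
    by apply: ler_peMl => //; rewrite -natrM ler1n muln_gt0 N0.
  by rewrite ler_wpM2l// mulrA.
have JN : #|J|%:R <= N%:R :> R by rewrite ler_nat card_fiber_le.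
have -> : 2 * (N%:R * (N%:R * Q)) = N%:R * (2 * N%:R * Q) by ring.
by rewrite ler_wpM2r// mulr_ge0// mulr_ge0.
Qed.

Lemma measurable_fiber_eq (J : {set 'I_N}) : measurable_fun setT (fun t => fiber t == J).
Proof.
have -> : (fun t => fiber t == J) =
    (fun t => all (fun j : 'I_N => A (t + (j : nat)%:R * h) == (j \in J)) (enum 'I_N)).
  apply/funext => t; apply/eqP/allP => [<- j _|H]; first by rewrite inE.
  by apply/setP => j; rewrite inE; apply/eqP/H; rewrite mem_enum.
elim: (enum 'I_N) => [|j s IH] /=; first exact: measurable_cst.
apply: measurable_and => //.
have mj : measurable_fun setT (fun t : R => A (t + (j : nat)%:R * h)).
  exact: (measurableT_comp mA (measurable_shift _)).
case: (j \in J); first by under eq_fun do rewrite eqb_id.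
by under eq_fun do rewrite eqbF_neg; exact: measurable_neg.
Qed.

Lemma measurable_level m : measurable_fun setT (level m).
Proof.
have -> : level m = (fun t => has (fun J : {set 'I_N} => (fiber t == J) && (m < #|J|)%N)
    (enum {set 'I_N})).
  apply/funext => t; apply/idP/hasP => [mt|[J _ /andP[/eqP <-]]//].
  by exists (fiber t); rewrite ?mem_enum// eqxx.
elim: (enum {set 'I_N}) => [|J s IH] /=; first exact: measurable_cst.
apply: measurable_or => //; apply: measurable_and; last exact: measurable_cst.
exact: measurable_fiber_eq.
Qed.

Lemma cmeas_target g f m : cmeas g -> (forall n, cmeas (f n)) -> cmeas (target g f m).
Proof.
move=> mg mf; apply: cmeasM; first exact: cmeas_ch.
(* The dependence on the fibre is made measurable by summing over all candidates J the expression
   cut off to the set where the fibre is J. *)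
have -> : (fun t => \sum_(j in fiber t) dual (fiber t) m j *
    (g (t + (j : nat)%:R * h) -
     \sum_(n < N | (#|fiber t| <= n)%N) zeta j ^+ n * (ch T n%:Z t * f n t))) =
  (fun t => \sum_(J <- enum {set 'I_N}) if fiber t == J then
    \sum_(j <- enum J) dual J m j * (g (t + (j : nat)%:R * h) -
     \sum_(n <- [seq n : 'I_N <- enum 'I_N | (#|J| <= n)%N]) zeta j ^+ n * (ch T n%:Z t * f n t))
    else 0).
  apply/funext => t; rewrite big_enum/= (bigD1 (fiber t))//= eqxx [X in _ + X]big1 ?addr0.
    rewrite big_enum/=; apply: eq_bigr => j _; congr (_ * (_ - _)).
    by rewrite big_filter big_enum_cond.
  by move=> J; rewrite eq_sym => /negbTE ->.
apply: cmeas_sum => J; apply: cmeas_if; [exact: measurable_fiber_eq| |exact: cmeas_cst].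
apply: cmeas_sum => j; apply: cmeasM; first exact: cmeas_cst.
apply: cmeasB; first by apply: cmeas_comp => //; exact: measurable_shift.
apply: cmeas_sum => n; apply: cmeasM; first exact: cmeas_cst.
by apply: cmeasM => //; exact: cmeas_ch.
Qed.

Lemma N2_fold f : cmeas f -> N2 0 T A f =
  wint 0 h (fun t => \sum_(j < N) (A (t + (j : nat)%:R * h))%:R * sqabs (f (t + (j : nat)%:R * h))).
Proof.
move=> mf; rewrite /N2 /T wint_fold ?(ltW h0)//; exact: nnmeas_N2.
Qed.

Lemma nnmeas_fold f : cmeas f ->
  nnmeas (fun t => \sum_(j < N) (A (t + (j : nat)%:R * h))%:R * sqabs (f (t + (j : nat)%:R * h))).
Proof.
move=> mf; apply: nnmeas_sum => j; exact: (nnmeas_shift _ (nnmeas_N2 mA mf)).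
Qed.

Lemma Cst_ge0 : 0 <= Cst.
Proof. by rewrite /Cst !mulr_ge0// K_ge0. Qed.

Lemma N2_target g f m : (m < N)%N -> cmeas g -> (forall n, cmeas (f n)) ->
  (N2 0 h (level m) (target g f m) <=
   Cst%:E * (N2 0 T A g + \sum_(m.+1 <= n < N) N2 0 h xpredT (f n)))%E.
Proof.
move=> mN mg mf.
have mS : nnmeas (fun t => \sum_(m.+1 <= n < N) sqabs (f n t)).
  by apply: nnmeas_sum => n; exact: cmeas_sqabs.
have mF := nnmeas_fold mg.
have -> : (\sum_(m.+1 <= n < N) N2 0 h xpredT (f n))%E =
    wint 0 h (fun t => \sum_(m.+1 <= n < N) sqabs (f n t)).
  rewrite wint_sum; last by move=> n; exact: cmeas_sqabs.
  by apply: eq_bigr => n _; apply: wint_eq => t _; rewrite mul1r.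
rewrite N2_fold// -wintD// -wintZ ?Cst_ge0//; last exact: nnmeasD.
apply: wint_le => [||t _].
- by apply: nnmeas_N2; [exact: measurable_level|exact: cmeas_target].
- by apply: nnmeasM; [apply: nnmeas_cst; exact: Cst_ge0|exact: nnmeasD].
- case: (boolP (level m t)) => lt; first by rewrite mul1r target_bound.
  rewrite mul0r mulr_ge0 ?Cst_ge0// addr_ge0//; first by case: mF.
  by case: mS.
Qed.

(** By [target_solves] the high modes cancel and only the errors of the modes below the size of the
    fibre remain, that is, those with [level m t]. One factor N counts the points, the other is
    Cauchy-Schwarz. *)
Lemma synth_error g f t : (forall n (j : 'I_N), f n (t + (j : nat)%:R * h) = f n t) ->
  \sum_(j < N) (A (t + (j : nat)%:R * h))%:R *
     sqabs (g (t + (j : nat)%:R * h) - synth f (t + (j : nat)%:R * h)) <=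
  N%:R * N%:R * \sum_(m < N) (level m t)%:R * sqabs (target g f m t - f m t).
Proof.
move=> fp; set S := \sum_(m < N) (level m t)%:R * _.
have S0 : 0 <= S by apply: sumr_ge0 => m _; rewrite mulr_ge0// sqabs_ge0.
rewrite -mulrA; apply: (@le_trans _ _ (\sum_(j < N) N%:R * S)); last first.
  by rewrite sumr_const card_ord -[leLHS]mulr_natl.
apply: ler_sum => j _; case: (boolP (A _)) => Aj; last by rewrite mul0r mulr_ge0.
have jJ : j \in fiber t by rewrite inE.
rewrite mul1r synth_node//.
rewrite (sum_split_ord (fun n => zeta j ^+ n * (ch T n%:Z t * f n t)) (card_fiber_le (fiber t))).
rewrite opprD addrCA addrC -target_solves// -sumrB.
apply: le_trans (sqabs_sum_cond _ _) _.
apply: ler_pM => //; first by apply: sumr_ge0 => m _; exact: sqabs_ge0.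
  by rewrite ler_nat card_fiber_le.
rewrite /S [leRHS](bigID (fun m : 'I_N => (m < #|fiber t|)%N))/= -[leLHS]addr0.
apply: lerD; last by apply: sumr_ge0 => m _; rewrite mulr_ge0// sqabs_ge0.
rewrite (big_ord_widen N (fun m => sqabs (zeta j ^+ m * (ch T m%:Z t * target g f m t) -
   zeta j ^+ m * (ch T m%:Z t * f m t))) (card_fiber_le (fiber t))).
apply: ler_sum => m mk; rewrite /level mk mul1r -!mulrBr !sqabsM sqabs_ch mul1r.
by rewrite /zeta -cis_natM sqabs_cis mul1r.
Qed.

Section Assemble.
Variable L : nat -> set int.
Definition assembled : set int := [set z | L (rd N z) (qd N z)].

Lemma ch_enc m q t : ch T (enc N m q) t = ch T m%:Z t * ch h q t.
Proof.
rewrite /enc chD mulrC; congr (_ * _).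
by rewrite -[in RHS](mulfK Nr h) -(ch_dilate _ _ _ N0) [h * _]mulrC.
Qed.

Lemma combo_enc m f : (m < N)%N -> combo h (L m) f ->
  combo T assembled (fun t => ch T m%:Z t * f t).
Proof.
move=> mN [s [a [us La ->]]].
have -> : (fun t => ch T m%:Z t * tpoly h s a t) =
    (fun t => \sum_(q <- s) a q * ch T (enc N m q) t).
  apply/funext => t; rewrite mulr_sumr; apply: eq_bigr => q _.
  by rewrite ch_enc mulrCA.
apply: combo_sum => q; have [Lq|Lq] := pselect (L m q); last first.
  by rewrite La//; under eq_fun do rewrite mul0r; exact: combo0.
by apply: comboZ; apply: combo_ch; rewrite /assembled /= rd_enc// qd_enc.
Qed.

Definition part_s (s : seq int) (m : nat) : seq int := [seq qd N z | z <- s & rd N z == m].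
Definition part_a (a : int -> C) (m : nat) (q : int) : C := a (enc N m q).

Lemma part_sum (V : nmodType) (F : int -> V) s :
  \sum_(z <- s) F z = \sum_(m < N) \sum_(q <- part_s s m) F (enc N m q).
Proof.
rewrite (partition_big (fun z => Ordinal (rd_lt N0 z)) xpredT)//=.
apply: eq_bigr => m _; rewrite /part_s big_map big_filter.
rewrite (eq_bigl (fun z => rd N z == m)); last by move=> z; rewrite -val_eqE.
by apply: eq_bigr => z /eqP <-; rewrite encK.
Qed.

Lemma part_uniq s m : uniq s -> uniq (part_s s m).
Proof.
move=> us; rewrite map_inj_in_uniq ?filter_uniq// => y z.
rewrite !mem_filter => /andP[/eqP hy _] /andP[/eqP hz _] e.
by rewrite -(encK N0 y) -(encK N0 z) hy hz e.
Qed.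

Lemma part_supported a m : (m < N)%N -> supported assembled a -> supported (L m) (part_a a m).
Proof.
by move=> mN La q Lq; apply: La; rewrite /assembled /= rd_enc// qd_enc.
Qed.

Lemma tpoly_parts s a :
  tpoly T s a = synth (fun m => tpoly h (part_s s m) (part_a a m)).
Proof.
apply/funext => t; rewrite /tpoly part_sum /synth; apply: eq_bigr => m _.
by rewrite mulr_sumr; apply: eq_bigr => q _; rewrite ch_enc mulrCA.
Qed.

Lemma tpoly_node s (a : int -> C) (j : nat) t : tpoly h s a (t + j%:R * h) = tpoly h s a t.
Proof.
by apply: eq_bigr => q _; rewrite pmulrn ch_periodZ// gt_eqF.
Qed.

Hypothesis L_lower : forall m, (m < N)%N -> lowerL2 0 h (level m) (L m).
Hypothesis L_total : forall m, (m < N)%N -> totalL2 0 h (level m) (L m).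

Lemma assembled_lower : lowerL2 0 T A assembled.
Proof.
have [c Hc] : exists c : nat -> R, forall m, (m < N)%N -> 0 < c m /\
    forall s a, uniq s -> supported (L m) a ->
    ((c m * \sum_(z <- s) sqabs (a z))%:E <= N2 0 h (level m) (tpoly h s a))%E.
  have /choice[c Hc] : forall m, exists c : R, (m < N)%N -> 0 < c /\
      forall s a, uniq s -> supported (L m) a ->
      ((c * \sum_(z <- s) sqabs (a z))%:E <= N2 0 h (level m) (tpoly h s a))%E.
    move=> m; have [mN|mN] := ltnP m N; last by exists 0.
    by have [c c0 H] := L_lower mN; exists c.
  by exists c.
(* The recursion below reads c m * x m <= Cst * (X + h * tail); the factor 1 + h dominates both 1
   and h, and the sum dominates all m at once. *)
pose D : R := \sum_(m < N) Cst / c m * (1 + h).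
have cD m : (m < N)%N -> Cst / c m * (1 + h) <= D.
  move=> mN; rewrite /D (bigD1 (Ordinal mN))//= lerDl sumr_ge0// => i _.
  have [ci _] := Hc i (ltn_ord i).
  by rewrite mulr_ge0// ?divr_ge0 ?Cst_ge0 ?(ltW ci)// addr_ge0// ltW.
have D0 : 0 <= D.
  apply: sumr_ge0 => i _; have [ci _] := Hc i (ltn_ord i).
  by rewrite mulr_ge0// ?divr_ge0 ?Cst_ge0 ?(ltW ci)// addr_ge0// ltW.
have D1 : 0 < (1 + D) ^+ N by rewrite exprn_gt0// ltr_wpDr.
exists ((1 + D) ^+ N)^-1 => [|s a us La]; first by rewrite invr_gt0.
have [|Foo] := ltP (N2 0 T A (tpoly T s a)) +oo%E; last first.
  by apply: le_trans Foo; rewrite leey.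
rewrite -ge0_fin_numE ?N2_ge0// => Ffin; rewrite -(fineK Ffin).
set X := fine _; rewrite lee_fin ler_pdivrMl//.
pose x m := \sum_(q <- part_s s m) sqabs (part_a a m q).
have x0 m : 0 <= x m by apply: sumr_ge0 => q _; exact: sqabs_ge0.
have -> : \sum_(z <- s) sqabs (a z) = \sum_(m < N) x m by rewrite part_sum.
have X0 : 0 <= X by rewrite fine_ge0// N2_ge0.
apply: le_trans (_ : X + \sum_(m < N) x m <= _); first by rewrite lerDr.
apply: downward_gronwall => // m mN.
have [cm Hm] := Hc m mN.
have := Hm _ _ (part_uniq m us) (part_supported mN La).
pose f n := tpoly h (part_s s n) (part_a a n).
have mf n : cmeas (f n) by exact: cmeas_tpoly.
have fp n (j : 'I_N) t : f n (t + (j : nat)%:R * h) = f n t by exact: tpoly_node.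
have -> : N2 0 h (level m) (tpoly h (part_s s m) (part_a a m)) =
    N2 0 h (level m) (target (tpoly T s a) f m).
  apply: N2_eq => t _ lt; rewrite tpoly_parts -/f.
  by rewrite (target_synth (fun n j => fp n j t) lt).
move=> H; have {H} := le_trans H (N2_target mN (cmeas_tpoly T s a) mf).
have -> : (\sum_(m.+1 <= n < N) N2 0 h xpredT (f n))%E = (\sum_(m.+1 <= n < N) h * x n)%:E.
  rewrite -sumEFin; apply: eq_bigr => n _; rewrite -(parseval 0)//; last exact: part_uniq.
  by apply: wint_eq => t _; rewrite mul1r.
rewrite -(fineK Ffin) -EFinD -EFinM lee_fin -/X -mulr_sumr -ler_pdivlMl// mulrA => H.
apply: le_trans H _; set Q := \sum_(m.+1 <= n < N) x n.
have Q0 : 0 <= Q by apply: sumr_ge0 => n _; exact: x0.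
apply: (@le_trans _ _ (Cst / c m * (1 + h) * (X + Q))); last first.
  by rewrite ler_wpM2r ?addr_ge0// cD.
rewrite [_^-1 * _]mulrC -mulrA ler_wpM2l ?divr_ge0 ?Cst_ge0 ?(ltW cm)//.
have : 0 <= h * X by rewrite mulr_ge0// ltW.
nra.
Qed.

(** Once the modes above m are fixed, the target of index m is fixed on [level m] and can be
    approximated there with the frequencies [L m]; later choices do not disturb it. *)
Lemma assembled_total : totalL2 0 T A assembled.
Proof.
move=> g mg gfin eps eps0.
(* A factor N^2 is lost in [synth_error] and a factor N to the number of levels. *)
pose e := eps / (N%:R * N%:R * N%:R).
have N3 : 0 < N%:R * N%:R * N%:R :> R by rewrite !mulr_gt0// ltr0n.
have e0 : 0 < e by rewrite divr_gt0.
have step i : (i <= N)%N -> exists f : nat -> R -> C, (forall m, combo h (L m) (f m)) /\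
    forall m, (N - i <= m < N)%N ->
      (N2 0 h (level m) (fun t => target g f m t - f m t)%R <= e%:E)%E.
  elim: i => [|i IH] iN.
    exists (fun=> fun=> 0); split=> [m|m]; first exact: combo0.
    by rewrite subn0 => /andP[h1 h2]; move: (leq_ltn_trans h1 h2); rewrite ltnn.
  have [f [cf Hf]] := IH (ltnW iN).
  set k := (N - i.+1)%N.
  have kN : (k < N)%N by rewrite ltn_subrL/= (leq_trans _ iN).
  have kS : (N - i)%N = k.+1 by rewrite /k subnSK.
  have mf n : cmeas (f n) := cmeas_combo (cf n).
  have mt := cmeas_target k mg mf.
  have tfin : (N2 0 h (level k) (target g f k) < +oo)%E.
    apply: le_lt_trans (N2_target kN mg mf) _; rewrite lte_mul_pinfty ?lee_fin ?Cst_ge0//.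
    rewrite lte_add_pinfty// lte_sum_pinfty// => n _.
    have [s [a [us _ ->]]] := cf n.
    apply: (@le_lt_trans _ _ (h * \sum_(z <- s) sqabs (a z))%:E); last exact: ltry.
    exact: N2_tpoly_fin.
  have [s [a [us La Hs]]] := L_total kN mt tfin e0.
  pose f' n := if n == k then tpoly h s a else f n.
  have ff' n t : (k < n)%N -> f' n t = f n t.
    by move=> kn; rewrite /f' ifF//; apply/negbTE; rewrite neq_ltn kn orbT.
  (* These targets involve only modes of index above m >= k, which the new choice of mode k leaves
     alone. *)
  have tt' m t : (k <= m)%N -> level m t -> target g f' m t = target g f m t.
    move=> km lt; rewrite /target; congr (_ * _); apply: eq_bigr => j _.
    congr (_ * (_ - _)); apply: eq_bigr => n nJ; rewrite ff'//.
    exact: leq_ltn_trans km (leq_trans lt nJ).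
  exists f'; split=> [n|n]; first by rewrite /f'; case: eqP => // ->; exists s, a.
  move=> /andP[kn nN]; rewrite (N2_eq (g := fun t => target g f n t - f' n t)); last first.
    by move=> t _ lt; rewrite tt'.
  have [->|nk] := eqVneq n k; first by rewrite /f' eqxx.
  have kn' : (k < n)%N by rewrite ltn_neqAle eq_sym nk.
  rewrite (N2_eq (g := fun t => target g f n t - f n t)); last by move=> t _ _; rewrite ff'.
  by apply: Hf; rewrite kS kn'.
have [f [cf Hf]] := step N (leqnn N).
have fp n t (j : 'I_N) : f n (t + (j : nat)%:R * h) = f n t.
  by have [s [a [_ _ ->]]] := cf n; exact: tpoly_node.
have cS : combo T assembled (synth f).
  rewrite /synth; have E : (fun t => \sum_(n < N) ch T n%:Z t * f n t) =
     (fun t => \sum_(n <- index_enum 'I_N) ch T (n : nat)%:Z t * f n t) by [].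
  by rewrite E; apply: combo_sum => n; exact: combo_enc.
have mS := cmeas_combo cS; have mf n : cmeas (f n) := cmeas_combo (cf n).
have HS : (N2 0 T A (fun t => g t - synth f t)%R <= eps%:E)%E.
  rewrite N2_fold; last exact: cmeasB.
  have nn m : nnmeas (fun t => (level m t)%:R * sqabs (target g f m t - f m t)).
    by apply: nnmeas_N2; [exact: measurable_level|apply: cmeasB => //; exact: cmeas_target].
  apply: (@le_trans _ _ (wint 0 h (fun t => N%:R * N%:R *
      \sum_(m < N) (level m t)%:R * sqabs (target g f m t - f m t)))).
    apply: wint_le => [||t _]; last exact: synth_error.
      exact: (nnmeas_fold (cmeasB mg mS)).
    by apply: nnmeasM; [exact: nnmeas_cst|exact: nnmeas_sum].
  rewrite wintZ//; last exact: nnmeas_sum.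
  rewrite wint_sum//.
  apply: (@le_trans _ _ ((N%:R * N%:R)%:E * \sum_(m < N) e%:E)%E).
    by rewrite lee_wpmul2l// ?lee_fin ?mulr_ge0//; apply: lee_sum => m _; apply: Hf; rewrite subnn ltn_ord.
  rewrite sumEFin sumr_const card_ord -EFinM lee_fin.
  have -> : N%:R * N%:R * (e *+ N) = eps by rewrite -mulr_natl /e; field; rewrite Nr.
  exact: lexx.
by have [s [a [us La E]]] := cS; exists s, a; split=> //; rewrite -E.
Qed.

End Assemble.

Theorem good_combine : (forall m, (m < N)%N -> good h (level m)) -> good T A.
Proof.
move=> H.
have /choice[L HL] : forall m, exists L : set int, (m < N)%N ->
    [/\ (exists2 x, 0 <= x < h & level m x) -> infinite_set L,
     lowerL2 0 h (level m) L & totalL2 0 h (level m) L].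
  move=> m; have [mN|mN] := ltnP m N; last by exists set0.
  by have [L HL] := H m mN; exists L.
exists (assembled L); split.
- move=> [x /andP[x0 xT] Ax].
  pose j := Num.truncn (x / h).
  have xh : 0 <= x / h by rewrite divr_ge0// ltW.
  have /andP[j1 j2] := truncn_itv xh.
  have jN : (j < N)%N.
    by rewrite -(ltr_nat R) (le_lt_trans j1)// ltr_pdivrMr.
  (* A point of [A] lies over a point of [level 0], so the residue class of 0 alone already
     contributes infinitely many frequencies. *)
  have [inf _ _] := HL 0%N N0.
  apply: (@sub_infinite_set _ (enc N 0 @` L 0%N)); last first.
    apply: infinite_inj_image; first by move=> p q /(congr1 (qd N)); rewrite !qd_enc.
    apply: inf; exists (x - j%:R * h).
      rewrite subr_ge0 -ler_pdivlMr// j1/= ltrBlDr -[X in X + _]mul1r -mulrDl.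
      by rewrite -ltr_pdivrMr// addrC natr1.
    by rewrite /level card_gt0; apply/set0Pn; exists (Ordinal jN); rewrite inE /= subrK.
  by move=> _ [q Lq <-]; rewrite /assembled /= rd_enc// qd_enc.
- by apply: assembled_lower => m mN; have [] := HL m mN.
- by apply: assembled_total => m mN; have [] := HL m mN.
Qed.

End Combining.

(** * Periodic step functions and their superlevel sets *)

Section StepFunctions.
Variable R : realType.
Implicit Types (l : seq (R * int)) (h T u t : R) (c n v : int).

Definition floorR (x : R) : int := Num.floor x.

Lemma floorRDz (x : R) (z : int) : floorR (x + z%:~R) = floorR x + z.
Proof. by rewrite /floorR floorDrz// intrKfloor. Qed.

Lemma floorR_eq (x : R) (z : int) : z%:~R <= x < z%:~R + 1 -> floorR x = z.
Proof. by move=> H; apply/eqP; rewrite /floorR floor_eq intrD. Qed.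

Lemma hermite_identity (N : nat) (u : R) : (0 < N)%N ->
  \sum_(j < N) floorR ((u + (j : nat)%:R) / N%:R) = floorR u.
Proof.
move=> N0; have Nr : 0 < N%:R :> R by rewrite ltr0n.
have base (v : R) : 0 <= v < 1 -> \sum_(j < N) floorR ((v + (j : nat)%:R) / N%:R) = 0.
  move=> /andP[v0 v1]; apply: big1 => j _; apply: floorR_eq.
  rewrite divr_ge0 ?addr_ge0//= add0r ltr_pdivrMr// mul1r.
  apply: (@lt_le_trans _ _ (1 + (j : nat)%:R)); first by rewrite ltrD2r.
  by rewrite nat1r ler_nat.
(* Adding 1 to v shifts the sum by one index: the term j = 0 is exchanged for j = N, where the floor
   is larger by 1. *)
have step (v : R) : \sum_(j < N) floorR ((v + 1 + (j : nat)%:R) / N%:R) =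
    \sum_(j < N) floorR ((v + (j : nat)%:R) / N%:R) + 1.
  pose F (j : nat) := floorR ((v + j%:R) / N%:R).
  have -> : \sum_(j < N) floorR ((v + 1 + (j : nat)%:R) / N%:R) = \sum_(j < N) F j.+1.
    by apply: eq_bigr => j _; rewrite /F -nat1r addrA.
  have e : \sum_(j < N) F j + F N = F 0%N + \sum_(j < N) F j.+1.
    by rewrite -(big_ord_recr N (fun j : 'I_N.+1 => F j)) big_ord_recl.
  have FN : F N = F 0%N + 1.
    rewrite /F addr0 mulrDl divff ?gt_eqF// -[X in _ + X]/(1%:~R) floorRDz//.
  by apply: (addrI (F 0%N)); rewrite -e FN addrA addrCA addrA.
have stepz (z : int) (v : R) : \sum_(j < N) floorR ((v + z%:~R + (j : nat)%:R) / N%:R) =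
    \sum_(j < N) floorR ((v + (j : nat)%:R) / N%:R) + z.
  have stepn (n : nat) (y : R) : \sum_(j < N) floorR ((y + n%:R + (j : nat)%:R) / N%:R) =
      \sum_(j < N) floorR ((y + (j : nat)%:R) / N%:R) + n%:Z.
    elim: n => [|n IH]; first by under eq_bigr do rewrite addr0; rewrite addr0.
    by under eq_bigr do rewrite -natr1 addrA; rewrite step IH -addrA; congr (_ + _); rewrite addrC -intS.
  case: z => n; first exact: stepn.
  have := stepn n.+1 (v + (Negz n)%:~R); rewrite NegzE mulrNz -pmulrn.
  under eq_bigr do rewrite subrK.
  by move=> ->; rewrite addrK.
have /andP[h1 h2] := floor_itvP u.
rewrite -[u in LHS](subrK (Num.floor u)%:~R) stepz base ?add0r//.
by rewrite subr_ge0 h1/= ltrBlDl.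
Qed.

(* The pair (x, s) in l encodes a jump by s at x + T Z; balanced means that the jumps over a
   period cancel, which makes step T c l periodic. *)
Definition jump_sum T l t : int := \sum_(p <- l) p.2 * floorR ((t - p.1) / T).
Definition step T (c : int) l t : int := c + jump_sum T l t.

Definition signed l := all (fun p : R * int => (p.2 == 1) || (p.2 == -1)) l.
Definition balanced l := \sum_(p <- l) p.2 = 0.

Lemma step_period T c l t : 0 < T -> balanced l -> step T c l (t + T) = step T c l t.
Proof.
move=> T0 bl; rewrite /step /jump_sum; congr (_ + _).
transitivity (\sum_(p <- l) (p.2 * floorR ((t - p.1) / T) + p.2)); last first.
  by rewrite big_split/= bl addr0.
apply: eq_bigr => p _.
rewrite (_ : (t + T - p.1) / T = (t - p.1) / T + 1%:~R).
  by rewrite floorRDz mulrDr mulr1.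
by rewrite addrAC mulrDl divff// gt_eqF.
Qed.

(** Hermite's identity, jump by jump: a jump repeated with period N h folds to one jump repeated
    with period h, so the list [l] is unchanged. *)
Lemma step_fold (N : nat) h c l t : (0 < N)%N -> 0 < h ->
  \sum_(j < N) step (N%:R * h) c l (t + (j : nat)%:R * h) = step h (N%:Z * c) l t.
Proof.
move=> N0 h0; rewrite /step big_split/= sumr_const card_ord; congr (_ + _); first by rewrite -mulr_natl natz.
rewrite /jump_sum exchange_big/=; apply: eq_bigr => p _.
rewrite -mulr_sumr -(hermite_identity _ N0); congr (_ * _); apply: eq_bigr => j _.
congr floorR; field; rewrite pnatr_eq0 -lt0n N0 gt_eqF//.
Qed.

Lemma measurable_step T c l (z : int) : measurable_fun setT (fun t => step T c l t == z).
Proof.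
have -> : (fun t => step T c l t == z) =
    (fun t => c%:~R + \sum_(p <- l) p.2%:~R * (floorR ((t - p.1) / T))%:~R == z%:~R :> R).
  apply/funext => t; rewrite -(eqr_int R) /step /jump_sum intrD rmorph_sum /=.
  by congr (_ + _ == _); apply: eq_bigr => p _; rewrite intrM.
apply: measurable_fun_eqr; last exact: measurable_cst.
apply: measurable_funD; first exact: measurable_cst.
apply: measurable_sum => p; apply: measurable_funM; first exact: measurable_cst.
apply: (measurableT_comp (@measurable_floor R)).
apply: measurable_funM; last exact: measurable_cst.
exact: (@measurable_shift R (- p.1)).
Qed.

(** * Threshold crossings of a sorted list of jumps *)

Definition above n v : int := if n <= v then 1 else 0.

(** [v] is the running value before the first jump of the list; the jumps kept are those at which
    the running value passes the threshold [n]. *)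
Fixpoint crossings (n v : int) l : seq (R * int) :=
  if l is p :: l' then
    if (n <= v + p.2) == (n <= v) then crossings n (v + p.2) l'
    else p :: crossings n (v + p.2) l'
  else [::].

(** For jumps of size 1 this forces the signs to alternate; alternation is used only in this
    form. *)
Fixpoint all_cross (n v : int) l : bool :=
  if l is p :: l' then ((n <= v + p.2) != (n <= v)) && all_cross n (v + p.2) l'
  else true.

Lemma crossings_size n v l : (size (crossings n v l) <= size l)%N.
Proof.
elim: l v => //= p l IH v; case: ifP => _ /=; last exact: IH.
exact: leq_trans (IH _) _.
Qed.

Lemma crossings_all_cross n v l : ~~ all_cross n v l ->
  (size (crossings n v l) < size l)%N.
Proof.
elim: l v => //= p l IH v; rewrite negb_and negbK => /orP[->|/IH].
  by rewrite ltnS crossings_size.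
by case: ifP => _ H; rewrite /= ?ltnS// ltnW// ltnS; exact: H.
Qed.

Lemma crossings_signed n v l : signed l -> signed (crossings n v l).
Proof.
elim: l v => //= p l IH v /andP[sp sl]; case: ifP => _ /=; first exact: IH.
by rewrite sp IH.
Qed.

Lemma crossing_sign n v (s : int) : (s == 1) || (s == -1) -> (n <= v + s) != (n <= v) ->
  above n (v + s) - above n v = s.
Proof.
by rewrite /above => /orP[]/eqP ->; case: (lerP n (v + _)); case: (lerP n v) => //=; lia.
Qed.

Lemma crossings_subseq n v l : subseq (crossings n v l) l.
Proof.
elim: l v => //= p l IH v.
by case: ifP => _; [exact: subseq_trans (IH _) (subseq_cons _ _)|rewrite eqxx].
Qed.

(** A crossing of size 1 changes the indicator by exactly its own sign, so the kept jumps keep their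
    weights. Sortedness makes the jumps with p.1 <= u an initial run of the list. *)
Lemma crossings_sum n v l (u : R) : signed l -> sorted <=%R (map fst l) ->
  above n (v + \sum_(p <- l | p.1 <= u) p.2) =
  above n v + \sum_(p <- crossings n v l | p.1 <= u) p.2.
Proof.
elim: l v => [|p l IH] v /=; first by rewrite !big_nil !addr0.
move=> /andP[sp sl] pl; have sl' := path_sorted pl.
have [pu|up] := leP p.1 u.
  rewrite big_cons pu addrA IH//; case: eqP => [e|/eqP ne]; first by rewrite /above e.
  rewrite big_cons pu addrA; congr (_ + _).
  by have /eqP := crossing_sign sp ne; rewrite subr_eq [p.2 + _]addrC => /eqP.
have big0 (P : seq (R * int)) : subseq P (p :: l) -> \sum_(q <- P | q.1 <= u) q.2 = 0 :> int.
  move=> sub; rewrite big_seq_cond big1// => q /andP[qP].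
  have : q \in p :: l by exact: mem_subseq sub _ qP.
  rewrite inE => /orP[/eqP ->|ql]; first by rewrite leNgt up.
  have /allP/(_ q.1) : all (>= p.1) (map fst l).
    by apply: order_path_min pl; exact: le_trans.
  by rewrite map_f// => /(_ isT) pq qu; move: (le_lt_trans (le_trans pq qu) up); rewrite ltxx.
rewrite -[if _ then _ else _]/(crossings n v (p :: l)).
by rewrite (big0 _ (crossings_subseq n v _)) (big0 _ (subseq_refl _)) !addr0.
Qed.

Lemma crossings_balanced n v l : signed l -> sorted <=%R (map fst l) -> balanced l ->
  balanced (crossings n v l).
Proof.
move=> sl ol bl; have [u Hu] : exists u : R, forall p, p \in l -> p.1 <= u.
  elim: l {sl ol bl} => [|p l [u IH]]; first by exists 0.
  exists (Num.max p.1 u) => q; rewrite inE le_max => /orP[/eqP ->|/IH ->]; first by rewrite lexx.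
  by rewrite orbT.
have all_sum (l' : seq (R * int)) : {subset l' <= l} ->
    \sum_(p <- l' | p.1 <= u) p.2 = \sum_(p <- l') p.2.
  move=> sub; rewrite big_seq_cond [RHS]big_seq; apply: eq_bigl => p.
  by case: (boolP (p \in l')) => //= /sub /Hu ->.
have := crossings_sum n v u sl ol; rewrite !all_sum//; last exact: mem_subseq (crossings_subseq n v l).
by rewrite bl addr0 => /esym/eqP; rewrite -subr_eq0 addrAC subrr add0r => /eqP.
Qed.

(** The jumps lie on the circle R / Z, which is cut at [al]. The cut stays a parameter because
    [bathtub] needs it at the end of an arc that depends on the list. *)
Definition normalize (al : R) (p : R * int) : R * int := (p.1 - (floorR (p.1 - al))%:~R, p.2).
Definition lefst (p q : R * int) := p.1 <= q.1.
Definition arranged (al : R) l : seq (R * int) := sort lefst (map (normalize al) l).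

Lemma arranged_perm al l : perm_eq (arranged al l) (map (normalize al) l).
Proof. exact/permPl/perm_sort. Qed.

Lemma arranged_size al l : size (arranged al l) = size l.
Proof. by rewrite (perm_size (arranged_perm al l)) size_map. Qed.

Lemma arranged_signed al l : signed l -> signed (arranged al l).
Proof. by rewrite /signed (perm_all _ (arranged_perm al l)) all_map. Qed.

Lemma arranged_balanced al l : balanced l -> balanced (arranged al l).
Proof. by rewrite /balanced (perm_big _ (arranged_perm al l)) /= big_map. Qed.

Lemma arranged_sorted al l : sorted <=%R (map fst (arranged al l)).
Proof.
rewrite sorted_map; apply: (sort_sorted (leT := lefst)) => p q.
exact: le_total.
Qed.

Lemma arranged_window al l p : p \in arranged al l -> al <= p.1 < al + 1.
Proof.
rewrite (perm_mem (arranged_perm al l)) => /mapP[q _ ->] /=.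
have /andP[h1 h2] := floor_itvP (q.1 - al); rewrite /floorR.
by apply/andP; split; lra.
Qed.

Definition offset_sum (al : R) l : int := \sum_(p <- l) p.2 * floorR (p.1 - al).

Lemma jump_sum_arranged al l u : jump_sum 1 l u = jump_sum 1 (arranged al l) u - offset_sum al l.
Proof.
rewrite /jump_sum (perm_big _ (arranged_perm al l)) /= big_map /offset_sum -sumrB.
apply: eq_bigr => p _; rewrite -mulrBr; congr (_ * _); rewrite /= !divr1.
rewrite (_ : u - (p.1 - (floorR (p.1 - al))%:~R) = u - p.1 + (floorR (p.1 - al))%:~R).
  by rewrite floorRDz addrK.
by ring.
Qed.

(** Within the window every floor is 0 or -1, and in a balanced list all floors may be raised by 1
    without changing the sum. *)
Lemma jump_sum_window al l u : balanced l -> (forall p, p \in l -> al <= p.1 < al + 1) ->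
  al <= u < al + 1 -> jump_sum 1 l u = \sum_(p <- l | p.1 <= u) p.2.
Proof.
move=> bl wl /andP[u0 u1]; rewrite /jump_sum.
transitivity (\sum_(p <- l) ((if p.1 <= u then p.2 else 0) - p.2)); last first.
  by rewrite sumrB bl subr0 -big_mkcond.
rewrite big_seq [RHS]big_seq; apply: eq_bigr => p /wl /andP[p0 p1]; rewrite divr1.
case: (leP p.1 u) => pu.
  by rewrite subrr (_ : floorR _ = 0) ?mulr0//; apply: floorR_eq; lra.
by rewrite sub0r (_ : floorR _ = -1) ?mulrN1//; apply: floorR_eq; rewrite rmorphN1; lra.
Qed.

(** The value just left of the cut, before any jump of the window is counted. *)
Definition level_start (al : R) c l : int := c - offset_sum al l.
Definition level_list (al : R) c n l := crossings n (level_start al c l) (arranged al l).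

Lemma step1_period (c : int) l (u : R) (z : int) : balanced l ->
  step 1 c l (u + z%:~R) = step 1 c l u.
Proof.
move=> bl; rewrite /step /jump_sum; congr (_ + _).
transitivity (\sum_(p <- l) (p.2 * floorR ((u - p.1) / 1) + p.2 * z)); last first.
  by rewrite big_split/= -mulr_suml bl mul0r addr0.
apply: eq_bigr => p _; rewrite -mulrDr !divr1; congr (_ * _).
by rewrite addrAC floorRDz.
Qed.

Lemma level_list_step (al : R) c n l u : signed l -> balanced l ->
  above n (step 1 c l u) = step 1 (above n (level_start al c l)) (level_list al c n l) u.
Proof.
move=> sl bl; have sa := arranged_signed al sl; have ba := arranged_balanced al bl.
have oa := arranged_sorted al l.
have bc : balanced (level_list al c n l) by exact: crossings_balanced.
set z := floorR (u - al).
have /andP[h1 h2] := floor_itvP (u - al); rewrite -/(floorR _) -/z in h1 h2.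
have -> : u = (u - z%:~R) + z%:~R by rewrite subrK.
rewrite !step1_period//; set v := u - z%:~R.
have vw : al <= v < al + 1 by rewrite /v; apply/andP; split; lra.
rewrite /step (jump_sum_arranged al) (jump_sum_window (al := al))//; last first.
  by move=> p /arranged_window.
rewrite (jump_sum_window (al := al))//; last first.
  by move=> p /(mem_subseq (crossings_subseq _ _ _)) /arranged_window.
by rewrite -crossings_sum// /level_start; congr above; lia.
Qed.

Lemma step_scale T c l t : 0 < T ->
  step T c l t = step 1 c (map (fun p => (p.1 / T, p.2)) l) (t / T).
Proof.
move=> T0; rewrite /step /jump_sum big_map; congr (_ + _); apply: eq_bigr => p _ /=.
by rewrite divr1 mulrBl.
Qed.

Lemma step_unscale T c l t : 0 < T ->
  step T c (map (fun p => (p.1 * T, p.2)) l) t = step 1 c l (t / T).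
Proof.
move=> T0; rewrite step_scale// -map_comp; congr (step 1 c _ _).
rewrite -[RHS]map_id; apply: eq_map => -[x s] /=; by rewrite mulfK// gt_eqF.
Qed.

Definition scaled (T : R) l := map (fun p : R * int => (p.1 / T, p.2)) l.

(** The strict inequality drives the induction on the number of jumps: one cut [al] at which some
    jump misses the threshold is enough for it. *)
Lemma superlevel_step (al : R) T c n l : 0 < T -> signed l -> balanced l ->
  exists c' l', [/\ signed l', balanced l',
    (size l' <= size l)%N,
    ~~ all_cross n (level_start al c (scaled T l)) (arranged al (scaled T l)) ->
       (size l' < size l)%N &
    forall t, above n (step T c l t) = step T c' l' t].
Proof.
move=> T0 sl bl.
have ss : signed (scaled T l) by rewrite /signed all_map.
have bs : balanced (scaled T l) by rewrite /balanced big_map.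
pose l1 := level_list al c n (scaled T l).
exists (above n (level_start al c (scaled T l))), (map (fun p => (p.1 * T, p.2)) l1).
have sz : size (scaled T l) = size l by rewrite size_map.
split.
- by rewrite /signed all_map; exact: crossings_signed (arranged_signed _ ss).
- rewrite /balanced big_map; apply: crossings_balanced; first exact: arranged_signed.
    exact: arranged_sorted.
  exact: arranged_balanced.
- by rewrite size_map (leq_trans (crossings_size _ _ _))// arranged_size sz.
- by move=> na; rewrite size_map (leq_trans (crossings_all_cross na))// arranged_size sz.
- by move=> t; rewrite step_unscale// step_scale// (level_list_step al).
Qed.

End StepFunctions.

(** * Signed exponential sums *)

Section SignedExponentialSums.
Variable R : realType.
Implicit Types (l : seq (R * int)) (h T u t x phi : R) (n v : int).

Lemma sin_mean (x y : R) : x <= y ->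
  exists2 c, x <= c <= y & sin y - sin x = cos c * (y - x).
Proof.
move=> xy; have [|c cI ->] := @MVT_segment R sin cos x y xy.
  by apply: continuous_subspaceT => z; exact: continuous_sin.
by exists c => //; move: cI; rewrite in_itv.
Qed.

(* Abel summation of the increments of f over the set where the running value is 1. *)
Lemma chain_bound (f H : R -> R) n v l x b : signed l -> all_cross n v l ->
  path <=%R x (map fst l) -> x <= b -> (forall p, p \in l -> p.1 <= b) ->
  (forall s t, x <= s -> s <= t -> t <= b -> 0 <= H t - H s /\ f t - f s <= H t - H s) ->
  ((above n v)%:~R + \sum_(p <- l) p.2%:~R) * f b - (above n v)%:~R * f x -
    \sum_(p <- l) p.2%:~R * f p.1 <= H b - H x.
Proof.
move=> sl al pl xb lb mono.
have inc m s t : x <= s -> s <= t -> t <= b ->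
    (above n m)%:~R * (f t - f s) <= H t - H s.
  move=> xs st tb; have [H0 fH] := mono s t xs st tb.
  by rewrite /above; case: ifP => _; rewrite ?mul1r ?mul0r.
elim: l v x xb lb pl sl al inc {mono} => [|p l IH] v x xb lb /=.
  move=> _ _ _ inc; rewrite !big_nil addr0 subr0 -mulrBr; exact: inc.
move=> /andP[xp pl] /andP[sp sl] /andP[cr al] inc.
have pb : p.1 <= b by rewrite lb// mem_head.
have lb' q : q \in l -> q.1 <= b by move=> ql; rewrite lb// inE ql orbT.
have inc' m s t : p.1 <= s -> s <= t -> t <= b -> (above n m)%:~R * (f t - f s) <= H t - H s.
  by move=> ps; apply: inc; exact: le_trans xp ps.
have := IH (v + p.2) p.1 pb lb' pl sl al inc'.
have := inc v x p.1 (lexx _) xp pb.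
have -> : above n (v + p.2) = above n v + p.2 by have := crossing_sign sp cr; lia.
rewrite !big_cons intrD.
set S1 := \sum_(_ <- l) _; set S2 := \sum_(_ <- l) _.
set w := (above n v)%:~R; set s := p.2%:~R.
set a := f p.1; set a0 := f x; set a1 := f b.
by nra.
Qed.

Definition moment l : R := \sum_(p <- l) p.2%:~R * p.1.
Definition cos_sum l : R := \sum_(p <- l) p.2%:~R * cos (2 * pi * p.1).
Definition sin_sum l : R := \sum_(p <- l) p.2%:~R * sin (2 * pi * p.1).
Definition sin_sum_at phi l : R := \sum_(p <- l) p.2%:~R * sin (2 * pi * (p.1 - phi)).

Lemma arranged_chain (f H : R -> R) n v l al : signed l -> balanced l ->
  all_cross n v (arranged al l) ->
  (forall s t, al <= s -> s <= t -> t <= al + 1 -> 0 <= H t - H s /\ f t - f s <= H t - H s) ->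
  (above n v)%:~R * (f (al + 1) - f al) - \sum_(p <- arranged al l) p.2%:~R * f p.1 <=
    H (al + 1) - H al.
Proof.
move=> sl bl av mono.
have := @chain_bound f H n v (arranged al l) al (al + 1) (arranged_signed al sl) av.
rewrite -rmorph_sum (arranged_balanced al bl) addr0 -mulrBr; apply => //.
- have := arranged_sorted al l; have := @arranged_window R al l.
  by case: (arranged al l) => //= p k /(_ p (mem_head _ _))/andP[-> _].
- by rewrite lerDl.
- by move=> p /arranged_window/andP[_ /ltW].
Qed.

Lemma moment_arranged al l : moment (arranged al l) = moment l - (offset_sum al l)%:~R.
Proof.
rewrite /moment (perm_big _ (arranged_perm al l)) /= big_map /offset_sum rmorph_sum -sumrB.
by apply: eq_bigr => p _; rewrite /= intrM -mulrBr.
Qed.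

Lemma cis_turn (x : R) (z : int) : cis (2 * pi * (x - z%:~R)) = cis (2 * pi * x).
Proof. by rewrite mulrBr -mulrN -mulrNz cisD cis_2pi_int mulr1. Qed.

Lemma sin_sum_at_arranged phi al l : sin_sum_at phi (arranged al l) = sin_sum_at phi l.
Proof.
rewrite /sin_sum_at (perm_big _ (arranged_perm al l)) /= big_map.
apply: eq_bigr => p _; rewrite /= addrAC; congr (_ * _).
by have [] := cis_turn (p.1 - phi) (floorR (p.1 - al)).
Qed.

(** Summed by parts, the number in the middle is the length of the superlevel set in the window. The
    bounds are the chain estimate for f = - t with H = 0, and for f = H = t. *)
Lemma all_cross_span n v l al : signed l -> balanced l -> all_cross n v (arranged al l) ->
  0 <= (above n v)%:~R - moment (arranged al l) <= 1.
Proof.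
move=> sl bl av; apply/andP; split.
  have := @arranged_chain (fun t => - t) (fun=> 0) n v l al sl bl av.
  under eq_bigr do rewrite mulrN; rewrite sumrN -/(moment _).
  have mono : forall s t : R, al <= s -> s <= t -> t <= al + 1 -> 0 <= 0 - 0 :> R /\ - t - - s <= 0 - 0.
    by move=> s t _ st _; split; lra.
  move=> /(_ mono); lra.
have := @arranged_chain (fun t => t) (fun t => t) n v l al sl bl av.
have mono : forall s t : R, al <= s -> s <= t -> t <= al + 1 -> 0 <= t - s /\ t - s <= t - s.
  by move=> s t _ st _; split; lra.
move=> /(_ mono); rewrite -/(moment _); lra.
Qed.

Lemma sin_two_pi (x y : R) : x <= y ->
  exists2 c, x <= c <= y & sin (2 * pi * y) - sin (2 * pi * x) = 2 * pi * cos (2 * pi * c) * (y - x).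
Proof.
move=> xy; have p0 := pi_gt0 R; have p2 : 0 < 2 * pi :> R by rewrite mulr_gt0.
have [|c /andP[c1 c2] e] := @sin_mean (2 * pi * x) (2 * pi * y); first by rewrite ler_pM2l.
exists (c / (2 * pi)); first by rewrite ler_pdivlMr// ler_pdivrMr// ![_ * (2 * pi)]mulrC c1.
rewrite e mulrCA divff ?gt_eqF// mulr1 -mulrBr; ring.
Qed.

Lemma cos_two_pi_le (x y : R) : 0 <= x -> x <= y -> y <= 1 - x -> cos (2 * pi * y) <= cos (2 * pi * x).
Proof.
have p0 := pi_gt0 R; have p2 : 0 < 2 * pi :> R by rewrite mulr_gt0.
have H (a b : R) : 0 <= a -> a <= b -> b <= 2^-1 -> cos (2 * pi * b) <= cos (2 * pi * a).
  move=> a0 ab b2; rewrite leNgt ltr_cos ?ltr_pM2l// -?leNgt// in_itv/=; apply/andP; split; nra.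
move=> x0 xy y1; have [y2|y2] := leP y 2^-1; first exact: H.
have -> : cos (2 * pi * y) = cos (2 * pi * (1 - y)).
  by rewrite -[RHS]cosN (_ : - _ = 2 * pi * (y - 1%:~R)); [have [-> _] := cis_turn y 1|ring].
by apply: H; lra.
Qed.

(* Among sets of length x in a period, an arc centred at phi maximizes the integral of
   2 pi cos (2 pi (t - phi)); starting the period at the left end of that arc lets the primitive
   be compared with a monotone H. *)
Lemma bathtub phi l : signed l -> balanced l ->
  (forall al, exists n v, all_cross n v (arranged al l)) ->
  - sin_sum_at phi l <= 2 * sin (pi * (- moment l - (floorR (- moment l))%:~R)).
Proof.
move=> sl bl alt; set x := - moment l - _.
have p0 := pi_gt0 R; have p2 : 0 < 2 * pi :> R by rewrite mulr_gt0.
have /andP[x0 x1] : 0 <= x < 1.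
  by have /andP[h1 h2] := floor_itvP (- moment l); rewrite /x /floorR; apply/andP; split; lra.
have F0 (al : R) : sin (2 * pi * (al + 1 - phi)) = sin (2 * pi * (al - phi)).
  by have [_] := cis_turn (al - phi + 1) 1; rewrite addrK => ->; rewrite addrAC.
have span al n v : all_cross n v (arranged al l) ->
    exists z : int, (above n v)%:~R - moment (arranged al l) = x + z%:~R.
  move=> _; exists (above n v + offset_sum al l + floorR (- moment l)).
  by rewrite moment_arranged /x !intrD; ring.
(* [lam] is a Lagrange multiplier for the length, which [span] determines up to an integer. *)
have main (lam : R) (H : R -> R) al n v : all_cross n v (arranged al l) ->
    (forall s t, al <= s -> s <= t -> t <= al + 1 -> 0 <= H t - H s /\
      sin (2 * pi * (t - phi)) - sin (2 * pi * (s - phi)) + lam * (t - s) <= H t - H s) ->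
    - sin_sum_at phi l + lam * ((above n v)%:~R - moment (arranged al l)) <= H (al + 1) - H al.
  move=> av mono.
  have := @arranged_chain (fun t => sin (2 * pi * (t - phi)) + lam * t) H n v l al sl bl av.
  rewrite F0 -(sin_sum_at_arranged _ al) /sin_sum_at /moment.
  under eq_bigr do rewrite mulrDr mulrCA.
  rewrite big_split/= -mulr_sumr.
  have mono' : forall s t, al <= s -> s <= t -> t <= al + 1 -> 0 <= H t - H s /\
      sin (2 * pi * (t - phi)) + lam * t - (sin (2 * pi * (s - phi)) + lam * s) <= H t - H s.
    move=> s t h1 h2 h3; have [H1 H2] := mono s t h1 h2 h3; split=> //; lra.
  move=> /(_ mono'); lra.
(* Here the length is 0 or 1; the multiplier - 2 pi, respectively 2 pi, makes the primitive monotone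
   on the whole window. *)
have [xz|xz] := eqVneq x 0.
  have [n [v av]] := alt 0.
  have /andP[sp0 sp1] := all_cross_span sl bl av.
  have [z ez] := span _ _ _ av; rewrite xz add0r in ez.
  rewrite xz mulr0 sin0 mulr0.
  move: sp0 sp1; rewrite ez ler0z -[1]/(1%:~R) ler_int => z0 z1.
  have lip (s t : R) : s <= t -> `|sin (2 * pi * (t - phi)) - sin (2 * pi * (s - phi))| <= 2 * pi * (t - s).
    move=> st; have [|c _ ->] := @sin_two_pi (s - phi) (t - phi); first by lra.
    rewrite (_ : t - phi - (s - phi) = t - s); last by ring.
    rewrite !normrM (gtr0_norm p0) (ger0_norm (ler0n R 2)) (@ger0_norm _ (t - s)) ?subr_ge0//.
    by rewrite ler_wpM2r ?subr_ge0// ler_piMr ?(ltW p2)// cos_max.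
  have [e|e] : z = 0 \/ z = 1 by lia.
    have := main (- (2 * pi)) (fun=> 0) 0 n v av.
    rewrite ez e mulr0 addr0 subrr; apply => s t _ st _; split=> //.
    by have := lip s t st; rewrite ler_norml => /andP[_]; lra.
  have := main (2 * pi) (fun t => sin (2 * pi * (t - phi)) + 2 * pi * t) 0 n v av.
  rewrite ez e mulr1 F0 => H0; lapply H0; [lra|].
  move=> s t _ st _; have := lip s t st; rewrite ler_norml => /andP[h1 h2]; split; lra.
have xp : 0 < x by rewrite lt_neqAle eq_sym xz.
pose al := phi - x / 2; have [n [v av]] := alt al.
have /andP[sp0 sp1] := all_cross_span sl bl av.
have [z ez] := span _ _ _ av.
have z0 : z = 0.
  suff : -1 < z < 1 by lia.
  rewrite -!(ltr_int R); apply/andP; split; rewrite ?mulrN1z; lra.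
rewrite z0 addr0 in ez.
(* With this multiplier the primitive [F] increases on the arc of length x centred at phi and
   decreases on the rest of the period; H is [F] stopped at the right end of the arc. *)
pose lam := - (2 * pi * cos (2 * pi * (x / 2))).
pose F t := sin (2 * pi * (t - phi)) + lam * t.
have Fup s t : al <= s -> s <= t -> t <= phi + x / 2 -> F s <= F t.
  move=> h1 h2 h3; rewrite -subr_ge0 /F.
  have [|c /andP[c1 c2] e] := @sin_two_pi (s - phi) (t - phi); first by lra.
  have -> : sin (2 * pi * (t - phi)) + lam * t - (sin (2 * pi * (s - phi)) + lam * s) =
     (2 * pi) * (cos (2 * pi * c) - cos (2 * pi * (x / 2))) * (t - s) by rewrite /lam; nra.
  rewrite mulr_ge0 ?subr_ge0// mulr_ge0 ?(ltW p2)// subr_ge0.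
  have -> : cos (2 * pi * c) = cos (2 * pi * `|c|).
    by rewrite -cos_norm !normrM (gtr0_norm p0) (ger0_norm (ler0n R 2)).
  have : `|c| <= x / 2 by rewrite ler_norml; move: h1; rewrite /al => h1; apply/andP; split; lra.
  by move=> cx; apply: cos_two_pi_le => //; lra.
have Fdn s t : phi + x / 2 <= s -> s <= t -> t <= al + 1 -> F t <= F s.
  move=> h1 h2 h3; rewrite -subr_ge0 /F.
  have [|c /andP[c1 c2] e] := @sin_two_pi (s - phi) (t - phi); first by lra.
  have -> : sin (2 * pi * (s - phi)) + lam * s - (sin (2 * pi * (t - phi)) + lam * t) =
     (2 * pi) * (cos (2 * pi * (x / 2)) - cos (2 * pi * c)) * (t - s) by rewrite /lam; nra.
  rewrite mulr_ge0 ?subr_ge0// mulr_ge0 ?(ltW p2)// subr_ge0.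
  by apply: cos_two_pi_le; move: h3; rewrite /al; lra.
have := main lam (fun t => F (Num.min t (phi + x / 2))) al n v av.
have -> : Num.min (al + 1) (phi + x / 2) = phi + x / 2 by apply/min_idPr; rewrite /al; lra.
have -> : Num.min al (phi + x / 2) = al by apply/min_idPl; rewrite /al; lra.
rewrite ez /F (_ : phi + x / 2 - phi = x / 2); last by ring.
rewrite /al (_ : phi - x / 2 - phi = - (x / 2)); last by ring.
rewrite mulrN sinN (_ : 2 * pi * (x / 2) = pi * x); last by field.
move=> H0; lapply H0; [lra|]; clear H0.
move=> s t h1 h2 h3; rewrite -/(F _).
have ef : sin (2 * pi * (t - phi)) - sin (2 * pi * (s - phi)) + lam * (t - s) = F t - F s.
  by rewrite /F; ring.
rewrite ef; have [sb|sb] := leP s (phi + x / 2); have [tb|tb] := leP t (phi + x / 2).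
- by rewrite subr_ge0 Fup.
- by rewrite subr_ge0 Fup// lerD2r Fdn// ltW.
- by move: (lt_le_trans sb (le_trans h2 tb)); rewrite ltxx.
- by rewrite subrr subr_le0 Fdn// ltW.
Qed.

Lemma polar_angle (a b : R) : exists psi, a = Num.sqrt (a ^+ 2 + b ^+ 2) * cos psi /\
  b = Num.sqrt (a ^+ 2 + b ^+ 2) * sin psi.
Proof.
have ge0 : 0 <= a ^+ 2 + b ^+ 2 by rewrite addr_ge0 ?sqr_ge0.
set r := Num.sqrt _; have r2 : r ^+ 2 = a ^+ 2 + b ^+ 2 by rewrite sqr_sqrtr.
have [r0|rn] := eqVneq r 0.
  move: r2; rewrite r0 expr0n/= => /esym/eqP; rewrite paddr_eq0 ?sqr_ge0// !sqrf_eq0.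
  by move=> /andP[/eqP -> /eqP ->]; exists 0; rewrite !mul0r.
have rp : 0 < r by rewrite lt_neqAle eq_sym rn sqrtr_ge0.
have ar : -1 <= a / r <= 1.
  rewrite -ler_norml -(@expr_le1 _ 2)// -normrX ger0_norm ?sqr_ge0// expr_div_n.
  by rewrite ler_pdivrMr ?exprn_gt0// mul1r r2 lerDl sqr_ge0.
have sa : r * sin (acos (a / r)) = `|b|.
  rewrite sin_acos// -{1}(gtr0_norm rp) -sqrtr_sqr -sqrtrM ?sqr_ge0//.
  by rewrite mulrBr mulr1 -exprMn mulrCA divff// mulr1 r2 addrAC subrr add0r sqrtr_sqr.
have ca : r * cos (acos (a / r)) = a by rewrite acosK ?in_itv//= mulrCA divff// mulr1.
have [b0|b0] := leP 0 b.
  by exists (acos (a / r)); rewrite ca sa ger0_norm.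
by exists (- acos (a / r)); rewrite cosN sinN ca mulrN sa ltr0_norm// opprK.
Qed.

(* Maximizing the estimate of bathtub over phi. *)
Lemma signed_sum_bound l : signed l -> balanced l ->
  (forall al, exists n v, all_cross n v (arranged al l)) ->
  cos_sum l ^+ 2 + sin_sum l ^+ 2 <= 2 - 2 * cos (2 * pi * moment l).
Proof.
move=> sl bl alt; have p0 := pi_gt0 R.
have [psi [e1 e2]] := polar_angle (- sin_sum l) (cos_sum l).
have ge0 : 0 <= (- sin_sum l) ^+ 2 + cos_sum l ^+ 2 by rewrite addr_ge0 ?sqr_ge0.
set r := Num.sqrt _ in e1 e2; have r2 : r ^+ 2 = (- sin_sum l) ^+ 2 + cos_sum l ^+ 2 by rewrite sqr_sqrtr.
have := bathtub (psi / (2 * pi)) sl bl alt.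
have -> : - sin_sum_at (psi / (2 * pi)) l = - sin_sum l * cos psi + cos_sum l * sin psi.
  rewrite mulNr [cos_sum _ * _]mulrC [sin_sum _ * _]mulrC /sin_sum_at /sin_sum /cos_sum !mulr_sumr.
  rewrite -!sumrN -big_split/=; apply: eq_bigr => p _.
  rewrite (_ : 2 * pi * (p.1 - psi / (2 * pi)) = 2 * pi * p.1 - psi); first by rewrite sinB; ring.
  by rewrite mulrBr [_ * (psi / _)]mulrC divfK// gt_eqF// mulr_gt0.
rewrite {1}e1 {1}e2 -(mulrA r) -(mulrA r) -mulrDr -!expr2 cos2Dsin2 mulr1.
set x := - moment l - _ => rx.
have -> : cos (2 * pi * moment l) = cos (2 * pi * x).
  rewrite -cosN -mulrN; by have [-> _] := cis_turn (- moment l) (floorR (- moment l)).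
have -> : 2 * pi * x = (pi * x) *+ 2 by rewrite mulr2n; ring.
rewrite cos_mulr2n cos2sin2.
have : r ^+ 2 <= (2 * sin (pi * x)) ^+ 2 by rewrite ler_pXn2r ?nnegrE ?sqrtr_ge0// (le_trans _ rx)// sqrtr_ge0.
rewrite r2 sqrrN exprMn !mulr2n; lra.
Qed.

(** * Averaging over dilations *)

Definition dilate (N : nat) l := [seq (N%:R * p.1, p.2) | p <- l].

(** The mean over N of cos (2 pi N d) is 1 for integral d and 0 otherwise: in the second case the
    sums are those of the Dirichlet kernel and telescope after multiplication by 2 sin (pi d). *)
Lemma cos_partial_sum (d : R) : (cos (2 * pi * d) = 1 /\
    forall M, \sum_(N < M) cos (2 * pi * ((N.+1)%:R * d)) = M%:R) \/
  exists K, forall M, `|\sum_(N < M) cos (2 * pi * ((N.+1)%:R * d))| <= K.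
Proof.
have [c1|c1] := eqVneq (cos (2 * pi * d)) 1; [left; split=> // M|right].
  rewrite -[M in RHS]card_ord -sum1_card natr_sum; apply: eq_bigr => N _.
  rewrite {1}(cos_2pi_eq1 c1) (_ : N.+1%:R * _ = (N.+1%:Z * Num.floor d)%:~R); last by rewrite intrM.
  by have [] := cis_2pi_int R (N.+1%:Z * Num.floor d).
have s0 : sin (pi * d) != 0.
  apply: contra c1 => /eqP s0; rewrite (_ : 2 * pi * d = (pi * d) *+ 2); last by ring.
  by rewrite cos_mulr2n cos2sin2 s0; apply/eqP; ring.
exists (`|sin (pi * d)|^-1) => M.
have tel : 2 * sin (pi * d) * \sum_(N < M) cos (2 * pi * ((N.+1)%:R * d)) =
    sin (pi * d * (M.*2.+1)%:R) - sin (pi * d).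
  elim: M => [|M IH]; first by rewrite big_ord0 mulr0 mulr1 subrr.
  rewrite big_ord_recr/= mulrDr IH doubleS.
  have -> : pi * d * (M.*2.+3)%:R = 2 * pi * (M.+1%:R * d) + pi * d.
    by rewrite -[M.*2.+3]addn1 -doubleS -muln2 natrD natrM; ring.
  have -> : pi * d * (M.*2.+1)%:R = 2 * pi * (M.+1%:R * d) - pi * d.
    by rewrite -addn1 -muln2 -natr1 natrD natrM; ring.
  by rewrite sinB sinD; ring.
have : `|2 * sin (pi * d) * \sum_(N < M) cos (2 * pi * ((N.+1)%:R * d))| <= 2.
  by rewrite tel (le_trans (ler_normB _ _))// -[leRHS]/(1 + 1) lerD// sin_max.
rewrite -mulrA normrM ger0_norm// ger_pMr// normrM.
by rewrite -[_^-1]mul1r ler_pdivlMr ?normr_gt0// mulrC.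
Qed.

Lemma sum_growth (I : eqType) (l : seq I) (F : I -> nat -> R) (b : R) :
  (forall p, p \in l -> exists K, forall M, b * M%:R - K <= F p M) ->
  exists K, forall M, (size l)%:R * b * M%:R - K <= \sum_(p <- l) F p M.
Proof.
elim: l => [|p l IH] H; first by exists 0 => M; rewrite big_nil !mul0r subrr.
have [K1 H1] := H p (mem_head _ _).
have [|K2 H2] := IH; first by move=> q ql; apply: H; rewrite inE ql orbT.
exists (K1 + K2) => M; rewrite big_cons /= -natr1.
by move: (H1 M) (H2 M); lra.
Qed.

Lemma sqr_sumE N l : cos_sum (dilate N l) ^+ 2 + sin_sum (dilate N l) ^+ 2 =
  \sum_(p <- l) \sum_(q <- l) (p.2 * q.2)%:~R * cos (2 * pi * (N%:R * (p.1 - q.1))).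
Proof.
rewrite /cos_sum /sin_sum !big_map !expr2 !mulr_suml -big_split/=.
apply: eq_bigr => p _; rewrite !mulr_sumr -big_split/=; apply: eq_bigr => q _.
by rewrite 2!mulrBr cosB intrM; ring.
Qed.

(* Averaging over N: the mean of the squared sums is at least size l, while signed_sum_bound
   would bound it by 2. *)
Lemma exists_short_levels l : signed l -> balanced l -> (2 < size l)%N ->
  (forall p q, p \in l -> q \in l -> cos (2 * pi * (p.1 - q.1)) = 1 -> p.2 = q.2) ->
  exists N al, (0 < N)%N /\ forall n v, ~~ all_cross n v (arranged al (dilate N l)).
Proof.
move=> sl bl sz co; apply: contrapT => noN.
have alt N al : exists n v, all_cross n v (arranged al (dilate N.+1 l)).
  apply: contrapT => H; apply: noN; exists N.+1, al; split=> // n v.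
  by apply/negP => c; apply: H; exists n, v.
have up N : cos_sum (dilate N.+1 l) ^+ 2 + sin_sum (dilate N.+1 l) ^+ 2 <=
    2 - 2 * cos (2 * pi * (N.+1%:R * moment l)).
  have -> : N.+1%:R * moment l = moment (dilate N.+1 l).
    by rewrite /moment big_map mulr_sumr; apply: eq_bigr => p _; rewrite mulrCA.
  apply: signed_sum_bound => //; first by rewrite /signed all_map.
  by rewrite /balanced big_map.
have [K HK] : exists K, forall M, - K <= \sum_(N < M) cos (2 * pi * ((N.+1)%:R * moment l)).
  have [[_ e]|[K HK]] := cos_partial_sum (moment l).
    by exists 0 => M; rewrite e oppr0.
  by exists K => M; have := HK M; rewrite ler_norml => /andP[].
pose G p q M := (p.2 * q.2)%:~R * \sum_(N < M) cos (2 * pi * ((N.+1)%:R * (p.1 - q.1))) : R.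
have s2 p q : p \in l -> q \in l -> `|(p.2 * q.2)%:~R : R| = 1.
  move=> /(allP sl) /orP[]/eqP -> /(allP sl) /orP[]/eqP ->;
  by rewrite ?mulr1 ?mul1r ?mulrN1 ?opprK ?mulrN1z ?normrN normr1.
(* A contribution is unbounded only if the two jumps coincide modulo 1, and then their signs agree
   by [co], so that it is nonnegative. *)
have G0 p q : p \in l -> q \in l -> exists K, forall M, 0 * M%:R - K <= G p q M.
  move=> pl ql; rewrite /G; have [[c1 e]|[K' HK']] := cos_partial_sum (p.1 - q.1).
    exists 0 => M; rewrite e (co p q pl ql c1).
    by case/orP: (allP sl _ ql) => /eqP ->; rewrite ?mulr1 ?mulrN1 ?opprK mul0r subr0 mul1r.
  exists K' => M; rewrite mul0r add0r lerNl (le_trans (ler_norm _))//.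
  by rewrite normrN normrM s2// mul1r.
have G1 p : p \in l -> exists K, forall M, 1 * M%:R - K <= \sum_(q <- l) G p q M.
  move=> pl; have [|K' HK'] := @sum_growth _ (rem p l) (G p) 0.
    by move=> q /mem_rem ql; exact: G0.
  exists K' => M; rewrite (perm_big _ (perm_to_rem pl)) big_cons /=.
  have -> : G p p M = M%:R.
    rewrite /G subrr; under eq_bigr do rewrite !mulr0 cos0.
    rewrite sumr_const card_ord.
    by case/orP: (allP sl _ pl) => /eqP ->; rewrite ?mulr1 ?mulrN1 ?opprK mul1r.
  have := HK' M; lra.
have [K1 H1] := sum_growth G1.
have low M : (size l)%:R * 1 * M%:R - K1 <= 2 * M%:R + 2 * K.
  apply: le_trans (H1 M) _.
  have -> : \sum_(p <- l) \sum_(q <- l) G p q M =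
     \sum_(N < M) (cos_sum (dilate N.+1 l) ^+ 2 + sin_sum (dilate N.+1 l) ^+ 2).
    under [RHS]eq_bigr do rewrite sqr_sumE.
    rewrite [RHS]exchange_big/=; apply: eq_bigr => p _.
    by rewrite [RHS]exchange_big/=; apply: eq_bigr => q _; rewrite -mulr_sumr.
  have : \sum_(N < M) (cos_sum (dilate N.+1 l) ^+ 2 + sin_sum (dilate N.+1 l) ^+ 2) <=
      \sum_(N < M) (2 - 2 * cos (2 * pi * (N.+1%:R * moment l))).
    by apply: ler_sum => N _; exact: up.
  move=> /le_trans; apply.
  rewrite sumrB sumr_const card_ord -[2 *+ M]mulr_natr -mulr_sumr; have := HK M; set S := \sum_(_ < _) _; lra.
(* As the size is at least 3, [low] yields M <= K1 + 2 K for all M, which fails for this M. *)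
have := low (Num.bound `|K1 + 2 * K|); have := archi_boundP (normr_ge0 (K1 + 2 * K)).
have := ler_norm (K1 + 2 * K); set b : R := (Num.bound _)%:R.
have : 3 <= (size l)%:R :> R by rewrite ler_nat.
have b0 : 0 <= b by rewrite ler0n.
by set s := (size l)%:R; nra.
Qed.

(** Dirichlet's pigeonhole gives a multiple close to an integer, but possibly below it. If it falls
    short by - del, the largest m with m * (- del) <= 1 leads to a multiple less than - del above an
    integer. *)
Lemma small_fractional_multiple (theta kappa : R) : 0 < kappa ->
  exists2 N, (0 < N)%N & N%:R * theta - (floorR (N%:R * theta))%:~R < kappa.
Proof.
move=> k0; pose K := (Num.bound kappa^-1).+1.
have Kp : 0 < K%:R :> R by rewrite ltr0n.
have Kk : K%:R^-1 < kappa.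
  rewrite -[kappa]invrK ltf_pV2 ?posrE ?invr_gt0//.
  apply: (@lt_le_trans _ _ (Num.bound kappa^-1)%:R); last by rewrite ler_nat.
  by apply: archi_boundP; rewrite invr_ge0 ltW.
pose fr (x : R) := x - (floorR x)%:~R.
have fr01 x : 0 <= fr x < 1.
  by have /andP[h1 h2] := floor_itvP x; rewrite /fr /floorR; apply/andP; split; lra.
have frE (x y : R) (z : int) : x = y + z%:~R -> 0 <= y < 1 -> fr x = y.
  by move=> -> y01; rewrite /fr floorRDz (@floorR_eq _ y 0) ?add0r// addrK.
pose f (i : 'I_K.+1) : 'I_K := inord (Num.truncn (K%:R * fr ((i : nat)%:R * theta))).
have fE i : (f i : nat) = Num.truncn (K%:R * fr ((i : nat)%:R * theta)).
  rewrite inordK//; have /andP[h0 h1] := fr01 ((i : nat)%:R * theta).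
  rewrite -(ltr_nat R); apply: le_lt_trans (_ : K%:R * fr ((i : nat)%:R * theta) < _).
    by rewrite truncn_le mulr_ge0// ltW.
  by rewrite -[ltRHS]mulr1 ltr_pM2l.
have /injectivePn[i [j ij e]] : ~~ injectiveb f.
  apply/negP => /injectiveP /leq_card; by rewrite !card_ord ltnn.
wlog lij : i j ij e / (i < j)%N.
  move=> H; have [|ji|/val_inj/eqP] := ltngtP i j; first exact: H.
    by apply: (H j i) => //; rewrite eq_sym.
  by rewrite (negPf ij).
pose n := (j - i)%N; have n0 : (0 < n)%N by rewrite subn_gt0.
pose del := fr ((j : nat)%:R * theta) - fr ((i : nat)%:R * theta).
have [z ez] : exists z : int, n%:R * theta = del + z%:~R.
  exists (floorR ((j : nat)%:R * theta) - floorR ((i : nat)%:R * theta)).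
  by rewrite /del /fr natrB 1?ltnW// intrB; ring.
have : `|del| < K%:R^-1.
  have ti := truncn_itv (mulr_ge0 (ltW Kp) (andP (fr01 ((i : nat)%:R * theta))).1).
  have tj := truncn_itv (mulr_ge0 (ltW Kp) (andP (fr01 ((j : nat)%:R * theta))).1).
  move: ti tj; rewrite -!fE e -natr1 => /andP[i0 i1] /andP[j0 j1].
  rewrite -(ltr_pM2l Kp) divff ?gt_eqF// -{1}(gtr0_norm Kp) -normrM /del mulrBr.
  by rewrite ltr_norml; apply/andP; split; lra.
have K1 : K%:R^-1 <= 1 :> R by rewrite invf_le1// ler1n.
rewrite ltr_norml => /andP[d1 d2].
have [d0|d0] := leP 0 del.
  exists n => //; rewrite -/(fr _) (frE _ _ _ ez); first lra.
  by rewrite d0 /=; lra.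
pose m := Num.truncn (- del)^-1.
have nd : 0 < - del by rewrite oppr_gt0.
have /andP[m1 m2] := truncn_itv (ltW (eqbRL (invr_gt0 (- del)) nd)).
rewrite -/m in m1 m2.
have m0 : (0 < m)%N by rewrite truncn_gt0 invf_ge1// lerNl; lra.
exists (m * n)%N; first by rewrite muln_gt0 m0.
have e1 : m%:R * (- del) <= 1 by rewrite -ler_pdivlMr// div1r.
have e2 : 1 < m.+1%:R * (- del) by rewrite -ltr_pdivrMr// div1r.
have mr : 1 <= m%:R :> R by rewrite ler1n.
have /frE : (m * n)%:R * theta = (1 + m%:R * del) + (m%:Z * z - 1)%:~R.
  by rewrite natrM -mulrA ez intrD intrM; ring.
rewrite -/(fr _) => ->; last by apply/andP; split; nra.
by move: e2; rewrite -natr1; nra.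
Qed.

End SignedExponentialSums.

(** * Superlevel sets of step functions *)

Section StepSets.
Variable R : realType.
Implicit Types (l : seq (R * int)) (h T t : R) (c : int).

Lemma good_eq T (A B : R -> bool) : A =1 B -> good T A -> good T B.
Proof. by move=> /funext ->. Qed.

Lemma good_translate (u T : R) (A : R -> bool) : 0 < T -> measurable_fun setT A ->
  (forall x, A (x + T) = A x) -> good T (fun t => A (t + u)) -> good T A.
Proof.
move=> T0 mA PA [L [L1 L2 L3]]; exists L; split.
- move=> [x xT Ax]; apply: L1.
  pose z := floorR ((x - u) / T); exists (x - u - z%:~R * T).
    have /andP[h1 h2] := floor_itvP ((x - u) / T); rewrite -/(floorR _) -/z in h1 h2.
    move: h1 h2; rewrite ler_pdivlMr// ltr_pdivrMr// => h1 h2.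
    by apply/andP; split; lra.
  have -> : x - u - z%:~R * T + u = x + (- z)%:~R * T by rewrite mulrNz mulNr addrAC subrK.
  by rewrite (periodicZ PA).
- apply: (@lower_window _ 0 u) => //; exact: lower_translate.
- apply: (@total_window _ 0 u) => //; exact: total_translate.
Qed.

Lemma step_perm T c l l' t : perm_eq l l' -> step T c l t = step T c l' t.
Proof. by move=> ll; rewrite /step /jump_sum (perm_big _ ll). Qed.

Lemma frac_bounds (x : R) : 0 <= x - (floorR x)%:~R < 1.
Proof. by have /andP[h1 h2] := floor_itvP x; rewrite /floorR; apply/andP; split; lra. Qed.

(** Two opposite jumps therefore produce two values only, the larger one on an arc whose relative
    length is the fractional part of w. *)
Lemma floor_pair (u w : R) : floorR u - floorR (u - w) =
  floorR w + (u - (floorR u)%:~R < w - (floorR w)%:~R).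
Proof.
have /andP[u0 u1] := frac_bounds u; have /andP[w0 w1] := frac_bounds w.
set fu := floorR u in u0 u1 *; set fw := floorR w in w0 w1 *.
case: ltP => uw /=.
  rewrite (@floorR_eq _ (u - w) (fu - fw - 1)); first by lia.
  by rewrite !intrB; apply/andP; split; lra.
rewrite (@floorR_eq _ (u - w) (fu - fw)); first by lia.
by rewrite !intrB; apply/andP; split; lra.
Qed.

(** The bound 1 / (24 pi) on the relative length r is where 2 pi r reaches the 1/12 of [good_arc].
    Only one threshold separates the two values; for the others the superlevel set is full or
    empty. *)
Lemma good_level_pair h c (x y : R) (m : nat) : 0 < h ->
  (y - x) / h - (floorR ((y - x) / h))%:~R < (24 * pi)^-1 ->
  good h (fun t => m%:Z < step h c [:: (x, 1); (y, -1)] t).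
Proof.
move=> h0; set w := (y - x) / h; set r := w - _ => rs; have p0 := pi_gt0 R.
have /andP[r0 r1] := frac_bounds w; rewrite -/r in r0 r1.
have stepE t : step h c [:: (x, 1); (y, -1)] t =
    c + floorR w + ((t - x) / h - (floorR ((t - x) / h))%:~R < r)%R.
  rewrite /step /jump_sum !big_cons big_nil /= mul1r mulN1r addr0.
  have -> : (t - y) / h = (t - x) / h - w by rewrite /w; field; rewrite gt_eqF.
  by rewrite floor_pair addrA.
have [hi|lo] := ltP m%:Z (c + floorR w).
  by apply: good_full => // t _; rewrite stepE; lia.
have [hi|hi] := ltP (c + floorR w) m%:Z.
  by apply: good_empty => t _; rewrite stepE; lia.
have {lo hi}e : c + floorR w = m by lia.
pose A t := (t - x) / h - (floorR ((t - x) / h))%:~R < r.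
apply: (@good_eq _ A); first by move=> t; rewrite stepE e /A; case: ltP => _ /=; lia.
have mA : measurable_fun setT A.
  apply: measurable_fun_ltr; last exact: measurable_cst.
  have mu : measurable_fun setT (fun t : R => (t - x) / h).
    apply: measurable_funM; last exact: measurable_cst.
    exact: (@measurable_shift R (- x)).
  apply: measurable_funB => //; exact: (measurableT_comp (@measurable_floor R)).
apply: (@good_translate x) => //.
  move=> t; rewrite /A (_ : (t + h - x) / h = (t - x) / h + 1%:~R); last by field; rewrite gt_eqF.
  by rewrite floorRDz intrD; congr (_ < _); ring.
have At t : 0 <= t < h -> A (t + x) = (t < r * h).
  move=> /andP[t0 t1]; rewrite /A addrK (@floorR_eq _ (t / h) 0) ?subr0; first by rewrite ltr_pdivrMr.
  by rewrite divr_ge0 ?(ltW h0)//= ltr_pdivrMr// add0r mul1r.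
have [rz|rz] := eqVneq r 0.
  by apply: good_empty => t tI; rewrite At// rz mul0r ltNge; have /andP[-> _] := tI.
apply: (@good_arc _ (r * h)) => //.
- by rewrite mulr_gt0// lt_neqAle eq_sym rz.
- by rewrite ger_pMl// ltW.
- rewrite (_ : 2 * pi / h * (r * h) = 2 * pi * r); last by field; rewrite gt_eqF.
  apply: (@le_trans _ _ (2 * pi * (24 * pi)^-1)); first by rewrite ler_wpM2l ?mulr_ge0 ?(ltW p0) ?(ltW rs).
  by rewrite -mulf_div divff ?lt0r_neq0// mulr1; lra.
- by apply: (measurableT_comp mA); exact: (@measurable_shift R x).
Qed.

(** For a function with values 0 and 1, the number of points of a fibre in the set is the sum over
    the fibre, which is the folded step function. *)
Lemma level_step N h c l m t : (0 < N)%N -> 0 < h ->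
  (forall t, 0 <= step (N%:R * h) c l t <= 1) ->
  level N h (fun t => step (N%:R * h) c l t == 1) m t = (m%:Z < step h (N%:Z * c) l t).
Proof.
move=> N0 h0 s01; rewrite -step_fold// /level.
suff -> : \sum_(j < N) step (N%:R * h) c l (t + (j : nat)%:R * h) =
    #|fiber N h (fun t => step (N%:R * h) c l t == 1) t|%:Z by [].
rewrite -[RHS]natz -sum1_card natr_sum [RHS]big_mkcond; apply: eq_bigr => j _.
rewrite inE; have := s01 (t + (j : nat)%:R * h); set v := step _ _ _ _.
by case: eqP => [->|] //; lia.
Qed.

Lemma good_step T c l : 0 < T -> signed l -> balanced l ->
  (forall t, 0 <= step T c l t <= 1) -> good T (fun t => step T c l t == 1).
Proof.
(* Period and constant are generalized because folding changes both. *)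
elim: {l}_.+1 {-2}l (ltnSn (size l)) T c => // k IH l lk T c T0 sl bl s01.
have Npos N : (0 < N)%N -> 0 < T / N%:R by move=> N0; rewrite divr_gt0// ltr0n.
have TN N : (0 < N)%N -> T = N%:R * (T / N%:R).
  by move=> N0; rewrite mulrCA divff ?mulr1// pnatr_eq0 -lt0n.
have split_period N : (0 < N)%N ->
    (forall m, good (T / N%:R) (fun t => m%:Z < step (T / N%:R) (N%:Z * c) l t)) ->
    good T (fun t => step T c l t == 1).
  move=> N0 gl; rewrite {1}(TN N N0); apply: good_combine => //; first exact: Npos.
    exact: measurable_step.
  move=> m mN; apply: good_eq (gl m) => t.
  by rewrite {3}(TN N N0) level_step ?Npos// => u; rewrite -(TN N N0).
have pair (x y : R) : perm_eq l [:: (x, 1); (y, -1)] -> good T (fun t => step T c l t == 1).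
  move=> lE; have p0 : 0 < (24 * pi)^-1 :> R by rewrite invr_gt0 mulr_gt0 ?pi_gt0.
  have [N N0 fN] := small_fractional_multiple ((y - x) / T) p0.
  apply: (split_period N) => // m.
  apply: (@good_eq _ (fun t => m%:Z < step (T / N%:R) (N%:Z * c) [:: (x, 1); (y, -1)] t)).
    by move=> t; rewrite (step_perm _ _ _ lE).
  apply: good_level_pair; first exact: Npos.
  by rewrite (_ : (y - x) / (T / N%:R) = N%:R * ((y - x) / T)) // invf_div; ring.
have [big|small] := ltnP 2 (size l); last first.
  case: l bl sl {lk} small split_period pair s01 => [|p [|q [|//]]] bl sl _ _ pair s01.
  - have E t : step T c [::] t = c by rewrite /step /jump_sum big_nil addr0.
    have [e|ne] := eqVneq c 1; first by apply: good_full => // t _; rewrite E e.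
    by apply: good_empty => t _; rewrite E; exact/negbTE.
  - move: bl sl; rewrite /balanced big_cons big_nil /= addr0 => ->; by [].
  - move: bl sl; rewrite /balanced !big_cons big_nil /= addr0 andbT => b.
    case: p b pair {s01} => x s; case: q => y s' /= b pair.
    have -> : s' = - s by lia.
    case/andP=> /orP[]/eqP es _; move: pair; rewrite (_ : s' = - s) ?es ?opprK; try lia.
      by move/(_ x y); apply.
    by move/(_ y x); apply; rewrite (perm_catC [:: _] [:: _]).
have [co|co] := pselect (forall p q, p \in scaled T l -> q \in scaled T l ->
    cos (2 * pi * (p.1 - q.1)) = 1 -> p.2 = q.2).
  have [] := @exists_short_levels R (scaled T l) _ _ _ co.
  - by rewrite /signed all_map.
  - by rewrite /balanced big_map.
  - by rewrite size_map.
  move=> N [al [N0 short]]; apply: (split_period N) => // m.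
  set h := T / N%:R; have h0 : 0 < h by exact: Npos.
  have [c' [l' [sl' bl' _ ss E]]] := @superlevel_step R al h (N%:Z * c) m.+1 l h0 sl bl.
  apply: (@good_eq _ (fun t => step h c' l' t == 1)).
    by move=> t; rewrite -E /above -[RHS]/(m.+1%:Z <= _); case: ifP.
  apply: IH => //; last by move=> t; rewrite -E /above; case: ifP.
  rewrite -ltnS (leq_trans _ lk)// ltnS; apply: ss.
  (* Measured in units of the new period T / N, the jumps are dilated by N. *)
  suff -> : scaled h l = dilate N (scaled T l) by exact: short.
  rewrite /dilate /scaled -map_comp; apply: eq_map => p /=.
  by congr (_, _); rewrite /h invf_div; ring.
have [p [q [pl ql e ne]]] : exists p q, [/\ p \in l, q \in l,
    cos (2 * pi * (p.1 / T - q.1 / T)) = 1 & p.2 != q.2].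
  apply: contrapT => H; apply: co => _ _ /mapP[p pl ->] /mapP[q ql ->] /= e.
  by apply/eqP/negPn/negP => ne; apply: H; exists p, q.
have qr : q \in rem p l.
  have := ql; rewrite (perm_mem (perm_to_rem pl)) inE => /orP[/eqP qp|//].
  by rewrite qp eqxx in ne.
pose l2 := rem q (rem p l).
have lE : perm_eq l [:: p, q & l2].
  by apply: (perm_trans (perm_to_rem pl)); rewrite perm_cons perm_to_rem.
have sl2 := sl; rewrite /signed (perm_all _ lE) /= in sl2.
have /and3P[sp sq sl2'] := sl2.
have pq : p.2 + q.2 = 0 by move: sp sq ne => /orP[]/eqP -> /orP[]/eqP ->.
have bl2 : balanced l2.
  by move: bl; rewrite /balanced (perm_big _ lE) !big_cons /= addrA pq add0r.
set z := Num.floor (p.1 / T - q.1 / T).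
have ez : p.1 / T = q.1 / T + z%:~R.
  by rewrite -[z%:~R]/((Num.floor _)%:~R) -(cos_2pi_eq1 e); ring.
(* Opposite jumps at points z periods apart contribute only the constant - p.2 z, so the pair is
   removed and the induction applies directly. *)
have E t : step T c l t = step T (c - p.2 * z) l2 t.
  rewrite (step_perm _ _ _ lE) /step /jump_sum !big_cons /=.
  have -> : (t - q.1) / T = (t - p.1) / T + z%:~R by rewrite !mulrBl ez; ring.
  by rewrite floorRDz; move: pq => /eqP; rewrite addr_eq0 => /eqP ->; ring.
apply: (good_eq (A := fun t => step T (c - p.2 * z) l2 t == 1)); first by move=> t; rewrite E.
apply: IH => //; last by move=> t; rewrite -E.
by rewrite -ltnS (leq_trans _ lk)// ltnS (perm_size lE) /= leqW.
Qed.

End StepSets.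

(** * The Riesz-Fischer theorem *)

Section RieszFischer.
Variable R : realType.
Local Notation C := R[i].
Local Notation Re := (@complex.Re R).
Local Notation Im := (@complex.Im R).
Local Notation mu := (@lebesgue_measure R).
Implicit Types (S : set R) (f g : R -> C).

Lemma L2sqnorm_ge0 S f : (0 <= L2sqnorm S f)%E.
Proof. by apply: integral_ge0 => x _; rewrite lee_fin sqabs_ge0. Qed.

Lemma L2sqnorm_le S f (G : R -> R) : measurable S -> cmeas f -> nnmeas G ->
  (forall x, S x -> sqabs (f x) <= G x) ->
  (L2sqnorm S f <= \int[mu]_(x in S) (G x)%:E)%E.
Proof.
move=> mS mf mG fG; apply: (@ge0_le_integral _ _ _ mu) => //.
- by move=> x _; rewrite lee_fin sqabs_ge0.
- by apply: nnmeasE; exact: cmeas_sqabs.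
- by apply: nnmeasE.
Qed.

Lemma L2sqnormD S f g : measurable S -> cmeas f -> cmeas g ->
  (L2sqnorm S (fun x => f x + g x)%R <= 2%:E * L2sqnorm S f + 2%:E * L2sqnorm S g)%E.
Proof.
move=> mS mf mg; have nf := cmeas_sqabs mf; have ng := cmeas_sqabs mg.
apply: (le_trans (L2sqnorm_le (G := fun x => 2 * sqabs (f x) + 2 * sqabs (g x)) mS _ _ _)).
- exact: cmeasD.
- by apply: nnmeasD; apply: nnmeasM => //; exact: nnmeas_cst.
- by move=> x _; exact: sqabsD.
have m2 (F : R -> R) : nnmeas F -> nnmeas (fun x => 2 * F x) by move=> ?; apply: nnmeasM => //; exact: nnmeas_cst.
under eq_integral do rewrite EFinD.
rewrite ge0_integralD//.
- under eq_integral do rewrite EFinM.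
  under [X in (_ + X <= _)%E]eq_integral do rewrite EFinM.
  by rewrite !ge0_integralZl_EFin//; try exact: nnmeasE; move=> x _; rewrite lee_fin sqabs_ge0.
- by move=> x _; rewrite lee_fin mulr_ge0// sqabs_ge0.
- by apply: nnmeasE; exact: m2.
- by move=> x _; rewrite lee_fin mulr_ge0// sqabs_ge0.
- by apply: nnmeasE; exact: m2.
Qed.

Lemma L2sqnormB S f g : L2sqnorm S (fun x => f x - g x) = L2sqnorm S (fun x => g x - f x).
Proof. by apply: eq_integral => x _; rewrite sqabsB. Qed.

(** The increments from k on are at most sqrt Y / 2^n, and this series sums to 2 sqrt Y. *)
Lemma fast_cauchy (x : nat -> R) (Y : R) (k : nat) :
  (forall n, 4 ^+ (n + k) * (x (n + k).+1 - x (n + k)%N) ^+ 2 <= Y) ->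
  cvgn x /\ (x k - limn x) ^+ 2 <= 4 * Y.
Proof.
move=> H; have Y0 : 0 <= Y by apply: le_trans (H 0%N); rewrite mulr_ge0 ?sqr_ge0 ?exprn_ge0.
set s := Num.sqrt Y; have s0 : 0 <= s by exact: sqrtr_ge0.
have d n : `|x (n + k).+1 - x (n + k)%N| <= s * 2^-1 ^+ n.
  have p2 : 0 < 2 ^+ n :> R by rewrite exprn_gt0.
  rewrite exprVn ler_pdivlMr// -ler_sqr ?nnegrE ?mulr_ge0 ?(ltW p2)// sqr_sqrtr//.
  apply: le_trans (H n); rewrite exprMn real_normK ?num_real// mulrC -exprM mulnC exprM.
  rewrite ler_wpM2r ?sqr_ge0// (_ : 2 ^+ 2 = 4); last by ring.
  by rewrite ler_weXn2l ?leq_addr//; lra.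
pose y n := x (n + k)%N.
have cy : cvgn y.
  have -> : y = (fun n => y 0%N + series (fun j => y j.+1 - y j) n).
    apply/funext => n; rewrite /series /= telescope_sumr//; ring.
  apply: is_cvgD; first exact: is_cvg_cst.
  apply: normed_cvg.
  apply: (@series_le_cvg _ _ (geometric s 2^-1)) => [n|n|n|].
  - exact: normr_ge0.
  - by rewrite /= mulr_ge0// exprn_ge0// invr_ge0.
  - by rewrite /= /y addSn; exact: d.
  - by apply: is_cvg_geometric_series; rewrite ger0_norm ?invr_ge0//; lra.
have by_ n : `|y n - y 0%N| <= s * 2.
  apply: (@le_trans _ _ (s * (2 - 2 * 2^-1 ^+ n))); last first.
    rewrite ler_wpM2l// gerBl mulr_ge0// exprn_ge0// invr_ge0//.
  elim: n => [|n IH]; first by rewrite subrr normr0 expr0; lra.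
  have -> : y n.+1 - y 0%N = (y n.+1 - y n) + (y n - y 0%N) by ring.
  apply: (le_trans (ler_normD _ _)).
  have := d n; rewrite -addSn -/(y n) -/(y n.+1) => dn.
  by apply: (le_trans (lerD dn IH)); rewrite exprS; lra.
have cx : cvgn x.
  by apply/cvg_ex; have /cvg_ex[l] := cy; exists l; rewrite -(cvg_shiftn k).
have ly : limn y = limn x.
  by apply/cvg_lim => //; rewrite (cvg_shiftn k).
split=> //; rewrite -ly -[x k]/(y 0%N).
have h1 : limn y <= y 0%N + s * 2.
  by apply: limr_le => //; near=> n; have := by_ n; rewrite ler_norml => /andP[_]; lra.
have h2 : y 0%N - s * 2 <= limn y.
  by apply: limr_ge => //; near=> n; have := by_ n; rewrite ler_norml => /andP[+ _]; lra.
have : `|y 0%N - limn y| <= s * 2 by rewrite ler_norml; apply/andP; split; lra.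
rewrite -ler_sqr ?nnegrE ?mulr_ge0// real_normK ?num_real// exprMn sqr_sqrtr//; lra.
Unshelve. all: by end_near. Qed.

(* Weighting the increments by 4^n makes the pointwise bound trivially true where the series of
   increments diverges, so no null set has to be discarded. *)
Lemma riesz_fischer S (P : nat -> R -> C) (M : R) : measurable S -> (forall k, cmeas (P k)) ->
  (forall k, (L2sqnorm S (fun t => P k.+1 t - P k t)%R <= (M * 16^-1 ^+ k)%:E)%E) ->
  exists2 g, cmeas g & forall k, (L2sqnorm S (fun t => P k t - g t)%R <= (16 * M * 4^-1 ^+ k)%:E)%E.
Proof.
move=> mS mP dP.
have M0 : 0 <= M.
  by have := le_trans (L2sqnorm_ge0 _ _) (dP 0%N); rewrite lee_fin expr0 mulr1.
(* The upper limit is measurable and defined everywhere, and it is the limit where that exists. *)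
pose lp (p : C -> R) t := fine (limn_esup (fun k => (p (P k t))%:E)).
pose g t := Complex (lp Re t) (lp Im t).
have mlp (p : C -> R) : (forall k, measurable_fun setT (fun t => p (P k t))) -> measurable_fun setT (lp p).
  move=> mp; apply: (measurableT_comp (fine_measurable measurableT)).
  by apply: measurable_fun_limn_esup => k; exact/measurable_EFinP.
have mg : cmeas g by split; apply: mlp => k; case: (mP k).
exists g => // k.
pose h n t := P (n + k).+1 t - P (n + k)%N t.
(* Because of the factor 8, [fast_cauchy] charges the real and the imaginary part with half of the
   sum each. *)
pose F n t := 8 * 4 ^+ (n + k) * sqabs (h n t).
have F0 n t : 0 <= F n t by rewrite !mulr_ge0 ?exprn_ge0 ?sqabs_ge0.
have mh n : cmeas (h n) by exact: cmeasB.
have mF n : nnmeas (F n).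
  by apply: nnmeasM; [apply: nnmeas_cst; rewrite mulr_ge0 ?exprn_ge0|exact: cmeas_sqabs].
have lpE (p : C -> R) t : cvgn (fun k => p (P k t)) -> lp p t = limn (fun k => p (P k t)).
  move=> cp; rewrite /lp is_cvg_limn_esupE; last first.
    by apply/cvg_ex; exists (limn (fun k => p (P k t)))%:E; by apply: cvg_EFin; [exact: nearW|exact: cp].
  by rewrite -[fun k => _]/(EFin \o (fun k => p (P k t))) EFin_lim.
have pt t : ((sqabs (P k t - g t))%:E <= \sum_(0 <= n <oo) (F n t)%:E)%E.
  have := @nneseries_lim_ge _ (fun n => (F n t)%:E) xpredT 0.
  set Z := \big[_/_]_(0 <= n <oo) _ => HZ.
  have : (0 <= Z)%E by apply: nneseries_ge0 => n _ _; rewrite lee_fin.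
  case: Z HZ => [z| |] HZ z0; [|by rewrite leey|by []].
  have Fz n : F n t <= z.
    have := HZ n.+1 (fun n _ _ => F0 n t); rewrite big_nat_recr//= -lee_fin; apply: le_trans.
    by rewrite leeDr// sume_ge0// => i _; rewrite lee_fin.
  have key (p : C -> R) : (forall a b, p (a - b) = p a - p b) -> (forall a, p a ^+ 2 <= sqabs a) ->
      cvgn (fun k => p (P k t)) /\ (p (P k t) - limn (fun k => p (P k t))) ^+ 2 <= 4 * (z / 8).
    move=> pB p2; apply: (@fast_cauchy (fun k => p (P k t))) => n.
    rewrite -pB ler_pdivlMr//; apply: le_trans (Fz n).
    rewrite mulrC /F -mulrA ler_wpM2l// ler_wpM2l ?exprn_ge0//; exact: p2.
  have [|a|c1 k1] := key Re; [by move=> a b; rewrite cReD cReN|by rewrite lerDl sqr_ge0|].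
  have [|a|c2 k2] := key Im; [by move=> a b; rewrite cImD cImN|by rewrite lerDr sqr_ge0|].
  rewrite lee_fin /sqabs cReD cImD cReN cImN /= !lpE//; lra.
apply: (@le_trans _ _ (\int[mu]_(x in S) \sum_(0 <= n <oo) (F n x)%:E)%E).
  apply: (@ge0_le_integral _ _ _ mu) => //.
  - by move=> x _; rewrite lee_fin sqabs_ge0.
  - by apply: nnmeasE; apply: cmeas_sqabs; exact: cmeasB.
  - apply: ge0_emeasurable_sum => [n x _ _|n _]; first by rewrite lee_fin.
    exact: nnmeasE.
rewrite integral_nneseries//; last 2 first.
- by move=> n; exact: nnmeasE.
- by move=> n x _; rewrite lee_fin.
apply: (@le_trans _ _ (\sum_(0 <= n <oo) (8 * M * 4^-1 ^+ k * 4^-1 ^+ n)%:E)%E).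
  apply: lee_nneseries => [n _ _|n _]; first by apply: integral_ge0 => x _; rewrite lee_fin.
  under eq_integral do rewrite EFinM.
  have c0 : 0 <= 8 * 4 ^+ (n + k) :> R by rewrite mulr_ge0 ?exprn_ge0.
  rewrite ge0_integralZl_EFin//; last by apply: nnmeasE; exact: cmeas_sqabs.
    2: by move=> x _; rewrite lee_fin sqabs_ge0.
  apply: (le_trans (lee_wpmul2l _ (dP (n + k)%N))); first by rewrite lee_fin mulr_ge0 ?exprn_ge0.
  rewrite -EFinM lee_fin -!mulrA ler_wpM2l// mulrCA ler_wpM2l// -exprMn -exprD addnC.
  by rewrite (_ : 4 * 16^-1 = 4^-1)//; lra.
apply: lime_le; first by apply: is_cvg_nneseries => n _ _; rewrite lee_fin !mulr_ge0 ?exprn_ge0 ?invr_ge0.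
near=> N; rewrite sumEFin lee_fin -mulr_sumr.
have : \sum_(0 <= n < N) 4^-1 ^+ n <= 2 - 4 / 3 * 4^-1 ^+ N :> R.
  elim: (N) => [|m IH]; first by rewrite big_geq// expr0; lra.
  have q0 : 0 <= 4^-1 ^+ m :> R by rewrite exprn_ge0 ?invr_ge0.
  by rewrite big_nat_recr//= exprS; lra.
have q0 : 0 <= 4^-1 ^+ N :> R by rewrite exprn_ge0 ?invr_ge0.
have q1 : 0 <= M * 4^-1 ^+ k by rewrite mulr_ge0 ?exprn_ge0 ?invr_ge0.
by set u := \sum_(_ <= _ < _) _; nra.
Unshelve. all: by end_near. Qed.

End RieszFischer.

(** * From good sets to Riesz bases *)

Section RieszBasisOfGood.
Variable R : realType.
Local Notation C := R[i].
Local Notation Re := (@complex.Re R).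
Local Notation Im := (@complex.Im R).
Local Notation mu := (@lebesgue_measure R).
Implicit Types (S : set R) (T a : R).

Lemma infinite_int_enum (L : set int) : infinite_set L ->
  exists e : nat -> int, [/\ injective e, forall k, L (e k) & forall z, L z -> exists k, e k = z].
Proof.
move=> infL; have cardL : ([set: nat] #= L)%card by apply: card_esym; exact: eq_card_nat.
have [f [g fK gK]] := card_bijP cardL.
pose u (k : nat) : [set: nat] := SigSub (mem_setT k).
exists (fun k => val (f (u k))); split.
- by move=> i j /val_inj/(can_inj fK)/(congr1 val).
- by move=> k; exact: set_valP (f (u k)).
- move=> z Lz; pose w : L := SigSub (mem_set Lz); exists (val (g w)).
  rewrite (_ : u _ = g w); first by rewrite gK.
  exact: val_inj.
Qed.

(** Since [riesz_fischer] requires a geometric rate, it is applied along indices where [s] is within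
    16^-k / 2 of its limit; the triangle inequality then covers the other indices. *)
Lemma bessel_limit S T (Q : nat -> R -> C) (s : nat -> R) : measurable S -> 0 < T ->
  (forall n, cmeas (Q n)) -> cvgn s ->
  (forall m n, (L2sqnorm S (fun t => Q n t - Q m t)%R <= (T * `|s n - s m|)%:E)%E) ->
  exists2 g, cmeas g & forall n,
    (L2sqnorm S (fun t => Q n t - g t)%R <= (2 * T * `|limn s - s n|)%:E)%E.
Proof.
move=> mS T0 mQ cs Qs; set l := limn s.
have near_l k : exists n, `|l - s n| <= 2^-1 * 16^-1 ^+ k.
  have e0 : 0 < 2^-1 * 16^-1 ^+ k :> R by rewrite mulr_gt0// exprn_gt0.
  have /cvgrPdist_lt/(_ _ e0)[n _ Hn] := cs.
  by exists n; apply: ltW; exact: (Hn n (leqnn n)).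
have [nk Hnk] := choice near_l.
have [|g mg Hg] := @riesz_fischer R S (fun k => Q (nk k)) T mS (fun k => mQ _).
  move=> k; apply: (le_trans (Qs _ _)); rewrite lee_fin ler_wpM2l ?(ltW T0)//.
  have -> : s (nk k.+1) - s (nk k) = (l - s (nk k)) - (l - s (nk k.+1)) by ring.
  apply: (le_trans (ler_normB _ _)); apply: (le_trans (lerD (Hnk _) (Hnk _))).
  have q0 : 0 <= 16^-1 ^+ k :> R by rewrite exprn_ge0 ?invr_ge0.
  rewrite exprS; lra.
exists g => // n; apply/lee_addgt0Pr => eps eps0.
(* 34 = 2 + 32: the distance of s (nk k) from the limit, and twice the rate of [riesz_fischer]. *)
pose k := Num.bound (34 * T / eps).
have ke : 34 * T * 4^-1 ^+ k <= eps.
  rewrite exprVn ler_pdivrMr ?exprn_gt0// -ler_pdivrMl// mulrC ltW//.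
  apply: (@lt_trans _ _ k%:R); first by apply: archi_boundP; rewrite divr_ge0 ?mulr_ge0 ?ltW.
  by rewrite -natrX ltr_nat ltn_expl.
have -> : (fun t => Q n t - g t) = (fun t => (Q n t - Q (nk k) t) + (Q (nk k) t - g t)).
  by apply/funext => t; ring.
apply: (le_trans (L2sqnormD mS _ _)); [exact: cmeasB|exact: cmeasB|].
apply: (@le_trans _ _ (2%:E * (T * `|s n - s (nk k)|)%:E + 2%:E * (16 * T * 4^-1 ^+ k)%:E)%E).
  by apply: leeD; rewrite lee_pmul2l ?lte_fin.
rewrite -!EFinM -!EFinD lee_fin.
have d : `|s n - s (nk k)| <= `|l - s n| + 4^-1 ^+ k.
  have -> : s n - s (nk k) = (l - s (nk k)) - (l - s n) by ring.
  apply: (le_trans (ler_normB _ _)); rewrite addrC lerD2l (le_trans (Hnk k))//.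
  apply: (@le_trans _ _ (16^-1 ^+ k)); last by rewrite lerXn2r ?nnegrE ?invr_ge0//; lra.
  have q0 : 0 <= 16^-1 ^+ k :> R by rewrite exprn_ge0 ?invr_ge0.
  lra.
have := ler_wpM2l (ltW T0) d; lra.
Qed.

Lemma expi_ch T (z : int) : expi (2 * pi * z%:~R / T) = ch T z.
Proof.
by apply/funext => t; rewrite /expi /ch /cis; congr (Complex (cos _) (sin _)); ring.
Qed.

(** Moves coefficients from the enumeration index to the frequencies, so that the estimates on
    [tpoly] apply to [lincomb]. *)
Definition spread (e : nat -> int) (b : nat -> C) (z : int) : C :=
  if pselect (exists k, e k = z) is left h then b (projT1 (cid h)) else 0.

Lemma spreadE e b k : injective e -> spread e b (e k) = b k.
Proof.
move=> inj; rewrite /spread; case: pselect => [h|[]]; last by exists k.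
by case: cid => j /= /inj ->.
Qed.

Lemma spread_supported e b (L : set int) : (forall k, L (e k)) -> supported L (spread e b).
Proof.
by move=> Le z Lz; rewrite /spread; case: pselect => // -[k ek]; case: Lz; rewrite -ek.
Qed.

(** * Riesz basis from a lower inequality and totality *)

Section FromGood.
Variables (S : set R) (a T c : R) (A : R -> bool) (L : set int) (e : nat -> int).
Hypothesis mS : measurable S.
Hypothesis T0 : 0 < T.
Hypothesis mA : measurable_fun setT A.
Hypothesis SA : forall f, cmeas f -> L2sqnorm S f = N2 a T A f.
Hypothesis c0 : 0 < c.
Hypothesis low : forall s b, uniq s -> supported L b ->
    ((c * \sum_(z <- s) sqabs (b z))%:E <= N2 a T A (tpoly T s b))%E.
Hypothesis total : totalL2 a T A L.
Hypothesis e_inj : injective e.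
Hypothesis Le : forall k, L (e k).
Hypothesis eL : forall z, L z -> exists k, e k = z.

Let F k := expi (2 * pi * (e k)%:~R / T).

Lemma lincomb_tpoly b n : lincomb b F n = tpoly T (map e (iota 0 n)) (spread e b).
Proof.
apply/funext => t; rewrite /lincomb /tpoly big_map -[n in iota _ n]subn0 -/(index_iota 0 n).
by rewrite big_mkord; apply: eq_bigr => k _; rewrite spreadE// /F expi_ch.
Qed.

Lemma lincomb_diff b m n : (m <= n)%N ->
  (fun t => lincomb b F n t - lincomb b F m t) = tpoly T (map e (index_iota m n)) (spread e b).
Proof.
move=> mn; apply/funext => t; rewrite /lincomb /tpoly big_map.
rewrite -(big_mkord xpredT (fun k => b k * F k t)) -(big_mkord xpredT (fun k => b k * F k t)).
rewrite (big_cat_nat (n := m))//= addrAC subrr add0r.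
by apply: eq_bigr => k _; rewrite spreadE// /F expi_ch.
Qed.

Lemma cmeas_lincomb b n : cmeas (lincomb b F n).
Proof. by rewrite lincomb_tpoly; exact: cmeas_tpoly. Qed.

Lemma uniq_freqs m n : uniq (map e (index_iota m n)).
Proof. by rewrite map_inj_uniq// iota_uniq. Qed.

Lemma spread_sum b m n : \sum_(z <- map e (index_iota m n)) sqabs (spread e b z) =
  \sum_(m <= k < n) sqabs (b k).
Proof. by rewrite big_map; apply: eq_bigr => k _; rewrite spreadE. Qed.

Lemma lincomb_bessel b m n : (L2sqnorm S (fun t => lincomb b F n t - lincomb b F m t)%R <=
  (T * `|series (fun k => sqabs (b k)) n - series (fun k => sqabs (b k)) m|)%:E)%E.
Proof.
wlog mn : m n / (m <= n)%N.
  move=> H; have [|/ltnW nm] := leqP m n; first exact: H.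
  by rewrite L2sqnormB distrC; exact: H.
rewrite (lincomb_diff _ mn) SA; last exact: cmeas_tpoly.
apply: (le_trans (N2_tpoly_fin _ _ _ _ _)) => //; first exact: uniq_freqs.
rewrite spread_sum lee_fin ler_wpM2l ?(ltW T0)// sub_series_geq// ler_norm//.
Qed.

Lemma lincomb_lower b n :
  ((c * series (fun k => sqabs (b k)) n)%:E <= L2sqnorm S (lincomb b F n))%E.
Proof.
rewrite lincomb_tpoly -[in iota 0 n](subn0 n) -/(index_iota 0 n) SA; last exact: cmeas_tpoly.
apply: le_trans (low (uniq_freqs 0 n) (spread_supported b Le)).
by rewrite spread_sum.
Qed.

Lemma inL2_cmeas f : cmeas f -> (L2sqnorm S f < +oo)%E -> inL2 S f.
Proof. by move=> [f1 f2] fin; split; [exact: measurable_funTS|split=> //; exact: measurable_funTS]. Qed.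

Lemma inL2_exp k : inL2 S (F k).
Proof.
apply: inL2_cmeas; rewrite /F expi_ch; first exact: cmeas_ch.
have -> : ch T (e k) = tpoly T [:: e k] (fun=> 1).
  by apply/funext => t; rewrite /tpoly big_seq1 mul1r.
rewrite SA; last exact: cmeas_tpoly.
by apply: (le_lt_trans (N2_tpoly_fin _ _ _ _ _)) => //; rewrite ltry.
Qed.

Lemma complete_exp : complete_in S F.
Proof.
move=> g [g1 [g2 gfin]] eps eps0.
(* [inL2] gives measurability on [S] only, whereas [totalL2] asks for a function measurable on the
   line. *)
pose g' t := Complex (((fun x => Re (g x)) \_ S) t) (((fun x => Im (g x)) \_ S) t).
have gg' t : S t -> g' t = g t.
  by move=> St; rewrite /g' /patch mem_set//; case: (g t).
have mg' : cmeas g' by split; apply/(measurable_restrictT _ mS).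
have eqS (f : R -> C) : L2sqnorm S (fun t => g t - f t) = L2sqnorm S (fun t => g' t - f t).
  by apply: eq_integral => t /set_mem St; rewrite gg'.
have [|s [al [us Lal Hs]]] := @total g' mg' _ (eps / 2) (divr_gt0 eps0 (ltr0Sn R 1)).
  rewrite -SA// (_ : L2sqnorm S g' = L2sqnorm S g)//.
  by apply: eq_integral => t /set_mem St; rewrite gg'.
have [N HN] : exists N, forall z, z \in s -> L z -> z \in map e (iota 0 N).
  elim: (s) => [|z s' [N IH]]; first by exists 0%N.
  have [Lz|nLz] := pselect (L z); last first.
    by exists N => z'; rewrite inE => /orP[/eqP -> //|]; exact: IH.
  have [k ek] := eL Lz; exists (maxn N k.+1) => z'; rewrite inE => /orP[/eqP -> _|zs Lz'].
    by apply/mapP; exists k => //; rewrite mem_iota add0n leq_max ltnSn orbT.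
  have /mapP[j] := IH _ zs Lz'; rewrite mem_iota add0n => /= jN ->.
  by apply/mapP; exists j => //; rewrite mem_iota add0n leq_max jN.
exists N, (fun k => if e k \in s then al (e k) else 0).
rewrite eqS SA; last by apply: cmeasB => //; exact: cmeas_lincomb.
rewrite (_ : lincomb _ F N = tpoly T s al); first by apply: (le_lt_trans Hs); rewrite lte_fin; lra.
apply/funext => t; rewrite lincomb_tpoly /tpoly.
transitivity (\sum_(z <- map e (iota 0 N) | z \in s) al z * ch T z t).
  rewrite [RHS]big_mkcond !big_map; apply: eq_bigr => k _; rewrite spreadE//.
  by case: ifP => // _; rewrite mul0r.
transitivity (\sum_(z <- s | z \in map e (iota 0 N)) al z * ch T z t).
  rewrite -big_filter -[RHS]big_filter; apply: perm_big; apply: uniq_perm.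
  - by rewrite filter_uniq// map_inj_uniq// iota_uniq.
  - by rewrite filter_uniq.
  - by move=> z; rewrite !mem_filter andbC.
rewrite big_mkcond big_seq [RHS]big_seq; apply: eq_bigr => z zs.
case: ifP => // zN; rewrite Lal ?mul0r// => Lz.
by rewrite HN in zN.
Qed.

Lemma riesz_basis_exp : riesz_basis S F.
Proof.
split; [exact: inL2_exp|split; first exact: complete_exp].
(* Each constant loses a factor 2 in passing from partial sums to the limit [g]; the minimum ensures
   that the lower constant does not exceed the upper one. *)
exists (Num.min (c / 2) (2 * T)), (2 * T); split.
  by rewrite lt_min divr_gt0//= mulr_gt0.
split; first by rewrite ge_min lexx orbT.
move=> b cb; pose s := series (fun k => sqabs (b k)).
have [g mg Hg] := bessel_limit mS T0 (cmeas_lincomb b) cb (lincomb_bessel b).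
rewrite -/s in cb Hg; have sge n : s n <= limn s.
  apply: nondecreasing_cvgn_le => //; apply: nondecreasing_series => k _ _; exact: sqabs_ge0.
have s0 : 0 <= limn s by have := sge 0%N; rewrite /s /series /= big_geq.
have up : (L2sqnorm S g <= (2 * T * limn s)%:E)%E.
  have := Hg 0%N; rewrite {2}/s /series /= big_geq// subr0 ger0_norm//.
  rewrite (_ : L2sqnorm S _ = L2sqnorm S g)//; apply: eq_integral => t _.
  by rewrite /lincomb big_ord0 sub0r sqabsN.
exists g; split; first by apply: inL2_cmeas => //; apply: (le_lt_trans up); rewrite ltry.
split.
  apply: (@squeeze_cvge _ _ _ _ (fun=> 0%E) _ (fun n => (2 * T * `|limn s - s n|)%:E)).
  - by near=> n; rewrite L2sqnorm_ge0 Hg.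
  - exact: cvg_cst.
  - apply: cvg_EFin; first exact: nearW.
    rewrite -[X in _ --> X](mulr0 (2 * T)); apply: cvgMr.
    rewrite -[X in _ --> X](normr0 R); apply: cvg_norm.
    rewrite -(subrr (limn s)); apply: cvgB; first exact: cvg_cst.
    exact: cb.
split; last exact: up.
apply: (@le_trans _ _ (c / 2 * limn s)%:E).
  by rewrite lee_fin ler_wpM2r// ge_min lexx.
have gfin : L2sqnorm S g \is a fin_num.
  by rewrite ge0_fin_numE ?L2sqnorm_ge0// (le_lt_trans up)// ltry.
rewrite -(fineK gfin) lee_fin; set G := fine _.
have bound n : c * s n <= 2 * G + 4 * T * `|limn s - s n|.
  rewrite -lee_fin; apply: (le_trans (lincomb_lower b n)).
  have -> : lincomb b F n = (fun t => g t + (lincomb b F n t - g t)) by apply/funext => t; ring.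
  apply: (le_trans (L2sqnormD mS mg _)); first by apply: cmeasB => //; exact: cmeas_lincomb.
  rewrite (EFinD (2 * G)) (EFinM 2 G) fineK// leeD2l//.
  rewrite (_ : 4 * T * _ = 2 * (2 * T * `|limn s - s n|)); last by ring.
  by rewrite EFinM lee_pmul2l ?lte_fin.
have lim1 : c * limn s <= 2 * G.
  have h1 : (fun n => c * s n - 4 * T * `|limn s - s n|) @ \oo --> c * limn s - 4 * T * `|limn s - limn s|.
    apply: cvgB; first by apply: cvgMr; exact: cb.
    by apply: cvgMr; apply: cvg_norm; apply: cvgB; [exact: cvg_cst|exact: cb].
  rewrite subrr normr0 mulr0 subr0 in h1; rewrite -(cvg_lim _ h1)//.
  apply: limr_le; first by apply/cvg_ex; exists (c * limn s).
  by near=> n; have := bound n; lra.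
lra.
Unshelve. all: by end_near. Qed.

End FromGood.

(** [E] absorbs the end points, at which the given intervals and the half-open ones of the step
    function may differ. *)
Lemma L2sqnorm_window S a T (A : R -> bool) (E : set R) f : measurable S ->
  measurable_fun setT A -> countable E ->
  (forall t, ~ E t -> S t <-> a <= t < a + T /\ A t) -> cmeas f ->
  L2sqnorm S f = N2 a T A f.
Proof.
move=> mS mA cE SE mf.
have mE : measurable E by apply: countable_measurable => // t; exact: measurable_set1.
have E0 := countable_lebesgue_measure0 cE.
rewrite /L2sqnorm /N2 /wint.
rewrite (@ge0_negligible_integral _ _ _ mu S E)//; last 2 first.
- by apply: nnmeasE; exact: cmeas_sqabs.
- by move=> x _; rewrite lee_fin sqabs_ge0.
rewrite [RHS](@ge0_negligible_integral _ _ _ mu _ E)//; last 2 first.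
- by apply: nnmeasE; exact: nnmeas_N2.
- by move=> x _; rewrite lee_fin mulr_ge0// sqabs_ge0.
rewrite integral_mkcond [RHS]integral_mkcond; apply: eq_integral => t _.
rewrite /patch; case: (boolP (t \in S `\` E)) => [/set_mem[St Et]|tSE].
  have [tw At] := (SE t Et).1 St.
  by rewrite mem_set//= ?in_itv//= At mul1r.
case: ifPn => // /set_mem[/=]; rewrite in_itv/= => tw Et.
case: (boolP (A t)) => [At|_]; last by rewrite mul0r.
by case/negP: tSE; apply/mem_set; split=> //; exact/(SE t Et).
Qed.

(** The intervals may overlap, so their jumps together count the intervals over t; the indicator of
    the union is the superlevel set of this count at 1. *)
Lemma indicator_step a T n (x y : 'I_n -> R) : 0 < T ->
  (forall i, [/\ a <= x i, x i < y i & y i <= a + T]) ->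
  exists c l, [/\ signed l, balanced l, (forall t, 0 <= step T c l t <= 1) &
    forall t, a <= t < a + T -> (step T c l t == 1) = [exists i, x i <= t < y i]].
Proof.
move=> T0 xy.
pose l0 : seq (R * int) := [seq (x i, 1) | i <- index_enum 'I_n] ++ [seq (y i, -1) | i <- index_enum 'I_n].
have sl0 : signed l0.
  by rewrite /signed all_cat !all_map; apply/andP; split; apply/allP.
have bl0 : balanced l0.
  by rewrite /balanced /l0 big_cat/= !big_map -big_split/= big1// => i _; rewrite subrr.
have [c [l [sl bl _ _ E]]] := @superlevel_step R 0 T 0 1 l0 T0 sl0 bl0.
exists c, l; split=> //.
  by move=> t; rewrite -E /above; case: ifP.
move=> t /andP[ta tT]; rewrite -E.
have -> : step T 0 l0 t = \sum_(i < n) ((x i <= t < y i)%R : nat)%:Z.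
  rewrite /step /jump_sum add0r big_cat/= !big_map -big_split/=.
  apply: eq_bigr => i _; rewrite mul1r mulN1r; have [ax xyi yT] := xy i.
  have fl (u : R) : a <= u -> u <= a + T -> t < u \/ u < a + T ->
      floorR ((t - u) / T) = ((u <= t)%R : nat)%:Z - 1.
    move=> au uT tu; case: leP => ut /=.
      apply: floorR_eq; rewrite divr_ge0 ?subr_ge0 ?(ltW T0)//= ltr_pdivrMr// add0r mul1r; lra.
    apply: floorR_eq; rewrite rmorphB rmorph0 rmorph1/=.
    rewrite ler_pdivlMr// ltr_pdivrMr//; apply/andP; split; lra.
  rewrite !fl//; try lra.
  by have [h1|h1] := leP (x i) t; have [h2|h2] := leP (y i) t => //; exfalso; lra.
rewrite /above; case: existsP => [[i it]|H].
  rewrite (_ : 1 <= _)// (bigD1 i)//= it /= lerDl sumr_ge0// => j _; by case: (_ && _).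
rewrite big1 ?ltr01//= => i _; case: (boolP (x i <= t < y i)) => // it.
by case: H; exists i.
Qed.

Lemma riesz_basis_window S a T n (b1 b2 : 'I_n -> bool) (x y : 'I_n -> R) : 0 < T -> (0 < n)%N ->
  (forall i, [/\ a <= x i, x i < y i & y i <= a + T]) ->
  S = \bigcup_(i in [set: 'I_n]) [set` Interval (BSide (b1 i) (x i)) (BSide (b2 i) (y i))] ->
  exists2 e : nat -> int, injective e & riesz_basis S (fun k => expi (2 * pi * (e k)%:~R / T)).
Proof.
move=> T0 n0 xy SE.
have [c [l [sl bl s01 lE]]] := indicator_step T0 xy.
pose A t := step T c l t == 1.
have mA : measurable_fun setT A by exact: measurable_step.
have PA t : A (t + T) = A t by rewrite /A step_period.
have mS : measurable S by rewrite SE; apply: fin_bigcup_measurable.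
pose E : set R := \bigcup_(i in [set: 'I_n]) [set x i; y i].
have cE : countable E.
  by apply: bigcup_countable => // i _; apply: finite_set_countable; exact: finite_set2.
have SA t : ~ E t -> S t <-> a <= t < a + T /\ A t.
  move=> Et; have mid i : t \in Interval (BSide (b1 i) (x i)) (BSide (b2 i) (y i)) = (x i <= t < y i).
    have tx : x i != t by apply/eqP => h; apply: Et; exists i => //; left.
    have ty : t != y i by apply/eqP => h; apply: Et; exists i => //; right.
    by rewrite in_itv; case: (b1 i) (b2 i) => -[]; rewrite /= ?lt_neqAle ?tx ?ty ?andTb.
  rewrite SE; split.
    move=> [i _ /=]; rewrite mid => it; have [ax xyi yT] := xy i.
    have tw : a <= t < a + T by case/andP: it => h1 h2; apply/andP; split; lra.
    by split=> //; rewrite /A lE//; apply/existsP; exists i.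
  by move=> [tw]; rewrite /A lE// => /existsP[i it]; exists i => //=; rewrite mid.
have [L [L1 [c' c0 low] total]] := good_step T0 sl bl s01.
have [e [e1 e2 e3]] : exists e : nat -> int,
    [/\ injective e, forall k, L (e k) & forall z, L z -> exists k, e k = z].
  apply: infinite_int_enum; apply: L1.
  have [ax xyi yT] := xy (Ordinal n0); set x0 := x _ in ax xyi.
  pose z := floorR (x0 / T); exists (x0 - z%:~R * T).
    have /andP[h1 h2] := floor_itvP (x0 / T); rewrite -/(floorR _) -/z in h1 h2.
    move: h1 h2; rewrite ler_pdivlMr// ltr_pdivrMr// => h1 h2; apply/andP; split; lra.
  rewrite -/(A _) -mulNr -mulrNz (periodicZ PA) /A lE; last by apply/andP; split; lra.
  by apply/existsP; exists (Ordinal n0); rewrite lexx xyi.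
exists e => //.
have [c1 c10 low'] : lowerL2 a T A L by apply: (@lower_window _ a 0) => //; exists c'.
have total' : totalL2 a T A L by exact: (@total_window _ a 0).
apply: (riesz_basis_exp mS T0 mA _ c10 low' total') => //.
by move=> f mf; exact: L2sqnorm_window SA mf.
Qed.

End RieszBasisOfGood.

Unset Implicit Arguments.

Theorem mainTheorem1 (R : realType) (S : set R) :
  finite_union_of_intervals S ->
  (exists lam : nat -> R, injective lam /\ riesz_basis S (fun k => expi (lam k))) /\
  (S `<=` `[0, 2 * pi]%classic ->
     exists lam : nat -> R, injective lam /\ (forall k, exists z : int, lam k = z%:~R) /\
       riesz_basis S (fun k => expi (lam k))).
Proof.
move=> [n [I [n0 [HI SE]]]]; have p0 := pi_gt0 R.
have [b1 H1] := fin_all_exists HI; have [b2 H2] := fin_all_exists H1.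
have [x H3] := fin_all_exists H2; have [y Hxy] := fin_all_exists H3.
have xy i : x i < y i by case: (Hxy i).
have {}SE : S = \bigcup_(i in [set: 'I_n]) [set` Interval (BSide (b1 i) (x i)) (BSide (b2 i) (y i))].
  by rewrite SE; apply: eq_bigcupr => i _; case: (Hxy i) => _ ->.
split.
  (* The window [-M, M[, of period 2 M, contains all the intervals up to end points; the summand 1
     makes M positive. *)
  pose M := \sum_(i < n) (`|x i| + `|y i|) + 1.
  have xyM i : `|x i| + `|y i| <= M - 1.
    rewrite /M addrK (bigD1 i)//= lerDl sumr_ge0// => j _; exact: addr_ge0.
  have M0 : 0 < M by have := xyM (Ordinal n0); have := normr_ge0 (x (Ordinal n0)); have := normr_ge0 (y (Ordinal n0)); lra.
  have T0 : 0 < 2 * M by rewrite mulr_gt0.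
  have [|e ei rb] := riesz_basis_window (a := - M) T0 n0 _ SE.
    move=> i; split=> //; have := xyM i; have := normr_ge0 (x i); have := normr_ge0 (y i);
    have := ler_norm (y i); have := ler_norm (- x i); rewrite normrN; lra.
  exists (fun k => 2 * pi * (e k)%:~R / (2 * M)); split=> // i j.
  have T1 : (2 * M)^-1 != 0 by rewrite invr_neq0// gt_eqF.
  have p1 : 2 * pi != 0 :> R by rewrite gt_eqF// mulr_gt0.
  by move=> /(mulIf T1)/(mulfI p1)/intr_inj/ei.
move=> S2; have T0 : 0 < 2 * pi :> R by rewrite mulr_gt0.
have [|e ei rb] := riesz_basis_window (a := 0) T0 n0 _ SE.
  (* The end points need not belong to [S], so their bounds are derived from interior points: one
     outside [0, 2 pi] would contradict the inclusion. *)
  move=> i; have inS t : x i < t < y i -> 0 <= t <= 2 * pi.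
    move=> /andP[xt ty]; suff /S2 : S t by rewrite /= in_itv.
    rewrite SE; exists i => //=; rewrite in_itv.
    by case: (b1 i) (b2 i) => -[] /=; rewrite ?xt ?ty ?(ltW xt) ?(ltW ty).
  split=> //; rewrite ?add0r leNgt; apply/negP => h.
    have [y0|y0] := leP (y i) 0.
      by have /andP[] := inS ((x i + y i) / 2) ltac:(move: (xy i) => ?; apply/andP; split; lra); have := xy i; lra.
    by have /andP[] := inS (x i / 2) ltac:(apply/andP; split; lra); lra.
  have [x0|x0] := leP (2 * pi) (x i).
    by have /andP[] := inS ((x i + y i) / 2) ltac:(move: (xy i) => ?; apply/andP; split; lra); have := xy i; lra.
  by have /andP[] := inS ((2 * pi + y i) / 2) ltac:(apply/andP; split; lra); lra.
exists (fun k => (e k)%:~R); split; first by move=> i j /intr_inj/ei.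
split; first by move=> k; exists (e k).
rewrite (_ : (fun k => _) = (fun k => expi (2 * pi * (e k)%:~R / (2 * pi))))//.
by apply/funext => k; rewrite mulrAC divff ?mul1r// gt_eqF.
Qed.
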